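(* Let $\mathcal X,\Theta$ be open subsets of $\mathbb R^d$ and $\mathbb R^r$ respectively. Suppose $\hat\theta_n\to\theta_*$ in probability, $\theta\mapsto\log p_\theta(x)$ is twice continuously differentiable on a closed ball $\bar B(\epsilon,\theta_* )\subset\Theta$, and that for $\mathbb Q$-a.e. $x\in\mathcal X$: (i) $\|m(x)m^\top(x)\|+\|\nabla_x\cdot(m(x)m^\top(x))\|\le f_1(x)$, and $\|\nabla_x\log p_\theta(x)\|+\|\nabla_\theta\nabla_x\log p_\theta(x)\|+\|\nabla_\theta\nabla_x\nabla_x\log p_\theta(x)\|\le f_2(x)$, with $f_1f_2,\ f_1f_2^2\in L^2(\mathbb Q)$; (ii) for $\theta\in\bar B(\epsilon,\theta_* )$, $\|\nabla_\theta\nabla_x\log p_\theta\|^2+\|\nabla_x\log p_\theta\|\,\|\nabla_\theta\nabla_\theta\nabla_x\log p_\theta\|+\|\nabla_\theta\nabla_\theta\nabla_x\log p_\theta\|+\|\nabla_\theta\nabla_\theta\nabla_x\nabla_x\log p_\theta\|\le g_1(x)$, and $f_1g_1\in L^1(\mathbb Q)$. Then, if the information tensor $g_{\mathrm{DSM}}$ is invertible at $\theta_*$, $$\sqrt n\,(\hat\theta_n-\theta_* )\xrightarrow{d}\mathcal N\Big(0,\ g_{\mathrm{DSM}}^{-1}(\theta_* )\,\Sigma_{\mathrm{DSM}}\,g_{\mathrm{DSM}}^{-1}(\theta_* )\Big),\qquad\Sigma_{\mathrm{DSM}}=\int_{\mathcal X}\nabla_\theta F_{\theta_*}(x)\otimes\nabla_\theta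 F_{\theta_*}(x)\,d\mathbb Q(x).$$
   Context: $\{\mathbb P_\theta:\theta\in\Theta\}$ are probability measures on $\mathcal X$ with positive densities $p_\theta$; $m:\mathcal X\to\mathbb R^{d\times d}$ does not depend on $\theta$; $X_1,X_2,\dots$ are i.i.d. from a probability measure $\mathbb Q$ with density $q$, in the specified setting $\mathbb Q=\mathbb P_{\theta_*}$. $F_\theta(x)=\|m^\top\nabla_x\log p_\theta(x)\|_2^2+2\nabla\cdot(mm^\top\nabla\log p_\theta)(x)$, with $(\nabla\cdot A)_i=\sum_j\partial_jA_{ji}$ for matrix fields. The diffusion score matching divergence is $\mathrm{DSM}_m(\mathbb Q\|\mathbb P_\theta)=\int\|m^\top(\nabla\log q-\nabla\log p_\theta)\|_2^2\,d\mathbb Q$, whose $\theta$-dependent part is $\int F_\theta\,d\mathbb Q$; $\theta_*=\mathrm{argmin}_{\theta\in\Theta}\mathrm{DSM}_m(\mathbb Q\|\mathbb P_\theta)=\mathrm{argmin}_{\theta\in\Theta}\int F_\theta\,d\mathbb Q$ and $\hat\theta_n=\mathrm{argmin}_{\theta\in\Theta}\frac1n\sum_{i=1}^nF_\theta(X_i)$. The information tensor is $g_{\mathrm{DSM}}(\theta)_{ij}=-\tfrac12\partial_{\alpha^i}\partial_{\theta^j}\mathrm{DSM}_m(\mathbb P_\alpha\|\mathbb P_\theta)|_{\alpha=\theta}$, with components $\int\langle m^\top\nabla\partial_{\theta^i}\log p_\theta,m^\top\nabla\partial_{\theta^j}\log p_\theta\rangle\,d\mathbb P_\theta$.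
   Formalization: The limit covariance is proved as (1/4) g^{-1} Σ g^{-1}: the Hessian of ∫F_θ dQ at θ_* is 2 g_DSM, so the printed formula is off by a factor 4 (for N(θ,1), m=1, θ_*=0 the limit variance is 1, but the printed formula gives 4). *)

(* Defs.v *)
From HB Require Import structures.
From mathcomp Require Import all_boot all_order all_algebra.
From mathcomp Require Import all_classical all_reals all_analysis.

Set Implicit Arguments.
Unset Strict Implicit.
Unset Printing Implicit Defensive.

Import Order.TTheory GRing.Theory Num.Theory.
Import numFieldNormedType.Exports.

Local Open Scope classical_set_scope.
Local Open Scope ring_scope.

(* Points of R^n are row vectors, with their Borel sigma-algebra; gradients are
   column vectors. The library norm of a matrix type is the sup norm, so
   Euclidean quantities below are written with [l2norm] or [dotc]. *)
HB.instance Definition _ (R : realType) (m n : nat) :=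
  @isMeasurable.Build (sigma_display (@open 'M[R]_(m, n))) 'M[R]_(m, n)
    <<s (@open 'M[R]_(m, n)) >> (@sigma_algebra0 _ setT _)
    (@sigma_algebraC _ _) (@sigma_algebra_bigcup _ setT _).

Section LebesgueMeasureRn.
Variable R : realType.
Notation RR := (measurableTypeR R).

Definition tcons n (p : n.-tuple RR * RR) : n.+1.-tuple RR :=
  [tuple of p.2 :: p.1].

Lemma measurable_tcons n : measurable_fun [set: n.-tuple RR * RR] (@tcons n).
Proof. by apply: measurable_cons. Qed.

Fixpoint lebesgue_tuple n : {measure set (n.-tuple RR) -> \bar R} :=
  if n is n'.+1 then
    measure_function_pushforward__canonical__measure_function_Measure
      (lebesgue_tuple n' \x lebesgue_measure)%E (@measurable_tcons n')
  else \d_([tuple] : 0.-tuple RR).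

Definition row_of_tuple n (t : n.-tuple RR) : 'rV[R]_n := \row_i tnth t i.

Lemma measurable_row_of_tuple n :
  measurable_fun [set: n.-tuple RR] (@row_of_tuple n).
Proof.
apply: (@measurability _ _ _ _ _ _ (@open 'rV[R]_n)) => //.
move=> _ [U oU <-]; rewrite setTI.
pose J := ((n.-tuple rat) * nat)%type.
pose B (j : J) : set 'rV[R]_n := ball (\row_i (ratr (tnth j.1 i) : R) : 'rV[R]_n) (j.2.+1%:R^-1).
pose V (j : J) : set (n.-tuple RR) :=
  if `[< B j `<=` U >] then @row_of_tuple n @^-1` B j else set0.
have -> : @row_of_tuple n @^-1` U = \bigcup_j V j.
  apply/seteqP; split => [t /= Ut|t [j _]]; last first.
    by rewrite /V; case: asboolP => // BU /= /BU.
  have /nbhs_ballP[e /= e0 eU] : nbhs (row_of_tuple t) U by exact: open_nbhs_nbhs.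
  have [k ke] : exists k : nat, k.+1%:R^-1 < e / 2.
    exists (Num.truncn (e / 2)^-1).
    rewrite invf_plt ?posrE ?divr_gt0 //.
    by apply: truncnS_gt.
  have k0 : 0 < k.+1%:R^-1 :> R by rewrite invr_gt0 ltr0n.
  have q_ i : {q : rat | `|ratr q - tnth t i| < k.+1%:R^-1}.
    apply: cid; have [|q] := @rat_in_itvoo R (tnth t i) (tnth t i + k.+1%:R^-1).
      by rewrite ltrDl.
    rewrite in_itv /= => /andP[q1 q2]; exists q.
    by rewrite gtr0_norm ?subr_gt0 // ltrBlDl.
  have Bk : B (mktuple (fun i => sval (q_ i)), k) (row_of_tuple t).
    by split=> // a i; rewrite ord1 !mxE tnth_mktuple; exact: (svalP (q_ i)).
  exists (mktuple (fun i => sval (q_ i)), k) => //.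
  rewrite /V; case: asboolP => // -[] y By; apply: eU.
  rewrite [e](splitr e); apply: ball_triangle.
    by apply: ball_sym; apply: (le_ball (ltW ke)); exact: Bk.
  by apply: (le_ball (ltW ke)); exact: By.
apply: countable_bigcupT_measurable => [|j]; first exact: countableP.
rewrite /V; case: asboolP => // _.
have -> : @row_of_tuple n @^-1` B j =
    \bigcap_(i : 'I_n) ((@tnth n RR)^~ i @^-1` ball (ratr (tnth j.1 i) : R) (j.2.+1%:R^-1)).
  apply/seteqP; split => [t [_ Bt] i _|t Bt].
    by have := Bt ord0 i; rewrite !mxE.
  by split=> [|a i]; [rewrite invr_gt0 ltr0n | rewrite ord1 !mxE; exact: Bt].
apply: fin_bigcap_measurable => // i _.
rewrite -[X in measurable X]setTI; apply: measurable_tnth => //.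
exact: measurable_realfun.measurable_ball.
Qed.

(* The iterated product of [lebesgue_measure], carried over from tuples to row
   vectors. *)
Definition lebesgue_Rn n : {measure set 'rV[R]_n -> \bar R} :=
  measure_function_pushforward__canonical__measure_function_Measure
    (lebesgue_tuple n) (@measurable_row_of_tuple n).

End LebesgueMeasureRn.

Section Calculus.
Variable R : realType.

Definition partial n (i : 'I_n) (f : 'rV[R]_n -> R) (x : 'rV[R]_n) : R :=
  'D_(delta_mx ord0 i) f x.

Definition grad n (f : 'rV[R]_n -> R) (x : 'rV[R]_n) : 'cV[R]_n :=
  \col_i partial i f x.

Definition div_vec n (v : 'rV[R]_n -> 'cV[R]_n) (x : 'rV[R]_n) : R :=
  \sum_j partial j (fun y => v y j ord0) x.

Definition div_mx n (A : 'rV[R]_n -> 'M[R]_n) (x : 'rV[R]_n) : 'cV[R]_n :=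
  \col_i \sum_j partial j (fun y => A y j i) x.

Definition dotc n (u v : 'cV[R]_n) : R := \sum_i u i ord0 * v i ord0.

(* Frobenius norm of a tensor whose components are indexed by I. *)
Definition l2norm (I : finType) (a : I -> R) : R :=
  Num.sqrt (\sum_i a i ^+ 2).

(* A tensor field is the family of its component functions; [nabla] puts the
   index of differentiation first. *)
Definition nabla n (I : finType) (u : I -> 'rV[R]_n -> R) :
    'I_n * I -> 'rV[R]_n -> R :=
  fun ik => partial ik.1 (u ik.2).

Definition twice_differentiable n (f : 'rV[R]_n -> R) (x : 'rV[R]_n) : Prop :=
  (\forall y \near x, differentiable f y) /\
  forall i, differentiable (partial i f) x.

Definition twice_continuously_differentiable_on n (A : set 'rV[R]_n)
    (f : 'rV[R]_n -> R) : Prop :=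
  (forall x, A x -> twice_differentiable f x) /\
  forall i j, {within A, continuous (partial i (partial j f))}.

Definition l2_closed_ball n (c : 'rV[R]_n) (e : R) : set 'rV[R]_n :=
  [set x | l2norm ((x - c) ord0) <= e].

Definition is_argmin d (V : porderType d) (T : Type) (A : set T) (f : T -> V)
    (a : T) : Prop :=
  A a /\ forall b, A b -> (f a <= f b)%O.

End Calculus.

Section Probability.
Variable R : realType.

Definition is_positive_density n (X : set 'rV[R]_n) (P : probability 'rV[R]_n R)
    (p : 'rV[R]_n -> R) : Prop :=
  [/\ measurable_fun X p, forall x, X x -> 0 < p x &
      forall A, measurable A ->
        P A = (\int[@lebesgue_Rn R n]_(x in A `&` X) (p x)%:E)%E].

Section sequences.
Context (d : measure_display) (Omega : measurableType d).
Variable Pr : probability Omega R.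

Definition mutually_independent d' (T : measurableType d')
    (Y : nat -> {RV Pr >-> T}) : Prop :=
  forall (J : seq nat) (A : nat -> set T),
    uniq J -> (forall i, measurable (A i)) ->
    Pr (\bigcap_(i in [set` J]) (Y i @^-1` A i)) =
    (\prod_(i <- J) Pr (Y i @^-1` A i))%E.

Definition iid_from d' (T : measurableType d') (Y : nat -> {RV Pr >-> T})
    (Q : probability T R) : Prop :=
  mutually_independent Y /\
  forall i A, measurable A -> distribution Pr (Y i) A = Q A.

Definition cvg_in_probability n (Y : nat -> {RV Pr >-> 'rV[R]_n})
    (y : 'rV[R]_n) : Prop :=
  forall e : R, 0 < e ->
    Pr [set w | e <= l2norm ((Y k w - y) ord0)] @[k --> \oo] --> 0%E.

Definition cvg_in_distribution n (Y : nat -> Omega -> 'rV[R]_n)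
    (nu : probability 'rV[R]_n R) : Prop :=
  forall h : 'rV[R]_n -> R, continuous h ->
    (exists M : R, forall y, `|h y| <= M) ->
    \int[Pr]_w h (Y k w) @[k --> \oo] --> \int[nu]_y h y.

End sequences.

(* N(a, v) on the line, with v the variance; [normal_prob] takes the standard
   deviation and is not the point mass when that is 0. *)
Definition normal_law1 (a v : R) : set (measurableTypeR R) -> \bar R :=
  if v == 0 then \d_(a : measurableTypeR R) else normal_prob a (Num.sqrt v).

(* nu = N(a, C), C possibly singular: every linear functional t of nu has law
   N(t a, t C t^T). *)
Definition is_multivariate_normal n (nu : probability 'rV[R]_n R)
    (a : 'rV[R]_n) (C : 'M[R]_n) : Prop :=
  forall (t : 'rV[R]_n) (A : set (measurableTypeR R)), measurable A ->
    nu [set y | A ((y *m t^T) ord0 ord0)] =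
    normal_law1 ((a *m t^T) ord0 ord0) ((t *m C *m t^T) ord0 ord0) A.

End Probability.

Section ScoreMatching.
Variables (R : realType) (d r : nat).
Variable m : 'rV[R]_d -> 'M[R]_d.

Definition diffusion (x : 'rV[R]_d) : 'M[R]_d := m x *m (m x)^T.

Definition score (p : 'rV[R]_d -> R) : 'rV[R]_d -> 'cV[R]_d :=
  grad (fun y => ln (p y)).

Definition dsm_loss (p : 'rV[R]_d -> R) (x : 'rV[R]_d) : R :=
  let s := (m x)^T *m score p x in
  dotc s s + 2 * div_vec (fun y => diffusion y *m score p y) x.

Definition DSM (X : set 'rV[R]_d) (Q : probability 'rV[R]_d R)
    (q p : 'rV[R]_d -> R) : \bar R :=
  (\int[Q]_(x in X)
    (let s := (m x)^T *m (score q x - score p x) in dotc s s)%:E)%E.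

Variable X : set 'rV[R]_d.
Variables (P : 'rV[R]_r -> probability 'rV[R]_d R)
          (p : 'rV[R]_r -> 'rV[R]_d -> R).

Definition dsm_info (theta : 'rV[R]_r) : 'M[R]_r :=
  \matrix_(i, j) (- 2^-1 *
    partial i (fun alpha =>
      partial j (fun t => fine (DSM X (P alpha) (p alpha) (p t))) theta) theta).

(* The theta-derivative is taken after the x-derivatives, here and in [log_grad]
   and [log_hess] below. *)
Definition dscore (i : 'I_r) (theta : 'rV[R]_r) (x : 'rV[R]_d) : 'cV[R]_d :=
  \col_a partial i (fun t => score (p t) x a ord0) theta.

Definition dsm_Sigma (theta : 'rV[R]_r) : 'M[R]_r :=
  \matrix_(i, j) \int[P theta]_(x in X)
    (partial i (fun t => dsm_loss (p t) x) theta *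
     partial j (fun t => dsm_loss (p t) x) theta).

(* The Hessian of theta |-> int F_theta dP_{theta*} at theta* is twice the
   information tensor g, so the sandwich covariance (2 g)^-1 Sigma (2 g)^-1
   carries the factor 1/4. *)
Definition dsm_asymptotic_cov (theta : 'rV[R]_r) : 'M[R]_r :=
  4^-1 *: (invmx (dsm_info theta) *m dsm_Sigma theta *m invmx (dsm_info theta)).

(* Curried with theta last, so that [nabla] differentiates in theta. *)
Definition log_grad (x : 'rV[R]_d) (a : 'I_d) (theta : 'rV[R]_r) : R :=
  partial a (fun y => ln (p theta y)) x.

Definition log_hess (x : 'rV[R]_d) (ab : 'I_d * 'I_d) (theta : 'rV[R]_r) : R :=
  partial ab.1 (partial ab.2 (fun y => ln (p theta y))) x.

End ScoreMatching.

(* Main.v *)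
Require Import Defs.
From HB Require Import structures.
From mathcomp Require Import all_boot all_order all_algebra.
From mathcomp Require Import all_classical all_reals all_analysis.
From mathcomp Require Import measurable_realfun ring lra zify.

(** The estimator is an M-estimator, so two things are needed: a linearization of
    the stationarity equation [sum_i grad F_theta (X_i) = 0], and the identities
    [E (grad F) = 0] and [E (Hess F) = 2 g] at [theta_star].

    For the identities, let [D_theta] be the integrand of DSM. By hypothesis
    [D_theta - F_theta] has constant Q-integral near [theta_star], and the bounds
    by [f1], [f2], [g1] allow differentiating twice under the integral; [D] vanishes
    to second order at [theta_star], where its Hessian is
    [2 <m^T grad d_i log p, m^T grad d_j log p>].

    For the linearization, the second theta-derivatives of [F] are dominated by a
    multiple of [f1 * g1], and [grad F] is differentiable at [theta_star] at almost
    every point; hence the linearization error at [h] is at most [rho * `|h|] with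
    [rho] of arbitrarily small expectation. With the weak law of large numbers for
    the Hessian this gives
    [sqrt n (theta_hat - theta_star) = - (2 g)^-1 n^-1/2 sum_i grad F (X_i) + o_P(1)].

    The multivariate central limit theorem is proved by Lindeberg's replacement of
    the summands by Gaussian ones, for test functions with a second-order Taylor
    expansion with cubic remainder; tensor products of cubic B-splines approximate a
    bounded continuous function by such functions on cubes. *)

Set Implicit Arguments.
Unset Strict Implicit.
Unset Printing Implicit Defensive.

Import Order.TTheory GRing.Theory Num.Theory.
Import numFieldNormedType.Exports.

Local Open Scope classical_set_scope.
Local Open Scope ring_scope.

(** * Measurability and independence in R^n *)

(** The second theta-derivatives of the score are not assumed continuous, so the gradient of F has
    no uniform modulus of differentiability near [theta_star]: how small h must be for its
    linearization to be good depends on x. The domination by [b3] controls the exceptional x, whose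
    set shrinks to the empty set with the radius.

    D and F agree only through their integrals, up to a constant, so their derivatives are compared
    by dominated difference quotients. The gradient of D at [theta_star + h] is at most [b2 x] times
    the norm of h, which dominates its quotients at [theta_star] with no bound on the second
    derivatives of D. Integrability of F itself is deduced from that of D.

    The Lindeberg argument constructs no sequence of Gaussian variables: by stability, the summands
    that are still Gaussian act as one scaled Gaussian vector, which is integrated out, so that H is
    replaced by its smoothing at a scale that shrinks as data come in. Normal laws are built as laws
    of sums of [g_b *: b], which gives stability and singular covariances together. *)

Section MeasurabilityRn.
Context {d} {T : measurableType d} {R : realType}.

(** The Borel sets of row vectors are generated by the open sets, not by cylinders. Factoring
    through tuples, where measurability is coordinatewise, leaves the comparison of the two to
    [measurable_row_of_tuple]. *)
Lemma measurable_rV n (D : set T) (f : T -> 'rV[R]_n) : measurable D ->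
  (forall i, measurable_fun D (fun x => f x ord0 i)) -> measurable_fun D f.
Proof.
move=> mD mf.
pose g x : n.-tuple (measurableTypeR R) := [tuple (f \_ D) x ord0 i | i < n].
have fE x : D x -> f x = row_of_tuple (g x).
  move=> Dx; apply/rowP => i; rewrite mxE tnth_mktuple patchE ifT//.
  exact/mem_set.
apply: (@eq_measurable_fun _ _ _ _ _ (@row_of_tuple R n \o g)).
  by move=> x /set_mem Dx; rewrite fE.
apply: measurable_funTS; apply: measurableT_comp.
  exact: measurable_row_of_tuple.
apply/measurable_fun_tnthP => i.
rewrite (_ : _ \o _ = (fun x => f x ord0 i) \_ D).
  by apply/(measurable_restrictT _ mD); exact: mf.
apply/funext => x /=; rewrite tnth_mktuple !patchE.
by case: ifP => //; rewrite mxE.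
Qed.

End MeasurabilityRn.

Section ProbabilityIntegral.
Context {d} {T : measurableType d} {R : realType} (P : probability T R).

Lemma integral_probability_cst (r : R) : (\int[P]_x r%:E = r%:E)%E.
Proof.
rewrite integral_cst//; rewrite -[RHS]mule1; congr (_ * _)%E.
exact: probability_setT.
Qed.

Lemma Rintegral_probability_cst (r : R) : \int[P]_x r = r.
Proof. by rewrite /Rintegral integral_probability_cst. Qed.

End ProbabilityIntegral.

Section ContinuousMeasurable.
Context {R : realType}.

Lemma open_continuous_measurable_Rn n (D : set 'rV[R]_n) (f : 'rV[R]_n -> R) :
  open D -> (forall x, D x -> {for x, continuous f}) -> measurable_fun D f.
Proof.
move=> oD cf; apply: (measurability _ (RGenOpens.measurableE R)).
move=> _ [_ [a [b ->] <-]]; apply: sub_sigma_algebra.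
suff : open (D `&` f @^-1` `]a, b[) by [].
rewrite openE => x [Dx /= fx]; apply: filterI.
  exact: open_nbhs_nbhs.
by apply: (cf x Dx); apply: open_nbhs_nbhs; split => //; exact: interval_open.
Qed.

Lemma continuous_measurable_Rn n (f : 'rV[R]_n -> R) :
  continuous f -> measurable_fun [set: 'rV[R]_n] f.
Proof.
by move=> cf; apply: open_continuous_measurable_Rn => [|x _]; [exact: openT|exact: cf].
Qed.

Lemma measurable_coord n i : measurable_fun [set: 'rV[R]_n] (fun x => x ord0 i).
Proof. by apply: continuous_measurable_Rn; exact: coord_continuous. Qed.

Lemma measurable_normr n : measurable_fun [set: 'rV[R]_n] (fun x => `|x|).
Proof. by apply: continuous_measurable_Rn; exact: norm_continuous. Qed.

End ContinuousMeasurable.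

Section MeasurableRowOps.
Context {d} {T : measurableType d} {R : realType} {n : nat}.
Implicit Types (D : set T) (f g : T -> 'rV[R]_n).

Lemma measurable_coord_fun D f i : measurable_fun D f ->
  measurable_fun D (fun x => f x ord0 i).
Proof. by move=> mf; exact: (measurableT_comp (measurable_coord i) mf). Qed.

Lemma measurable_rVD D f g : measurable D -> measurable_fun D f ->
  measurable_fun D g -> measurable_fun D (fun x => f x + g x).
Proof.
move=> mD mf mg; apply: measurable_rV => // i.
under eq_fun do rewrite mxE.
by apply: measurable_funD; exact: measurable_coord_fun.
Qed.

Lemma measurable_rVZ D (c : T -> R) f : measurable D -> measurable_fun D c ->
  measurable_fun D f -> measurable_fun D (fun x => c x *: f x).
Proof.
move=> mD mc mf; apply: measurable_rV => // i.
under eq_fun do rewrite mxE.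
by apply: measurable_funM => //; exact: measurable_coord_fun.
Qed.

Lemma measurable_rV_sum D I (s : seq I) (f : I -> T -> 'rV[R]_n) :
  measurable D -> (forall i, measurable_fun D (f i)) ->
  measurable_fun D (fun x => \sum_(i <- s) f i x).
Proof.
move=> mD mf; elim: s => [|i s IH].
  by under eq_fun do rewrite big_nil; exact: measurable_cst.
by under eq_fun do rewrite big_cons; apply: measurable_rVD.
Qed.

End MeasurableRowOps.

(** * Independence of a partial sum from the next variable *)

Section ProductLaw.
Context {R : realType} {dO d1 d2 : measure_display}
  {Omega : measurableType dO} {T1 : measurableType d1} {T2 : measurableType d2}.
Variables (Pr : probability Omega R) (Q : probability T2 R).
Variables (Y : {RV Pr >-> T1}) (Z : {RV Pr >-> T2}).
Hypothesis YZ : forall A B, measurable A -> measurable B ->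
  Pr (Y @^-1` A `&` Z @^-1` B) = (Pr (Y @^-1` A) * Q B)%E.
Local Open Scope ereal_scope.

(** Factorization on rectangles determines the joint law, which is therefore the product of the law
    of [Y] with [Q]; Tonelli then applies. *)
Lemma indep_tonelli (f : T1 * T2 -> \bar R) : measurable_fun setT f ->
  (forall x, 0 <= f x) ->
  \int[Pr]_w f (Y w, Z w) = \int[Pr]_w \int[Q]_z f (Y w, z).
Proof.
move=> mf f0.
have mYZ : measurable_fun setT (fun w => (Y w, Z w)).
  by apply: measurable_fun_pair; exact: measurable_funP.
pose YZm := HB.pack_for {mfun Omega >-> (T1 * T2)%type} (fun w => (Y w, Z w))
  (isMeasurableFun.Build _ _ _ _ _ mYZ).
transitivity (\int[distribution Pr YZm]_z f z).
  by rewrite ge0_integral_distribution.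
transitivity (\int[distribution Pr Y \x Q]_z f z).
  apply/esym; apply: eq_measure_integral => A mA _.
  by apply: product_measure_unique => //= B C mB mC; exact: YZ.
rewrite fubini_tonelli1//= /fubini_F ge0_integral_distribution//.
- exact: measurable_fun_fubini_tonelli_F.
- by move=> y; exact: integral_ge0.
Qed.

End ProductLaw.

Section IidPast.
Context {R : realType} {dO d : measure_display}
  {Omega : measurableType dO} {T : measurableType d}.
Variables (Pr : probability Omega R) (Q : probability T R).
Variables (X : nat -> {RV Pr >-> T}) (iidX : iid_from X Q).

(** The pi-system of cylinders that generates the sigma-algebra of the first [k] variables. *)
Definition past_events (k : nat) : set (set Omega) :=
  [set E | exists2 A : nat -> set T, (forall i, measurable (A i)) &
    E = \bigcap_(i in [set` iota 0 k]) (X i @^-1` A i)].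

Lemma iid_prob i A : measurable A -> Pr (X i @^-1` A) = Q A.
Proof. by move=> mA; rewrite -((iidX.2) i). Qed.

Lemma measurable_past k E : <<s past_events k >> E -> measurable E.
Proof.
apply: smallest_sub; first exact: sigma_algebra_measurable.
move=> _ [A mA ->]; apply: fin_bigcap_measurable => // i _.
rewrite -[X in measurable X]setTI.
by have /= := @measurable_funP _ _ _ _ _ (X i); apply.
Qed.

Lemma measurable_past_coord k i : (i < k)%N ->
  measurable_fun [set: g_sigma_algebraType (past_events k)]
    (X i : g_sigma_algebraType (past_events k) -> T).
Proof.
move=> ik _ A mA; rewrite setTI; apply: sub_sigma_algebra.
exists (fun j => if j == i then A else setT) => [j|].
  by case: ifP.
apply/seteqP; split => [w XA j _ /=|w /(_ i)/=].
  by case: eqP => // ->.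
by rewrite eqxx; apply; rewrite mem_iota.
Qed.

(** Both sides are finite measures in [E] that agree on the pi-system of cylinders, hence on the
    sigma-algebra it generates. *)
Lemma past_indep k (E : set Omega) (B : set T) : <<s past_events k >> E ->
  measurable B -> Pr (E `&` X k @^-1` B) = (Pr E * Q B)%E.
Proof.
move=> sE mB.
have mXB : measurable (X k @^-1` B).
  rewrite -[X in measurable X]setTI.
  by have /= := @measurable_funP _ _ _ _ _ (X k); apply.
have QB0 : 0 <= fine (Q B) by rewrite fine_ge0.
have QBE : (fine (Q B))%:E = Q B by rewrite fineK// fin_num_measure.
pose m1 : {measure set Omega -> \bar R} := mrestr Pr mXB.
pose m2 : {measure set Omega -> \bar R} := mscale (NngNum QB0) Pr.
suff: m1 E = m2 E.
  by move=> m12; rewrite muleC -QBE; exact: m12.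
apply: (g_sigma_algebra_measure_unique (past_events k) _ (fun=> setT)) => //.
- by move=> F PF; apply: (@measurable_past k); exact: sub_sigma_algebra.
- move=> _; exists (fun=> setT) => //.
  by apply/seteqP; split.
- by apply/seteqP; split => // w _; exists 0%N.
- move=> _ _ [A mA ->] [A' mA' ->]; exists (fun i => A i `&` A' i).
    by move=> i; exact: measurableI.
  by rewrite -bigcapI.
- move=> _ [A mA ->]; 
  set E' := \bigcap_(i in _) _.
  transitivity (Q B * Pr E')%E; last by rewrite -QBE.
  rewrite /m1 /= /mrestr {}/E'.
  (* Putting [B] at index [k] turns the intersection into a cylinder over the first [k + 1]
     variables, to which mutual independence applies. *)
  pose A' i := if i == k then B else A i.
  have mA' i : measurable (A' i) by rewrite /A'; case: ifP.
  have := (iidX.1) (iota 0 k.+1) A' (iota_uniq _ _) mA'.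
  have := (iidX.1) (iota 0 k) A (iota_uniq _ _) mA.
  move=> ->.
  rewrite -addn1 iotaD add0n /= big_cat big_seq1 /= /A' eqxx iid_prob// muleC.
  rewrite (_ : \bigcap_(i in _) _ =
      \bigcap_(i in [set` iota 0 k]) (X i @^-1` A i) `&` X k @^-1` B); last first.
    apply/seteqP; split => [w XA|w [XA XB] i /=].
      split => [i /= ik|].
        have := XA i; rewrite /= mem_cat ik => /(_ isT).
        by case: eqP ik => // ->; rewrite mem_iota ltnn.
      by have := XA k; rewrite /= mem_cat mem_seq1 eqxx orbT => /(_ isT).
    rewrite mem_cat mem_seq1 => /orP[ik|/eqP->]; last by rewrite eqxx.
    case: eqP => [->//|_]; exact: XA.
  move=> ->; congr (_ * _)%E; rewrite big_seq_cond [RHS]big_seq_cond.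
  apply: eq_bigr => i; rewrite andbT mem_iota add0n => ik.
  by rewrite (ltn_eqF ik).
- move=> _; apply: (@le_lt_trans _ _ 1%E); last exact: ltry.
  by apply: probability_le1; exact: measurableI.
Qed.

End IidPast.

Section PartialSums.
Context {R : realType} {dO d : measure_display}
  {Omega : measurableType dO} {T : measurableType d}.
Variables (Pr : probability Omega R) (Q : probability T R).
Variables (X : nat -> {RV Pr >-> T}) (iidX : iid_from X Q).
Local Open Scope ereal_scope.

(** The partial sum is measurable for the sigma-algebra of the past, hence independent of [X k]. *)
Lemma sum_step_tonelli n (V : T -> 'rV[R]_n) k (f : 'rV[R]_n * T -> \bar R) :
  measurable_fun setT V -> measurable_fun setT f -> (forall x, 0 <= f x) ->
  \int[Pr]_w f (\sum_(i < k) V (X i w), X k w)%R =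
  \int[Pr]_w \int[Q]_z f (\sum_(i < k) V (X i w), z)%R.
Proof.
move=> mV mf f0.
pose S w := (\sum_(i < k) V (X i w))%R.
have mS : measurable_fun setT S.
  apply: measurable_rV_sum => // i.
  apply: (measurableT_comp mV); exact: measurable_funP.
have sS : measurable_fun [set: g_sigma_algebraType (past_events X k)]
    (S : g_sigma_algebraType (past_events X k) -> _).
  apply: measurable_rV_sum => // i.
  by apply: (measurableT_comp mV); apply: measurable_past_coord.
pose Sm := HB.pack_for {mfun Omega >-> 'rV[R]_n} S
  (isMeasurableFun.Build _ _ _ _ _ mS).
apply: (@indep_tonelli _ _ _ _ _ _ _ Pr Q Sm (X k)) => // A B mA mB.
apply: (past_indep iidX) => //.
by rewrite -[X in <<s _ >> X]setTI; exact: sS.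
Qed.

Lemma integral_iid i (f : T -> \bar R) : measurable_fun setT f ->
  (forall x, 0 <= f x) -> \int[Pr]_w f (X i w) = \int[Q]_x f x.
Proof.
move=> mf f0; rewrite -(ge0_integral_distribution (X i) mf f0).
by apply: eq_measure_integral => A mA _; exact: iidX.2.
Qed.

(** Integrating out the last summand kills the cross term, since [V] has mean zero; the second
    moments then add up. *)
Lemma sum_second_moment n (V : T -> 'rV[R]_n) i k :
  measurable_fun setT V ->
  Q.-integrable setT (fun x => (V x ord0 i)%:E) ->
  Q.-integrable setT (fun x => (V x ord0 i ^+ 2)%:E) ->
  \int[Q]_x (V x ord0 i)%:E = 0 ->
  \int[Pr]_w ((\sum_(j < k) V (X j w))%R ord0 i ^+ 2)%:E =
  (k%:R)%:E * \int[Q]_x (V x ord0 i ^+ 2)%:E.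
Proof.
move=> mV iV iV2 V0.
have fin2 : \int[Q]_x (V x ord0 i ^+ 2)%:E \is a fin_num.
  exact: integrable_fin_num.
have mVi : measurable_fun setT (fun x => V x ord0 i) by exact: measurable_coord_fun.
elim: k => [|k IH].
  rewrite mul0e; apply: integral0_eq => w _.
  by rewrite big_ord0 mxE expr0n.
under eq_integral do rewrite big_ord_recr.
pose f (u : 'rV[R]_n * T) : \bar R := ((u.1 ord0 i + V u.2 ord0 i) ^+ 2)%:E.
transitivity (\int[Pr]_w f ((\sum_(j < k) V (X j w))%R, X k w)).
  by apply: eq_integral => w _; rewrite /f /= !mxE.
have mS : measurable_fun setT (fun w => (\sum_(j < k) V (X j w))%R).
  apply: measurable_rV_sum => // j.
  apply: (measurableT_comp mV); exact: measurable_funP.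
rewrite sum_step_tonelli//; first last.
- by move=> u; rewrite /f lee_fin sqr_ge0.
- apply/measurable_EFinP; apply: measurable_funX; apply: measurable_funD.
    exact: (measurableT_comp (measurable_coord i) measurable_fst).
  exact: (measurableT_comp mVi measurable_snd).
transitivity (\int[Pr]_w (((\sum_(j < k) V (X j w))%R ord0 i ^+ 2)%:E +
    \int[Q]_x (V x ord0 i ^+ 2)%:E)).
  apply: eq_integral => w _; rewrite /f /=; move: ((\sum_(j < k) V (X j w))%R ord0 i) => a.
  transitivity (\int[Q]_x ((a ^+ 2)%:E + ((2 * a)%:E * (V x ord0 i)%:E +
      (V x ord0 i ^+ 2)%:E))).
    apply: eq_integral => x _.
    have -> : (((a + V x ord0 i) ^+ 2)
        = a ^+ 2 + (2 * a * V x ord0 i + V x ord0 i ^+ 2))%R by ring.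
    by rewrite EFinD EFinD EFinM.
  rewrite integralD//; last 2 first.
  - exact: finite_measure_integrable_cst.
  - by apply: integrableD => //; exact: integrableZl.
  rewrite integralD//; last exact: integrableZl.
  by rewrite integralZl// V0 mule0 add0e integral_probability_cst.
set s2 := (\int[Q]_x _)%E in fin2 *.
pose g w := ((\sum_(j < k) V (X j w))%R ord0 i ^+ 2)%:E.
rewrite [LHS](_ : _ = \int[Pr]_w g w + \int[Pr]_w cst s2 w); last first.
  apply: ge0_integralD => //.
  - by move=> w _; rewrite lee_fin sqr_ge0.
  - by apply/measurable_EFinP; apply: measurable_funX; exact: measurable_coord_fun.
  - by move=> w _; apply: integral_ge0 => x _; rewrite lee_fin sqr_ge0.
rewrite IH -/s2 -(fineK fin2) integral_probability_cst.
by rewrite -!EFinM -EFinD -natr1 mulrDl mul1r.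
Qed.

End PartialSums.

(** * Normal laws *)

Section Density.
Context {d} {T : measurableType d} {R : realType}.
Variables (mu nu : {measure set T -> \bar R}) (p : T -> R).
Hypotheses (mp : measurable_fun setT p) (p0 : forall x, 0 <= p x).
Hypothesis nuE : forall A, measurable A -> nu A = (\int[mu]_(x in A) (p x)%:E)%E.
Local Open Scope ereal_scope.
Import HBNNSimple.

Let density_indic A : measurable A ->
  \int[nu]_x (\1_A x)%:E = \int[mu]_x ((\1_A x)%:E * (p x)%:E).
Proof.
move=> mA; rewrite integral_indic// setIT nuE// integral_mkcond.
apply: eq_integral => x _; rewrite patchE indicE.
by case: ifP => _; rewrite ?mul1e ?mul0e.
Qed.

Let density_nnsfun (h : {nnsfun T >-> R}) :
  \int[nu]_x (h x)%:E = \int[mu]_x ((h x)%:E * (p x)%:E).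
Proof.
under [LHS]eq_integral do rewrite fimfunE -fsumEFin//.
rewrite [LHS]ge0_integral_fsum//; last 2 first.
  - by move=> r; exact/measurable_EFinP/measurableT_comp.
  - by move=> n x _; rewrite EFinM nnfun_muleindic_ge0.
under [RHS]eq_integral.
  move=> x xD; rewrite fimfunE -fsumEFin// muleC ge0_mule_fsumr; last first.
    by move=> r; rewrite EFinM nnfun_muleindic_ge0.
  over.
rewrite [RHS]ge0_integral_fsum//; last 2 first.
  - move=> r; apply: emeasurable_funM; first exact/measurable_EFinP.
    exact/measurable_EFinP/measurableT_comp.
  - move=> n x _; apply: mule_ge0; first by rewrite lee_fin.
    by rewrite EFinM nnfun_muleindic_ge0.
apply: eq_fsbigr => r; rewrite inE => -[/= t _ <-{r}].
under eq_integral do rewrite EFinM.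
rewrite ge0_integralZl//; last 2 first.
- exact/measurable_EFinP.
- by rewrite lee_fin.
rewrite density_indic// -ge0_integralZl//.
- by apply: eq_integral => x _; rewrite EFinM muleA muleC.
- by apply: emeasurable_funM; exact/measurable_EFinP.
- by move=> x _; rewrite mule_ge0// lee_fin.
- by rewrite lee_fin.
Qed.

(** Passes from indicators to simple functions, then to monotone limits. *)
Lemma ge0_integral_density (f : T -> \bar R) : measurable_fun setT f ->
  (forall x, 0 <= f x) -> \int[nu]_x f x = \int[mu]_x (f x * (p x)%:E).
Proof.
move=> mf f0; pose f_ := nnsfun_approx measurableT mf.
transitivity (limn (fun n => \int[nu]_x (f_ n x)%:E)).
  rewrite -monotone_convergence//=.
  - apply: eq_integral => x xD; apply/esym/cvg_lim => //=.
    exact: cvg_nnsfun_approx.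
  - by move=> n; exact/measurable_EFinP.
  - by move=> n x _; rewrite lee_fin.
  - by move=> x _ a b ab; rewrite lee_fin//; exact/lefP/nd_nnsfun_approx.
under eq_fun do rewrite density_nnsfun.
rewrite -monotone_convergence//=.
- apply: eq_integral => x xD; apply/cvg_lim => //=.
  apply: cvgeZr => //; exact: cvg_nnsfun_approx.
- by move=> n; apply: emeasurable_funM; exact/measurable_EFinP.
- by move=> n x _; rewrite mule_ge0// lee_fin.
- move=> x _ a b ab; apply: lee_wpmul2r; rewrite lee_fin//.
  exact/lefP/nd_nnsfun_approx.
Qed.

End Density.

Section AffineChange.
Context {R : realType}.
Local Notation mu := (@lebesgue_measure R).
Local Notation RR := (measurableTypeR R).

Lemma measurable_affine (a b : R) :
  measurable_fun [set: RR] ((fun x => a * x + b) : RR -> RR).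
Proof. by apply: measurable_funD => //; exact: measurable_funM. Qed.

(** The scaled push-forward has the values of Lebesgue measure on half-open intervals, and these
    determine it. *)
Lemma lebesgue_affine (a b : R) (A : set RR) : a != 0 -> measurable A ->
  (mu A = `|a|%:E * mu ((fun x => (a * x + b)%R) @^-1` A))%E.
Proof.
move=> a0 mA.
pose nu : {measure set RR -> \bar R} := mscale (NngNum (normr_ge0 a))
  (measure_function_pushforward__canonical__measure_function_Measure mu
    (measurable_affine a b)).
rewrite (@lebesgue_measure_unique _ nu)// => _ [[p q] /= pq <-].
rewrite /nu /mscale /= /pushforward /=.
have [ap|an] : 0 < a \/ a < 0 by move: a0; rewrite neq_lt => /orP[]; tauto.
- rewrite (_ : _ @^-1` _ = `](p - b) / a, (q - b) / a]%classic); last first.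
    apply/seteqP; split => x /=; rewrite !in_itv /=;
    by rewrite ltr_pdivrMr// ler_pdivlMr// mulrC ltrBlDr lerBrDr.
  rewrite !lebesgue_measure_itv /= !lte_fin.
  rewrite ltr_pM2r ?invr_gt0// ltrD2r; case: ifP => _; last by rewrite mule0.
  rewrite -!EFinB -EFinM gtr0_norm//; congr EFin; field.
  by rewrite gt_eqF.
(* A negative slope exchanges the two ends, so the preimage is closed on the left. *)
- rewrite (_ : _ @^-1` _ = `[(q - b) / a, (p - b) / a[%classic); last first.
    apply/seteqP; split => x /=; rewrite !in_itv /=;
    by rewrite ltr_ndivlMr// ler_ndivrMr// mulrC ltrBlDr lerBrDr andbC.
  rewrite !lebesgue_measure_itv /= !lte_fin.
  rewrite ltr_nM2r ?invr_lt0// ltrD2r; case: ifP => _; last by rewrite mule0.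
  rewrite -!EFinB -EFinM ltr0_norm//; congr EFin; field.
  by rewrite lt_eqF.
Qed.

Lemma ge0_integral_affine (a b : R) (f : RR -> \bar R) : a != 0 ->
  measurable_fun setT f -> (forall x, (0 <= f x)%E) ->
  (\int[mu]_x f x = `|a|%:E * \int[mu]_x f (a * x + b)%R)%E.
Proof.
move=> a0 mf f0.
pose nu : {measure set RR -> \bar R} := mscale (NngNum (normr_ge0 a))
  (measure_function_pushforward__canonical__measure_function_Measure mu
    (measurable_affine a b)).
rewrite (@eq_measure_integral _ _ _ setT nu) => [|A mA _]; last first.
  exact: lebesgue_affine.
rewrite ge0_integral_mscale//; congr (_ * _)%E.
by rewrite ge0_integral_pushforward//; exact: measurable_affine.
Qed.

End AffineChange.

Section GaussianConvolution.
Context {R : realType}.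
Local Notation mu := (@lebesgue_measure R).
Local Notation RR := (measurableTypeR R).

(** [normal_law1] is a bare set function defined by cases; this supplies a measure with the same
    values, to which results on measures apply. *)
Lemma normal_lawP (v : R) : 0 <= v -> exists nu : probability RR R,
  forall A, measurable A -> nu A = normal_law1 0 v A.
Proof.
move=> v0; rewrite /normal_law1; case: eqP => _.
  by exists \d_(0 : RR).
by exists (normal_prob 0 (Num.sqrt v)).
Qed.

Lemma ge0_integral_normal_prob (a s : R) (f : RR -> \bar R) :
  measurable_fun setT f -> (forall x, (0 <= f x)%E) ->
  (\int[normal_prob a s]_x f x = \int[mu]_x (f x * (normal_pdf a s x)%:E))%E.
Proof.
apply: ge0_integral_density; first exact: measurable_normal_pdf.
  by move=> x; exact: normal_pdf_ge0.
by [].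
Qed.

Lemma normal_pdf_scale (c x : R) : c != 0 ->
  normal_pdf 0 1 x = `|c| * normal_pdf 0 `|c| (c * x + 0).
Proof.
move=> c0; rewrite !normal_pdfE ?normr_eq0 ?oner_neq0//.
rewrite mulrA; congr (_ * _).
  rewrite /normal_peak expr1n mul1r -mulrnAr sqrtrM ?sqr_ge0//.
  by rewrite sqrtr_sqr normr_id invfM mulrA divff ?normr_eq0// mul1r.
rewrite /normal_fun real_normK ?num_real//; congr expR.
rewrite addr0 !subr0 -(mulr_natr (1 ^+ 2)) -(mulr_natr (c ^+ 2)); field.
by [].
Qed.

(** Completing the square. For [Y = c X + s Z] with [X] and [Z] independent standard normal, both
    sides are the joint density of [(X, Y)]: on the right, the marginal density of [Y] times the
    conditional density of [X] given [Y = y]. *)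
Lemma normal_pdf_convol (s c y x : R) : s != 0 ->
  normal_pdf 0 1 x * normal_pdf 0 s (y - c * x) =
  normal_pdf 0 (Num.sqrt (s ^+ 2 + c ^+ 2)) y *
  normal_pdf (c * y / (s ^+ 2 + c ^+ 2)) (s / Num.sqrt (s ^+ 2 + c ^+ 2)) x.
Proof.
move=> s0; set t := s ^+ 2 + c ^+ 2.
have t0 : 0 < t by rewrite ltr_wpDr ?sqr_ge0// exprn_even_gt0.
have st0 : Num.sqrt t != 0 by rewrite sqrtr_eq0 -ltNge.
have pi0 := pi_gt0 R.
rewrite !normal_pdfE ?oner_neq0//; last by rewrite mulf_neq0 ?invr_eq0.
rewrite mulrACA [RHS]mulrACA; congr (_ * _).
  rewrite /normal_peak -!invfM -!sqrtrM; last 2 first.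
  - by rewrite -mulr_natr !mulr_ge0 ?sqr_ge0// ltW.
  - by rewrite -mulr_natr !mulr_ge0 ?sqr_ge0// ltW.
  congr (Num.sqrt _)^-1.
  rewrite sqr_sqrtr ?(ltW t0)// exprMn exprVn sqr_sqrtr ?(ltW t0)//.
  by rewrite -!(mulr_natr (_ * pi)); field; exact: lt0r_neq0.
rewrite /normal_fun -!expRD; congr expR.
rewrite sqr_sqrtr ?(ltW t0)// !exprMn exprVn sqr_sqrtr ?(ltW t0)//.
rewrite -(mulr_natr (1 ^+ 2)) -(mulr_natr (s ^+ 2)) -(mulr_natr t).
rewrite -(mulr_natr (s ^+ 2 / t)) !subr0.
have t0' : t != 0 by rewrite lt0r_neq0.
rewrite /t in t0' *; field.
by rewrite t0' s0.
Qed.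

(** Convolution of [N(0, v)] with [N(0, c^2)]. Point masses force the case split: for [c = 0]
    nothing moves, for [v = 0] only a scaling remains, and otherwise both laws have densities. *)
Lemma normal_law1_convol (v c : R) (A : set RR) : 0 <= v -> measurable A ->
  (\int[normal_prob 0 (1 : R)]_x
     normal_law1 0 v ((fun z : RR => (z + c * x)%R) @^-1` A) =
   normal_law1 0 (v + c ^+ 2) A)%E.
Proof.
move=> v0 mA; have [->|c0] := eqVneq c 0.
  rewrite expr0n addr0.
  rewrite (eq_integral (cst (normal_law1 0 v A))) => [|x _]; last first.
    by rewrite mul0r; congr normal_law1; apply/seteqP; split => z /=; rewrite addr0.
  have [nu nuE] := normal_lawP v0.
  rewrite -(nuE _ mA) -(fineK (fin_num_measure nu _ mA)).
  exact: integral_probability_cst.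
have [->|v1] := eqVneq v 0.
  rewrite /normal_law1 eqxx add0r sqrf_eq0 (negbTE c0) sqrtr_sqr.
  rewrite (eq_integral (fun x : RR => (\1_A (c * x + 0)%R)%:E)) => [|x _]; last first.
    by rewrite diracE indicE; congr (((nat_of_bool _)%:R)%:E); apply/idP/idP => /set_mem /=;
      rewrite ?add0r ?addr0 => h; apply/mem_set => /=; rewrite ?add0r ?addr0.
  rewrite ge0_integral_normal_prob; first last.
  - by move=> x; rewrite lee_fin.
  - apply/measurable_EFinP; apply: (measurableT_comp (measurable_indic mA)).
    exact: measurable_affine.
  rewrite /normal_prob [RHS]integral_mkcond.
  rewrite [RHS](ge0_integral_affine 0 c0); first last.
  - by move=> x; rewrite patchE; case: ifP => _ //; rewrite lee_fin normal_pdf_ge0.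
  - apply/(measurable_restrictT _ mA)/measurable_funTS/measurable_EFinP.
    exact: measurable_normal_pdf.
  rewrite -ge0_integralZl//; first last.
  - by move=> x _; rewrite patchE; case: ifP => _ //; rewrite lee_fin normal_pdf_ge0.
  - apply: (measurableT_comp _ (measurable_affine c 0)).
    apply/(measurable_restrictT _ mA)/measurable_funTS/measurable_EFinP.
    exact: measurable_normal_pdf.
  apply: eq_integral => x _; rewrite (normal_pdf_scale x c0) patchE indicE.
  by case: ifP => _; rewrite ?mul1e ?mul0e ?mule0 ?EFinM.
have vp : 0 < v by rewrite lt_neqAle eq_sym v1.
set s := Num.sqrt v.
have s2 : s ^+ 2 = v by rewrite sqr_sqrtr.
have s0 : s != 0 by rewrite sqrtr_eq0 -ltNge.
pose f (z : RR * RR) : \bar R :=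
  ((\1_A z.2)%:E * (normal_pdf 0 1 z.1 * normal_pdf 0 s (z.2 - c * z.1))%:E)%E.
have mf : measurable_fun setT f.
  apply: emeasurable_funM; apply/measurable_EFinP.
    exact: (measurableT_comp (measurable_indic mA)).
  apply: measurable_funM.
    by apply: measurableT_comp => //; exact: measurable_normal_pdf.
  apply: measurableT_comp; first exact: measurable_normal_pdf.
  by apply: measurable_funB => //; exact: measurable_funM.
have f0 z : (0 <= f z)%E.
  by rewrite mule_ge0// lee_fin// mulr_ge0 ?normal_pdf_ge0.
have inner x : normal_law1 0 v ((fun z : RR => (z + c * x)%R) @^-1` A) =
    (\int[mu]_y ((\1_A y)%:E * (normal_pdf 0 s (y - c * x))%:E))%E.
  rewrite /normal_law1 (negbTE v1) /normal_prob -/s integral_mkcond.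
  rewrite [RHS](ge0_integral_affine (c * x) (oner_neq0 _)); first last.
  - by move=> y; rewrite mule_ge0// lee_fin// normal_pdf_ge0.
  - apply: emeasurable_funM; apply/measurable_EFinP.
      exact: measurable_indic.
    apply: measurableT_comp; first exact: measurable_normal_pdf.
    exact: measurable_funB.
  rewrite normr1 mul1e; apply: eq_integral => y _.
  rewrite mul1r addrK patchE indicE.
  rewrite (_ : (y \in _) = (y + c * x \in A)); last first.
    by apply/idP/idP => /set_mem /= h; exact/mem_set.
  by case: ifP => _; rewrite ?mul1e ?mul0e.
rewrite (eq_integral (fun x : RR => \int[mu]_y
    ((\1_A y)%:E * (normal_pdf 0 s (y - c * x))%:E))%E); last first.
  by move=> x _; exact: inner.
pose h (z : RR * RR) : \bar R :=
  ((\1_A z.2)%:E * (normal_pdf 0 s (z.2 - c * z.1))%:E)%E.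
have mh : measurable_fun setT h.
  apply: emeasurable_funM; apply/measurable_EFinP.
    exact: (measurableT_comp (measurable_indic mA)).
  apply: measurableT_comp; first exact: measurable_normal_pdf.
  by apply: measurable_funB => //; exact: measurable_funM.
have h0 z : (0 <= h z)%E by rewrite mule_ge0// lee_fin// normal_pdf_ge0.
rewrite ge0_integral_normal_prob; first last.
- by move=> x; apply: integral_ge0 => y _; exact: (h0 (x, y)).
- exact: (measurable_fun_fubini_tonelli_F h mh h0).
transitivity (\int[mu]_x \int[mu]_y f (x, y))%E.
  apply: eq_integral => x _; rewrite muleC -ge0_integralZl//; first last.
  - by rewrite lee_fin normal_pdf_ge0.
  - by move=> y _; exact: (h0 (x, y)).
  - apply: emeasurable_funM; apply/measurable_EFinP; first exact: measurable_indic.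
    by apply: measurableT_comp; [exact: measurable_normal_pdf|exact: measurable_funB].
  by apply: eq_integral => y _; rewrite /f /= EFinM muleCA.
(* With [y] outermost, [normal_pdf_convol] leaves in the inner integral the conditional density of
   [x], whose total mass is 1. *)
rewrite (fubini_tonelli f)//=.
have vc0 : v + c ^+ 2 != 0 by rewrite gt_eqF// ltr_wpDr ?sqr_ge0.
rewrite /normal_law1 (negbTE vc0) /normal_prob [RHS]integral_mkcond.
apply: eq_integral => y _; rewrite /f /=.
rewrite (eq_integral (fun x : RR => ((\1_A y)%:E *
  (normal_pdf 0 (Num.sqrt (v + c ^+ 2)) y)%:E) *
  (normal_pdf (c * y / (v + c ^+ 2)) (s / Num.sqrt (v + c ^+ 2)) x)%:E)%E);
  last first.
  by move=> x _; rewrite normal_pdf_convol// s2 EFinM muleA.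
rewrite ge0_integralZl//; first last.
- by rewrite mule_ge0// lee_fin// normal_pdf_ge0.
- by move=> x _; rewrite lee_fin normal_pdf_ge0.
- by apply/measurable_EFinP; exact: measurable_normal_pdf.
rewrite integral_normal_pdf mule1 patchE indicE.
by case: ifP => _; rewrite ?mul1e ?mul0e.
Qed.

End GaussianConvolution.

(** * Normal laws on R^n and their stability *)

Section GaussLaw.
Context {R : realType}.
Local Notation mu := (@lebesgue_measure R).
Local Notation RR := (measurableTypeR R).
Local Notation gamma := (normal_prob (0 : R) 1).
Variable n : nat.

Definition addZ (b : 'rV[R]_n) (z : 'rV[R]_n * RR) : 'rV[R]_n := z.1 + z.2 *: b.

Lemma measurable_addZ (b : 'rV[R]_n) : measurable_fun setT (addZ b).
Proof.
by apply: measurable_rVD => //; apply: measurable_rVZ.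
Qed.

HB.instance Definition _ (b : 'rV[R]_n) :=
  isMeasurableFun.Build _ _ _ _ (addZ b) (measurable_addZ b).

(** The law of the sum of [g_b *: b] with independent standard normal [g_b]. Its covariance, the sum
    of the [b^T *m b], may be singular, so there is no density on R^n to start from. *)
Fixpoint gauss_law (bs : seq 'rV[R]_n) : probability 'rV[R]_n R :=
  if bs is b :: bs' then
    distribution (gauss_law bs' \x gamma)%E (addZ b)
  else \d_(0 : 'rV[R]_n).

Local Open Scope ereal_scope.

Lemma ge0_integral_gauss_cons b bs (f : 'rV[R]_n -> \bar R) :
  measurable_fun setT f -> (forall x, 0 <= f x) ->
  \int[gauss_law (b :: bs)]_y f y =
  \int[gauss_law bs]_y \int[gamma]_x f (y + x *: b)%R.
Proof.
move=> mf f0 /=; rewrite ge0_integral_distribution// fubini_tonelli1//.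
  by apply: (measurableT_comp mf); exact: measurable_addZ.
by move=> z; exact: f0.
Qed.

(** Each further vector [b] convolves the law of the functional with a centred normal law of
    standard deviation [b *m t^T] in absolute value. *)
Lemma gauss_law_marginal bs (t : 'rV[R]_n) (A : set RR) : measurable A ->
  gauss_law bs [set y | A ((y *m t^T) ord0 ord0)] =
  normal_law1 0 (\sum_(b <- bs) ((b *m t^T) ord0 ord0) ^+ 2)%R A.
Proof.
move=> mA.
have mS B : measurable B ->
    measurable [set y : 'rV[R]_n | B ((y *m t^T) ord0 ord0)].
  move=> mB; rewrite -[X in measurable X]setTI.
  have : measurable_fun [set: 'rV[R]_n] (fun y => (y *m t^T) ord0 ord0).
    under eq_fun do rewrite mxE.
    by apply: measurable_sum => j; apply: measurable_funM => //; exact: measurable_coord.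
  by move=> /(_ measurableT _ mB).
elim: bs A mA => [|b bs IH] A mA.
  rewrite big_nil /normal_law1 eqxx /= !diracE; congr (((nat_of_bool _)%:R)%:E).
  have z0 : ((0 : 'rV[R]_n) *m t^T) ord0 ord0 = 0%R by rewrite mul0mx mxE.
  apply/idP/idP => /set_mem h; apply/mem_set; first by move: h; rewrite /= z0.
  by rewrite /= z0.
rewrite big_cons -(setIT [set y | _]) -integral_indic//; last exact: mS.
rewrite ge0_integral_gauss_cons//; last first.
  by apply/measurable_EFinP; apply: measurable_indic; exact: mS.
pose f (z : 'rV[R]_n * RR) : \bar R :=
  (\1_[set y : 'rV[R]_n | A ((y *m t^T) ord0 ord0)] (z.1 + z.2 *: b)%R)%:E.
have f0 z : 0 <= f z by rewrite lee_fin.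
have mf : measurable_fun setT f.
  apply/measurable_EFinP; apply: measurableT_comp; last exact: measurable_addZ.
  by apply: measurable_indic; exact: mS.
rewrite (fubini_tonelli f)//=.
rewrite addrC -normal_law1_convol//; last by apply: sumr_ge0 => i _; exact: sqr_ge0.
apply: eq_integral => x _; rewrite -IH; last first.
  rewrite -[X in measurable X]setTI.
  have : measurable_fun [set: RR] (fun z : RR => z + (b *m t^T) ord0 ord0 * x)%R.
    exact: measurable_funD.
  by move=> /(_ measurableT _ mA).
rewrite /f /=; set E := (X in _ = gauss_law bs X).
have mE : measurable E.
  apply: (mS ((fun z : RR => z + (b *m t^T) ord0 ord0 * x)%R @^-1` A)).
  rewrite -[X in measurable X]setTI.
  have : measurable_fun [set: RR] (fun z : RR => z + (b *m t^T) ord0 ord0 * x)%R.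
    exact: measurable_funD.
  by move=> /(_ measurableT _ mA).
transitivity (\int[gauss_law bs]_y (\1_E y)%:E); last by rewrite integral_indic// setIT.
apply: eq_integral => y _; rewrite !indicE; congr (((nat_of_bool _)%:R)%:E).
have yxE : ((y + x *: b) *m t^T) ord0 ord0 =
    ((y *m t^T) ord0 ord0 + (b *m t^T) ord0 ord0 * x)%R.
  by rewrite mulmxDl -scalemxAl [LHS]mxE [X in (_ + X)%R = _]mxE [(x * _)%R]mulrC.
by apply/idP/idP => /set_mem h; apply/mem_set; move: h; rewrite /E /= yxE.
Qed.

End GaussLaw.

Section NormalStability.
Context {R : realType}.
Local Notation RR := (measurableTypeR R).
Local Notation gamma := (normal_prob (0 : R) 1).
Local Open Scope ereal_scope.

(** Convolution with the point mass at 0, which also covers [c = 0]. *)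
Lemma normal_scale (c : R) (A : set RR) : measurable A ->
  gamma ((fun x : RR => (c * x)%R : RR) @^-1` A) = normal_law1 0 (c ^+ 2) A.
Proof.
move=> mA; rewrite -[X in normal_law1 0 X]add0r -normal_law1_convol//.
rewrite -(setIT (_ @^-1` _)) -integral_indic//; last first.
  rewrite -[X in measurable X]setTI.
  have : measurable_fun [set: RR] (fun z : RR => c * z : RR)%R by exact: measurable_funM.
  by move=> /(_ measurableT _ mA).
apply: eq_integral => x _; rewrite /normal_law1 eqxx diracE indicE.
congr (((nat_of_bool _)%:R)%:E).
by apply/idP/idP => /set_mem /= h; apply/mem_set; move: h => /=; rewrite add0r.
Qed.

(** Both sides are integrals against push-forwards, whose values on sets are given by
    [normal_law1_convol] and [normal_scale]. *)
Lemma normal_stable (a b c : R) (f : RR -> \bar R) : (c ^+ 2 = a ^+ 2 + b ^+ 2)%R ->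
  measurable_fun setT f -> (forall x, 0 <= f x) ->
  \int[gamma]_x \int[gamma]_y f (a * x + b * y)%R = \int[gamma]_x f (c * x)%R.
Proof.
move=> cab mf f0.
have mc : measurable_fun [set: RR] (fun x : RR => (c * x)%R : RR).
  exact: measurable_funM.
have mab : measurable_fun [set: RR * RR]
    (fun z : RR * RR => (a * z.1 + b * z.2)%R : RR).
  by apply: measurable_funD; exact: measurable_funM.
pose g1 := HB.pack_for {mfun RR >-> RR} (fun x : RR => (c * x)%R : RR)
  (isMeasurableFun.Build _ _ _ _ _ mc).
pose g2 := HB.pack_for {mfun (RR * RR)%type >-> RR}
  (fun z : RR * RR => (a * z.1 + b * z.2)%R : RR)
  (isMeasurableFun.Build _ _ _ _ _ mab).
transitivity (\int[distribution gamma g1]_x f x); last first.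
  by rewrite ge0_integral_distribution.
transitivity (\int[distribution (gamma \x gamma) g2]_x f x).
  rewrite ge0_integral_distribution// fubini_tonelli1//.
    exact: (measurableT_comp mf mab).
  by move=> z; exact: f0.
apply: eq_measure_integral => A mA _.
rewrite /distribution /= /pushforward normal_scale// cab addrC.
rewrite -normal_law1_convol ?sqr_ge0//.
rewrite -(setIT (_ @^-1` _)) -integral_indic//; last first.
  by rewrite -[X in measurable X]setTI; have := mab measurableT A mA.
rewrite fubini_tonelli1//; last first.
  apply/measurable_EFinP; apply: measurable_indic.
  by rewrite -[X in measurable X]setTI; have := mab measurableT A mA.
apply: eq_integral => x _; rewrite /fubini_F /= -normal_scale; last first.
  rewrite -[X in measurable X]setTI.
  have : measurable_fun [set: RR] (fun z : RR => (z + a * x)%R : RR) by exact: measurable_funD.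
  by move=> /(_ measurableT _ mA).
have mS : measurable [set y : RR | A (a * x + b * y)%R].
  rewrite -[X in measurable X]setTI.
  have : measurable_fun [set: RR] (fun y : RR => (a * x + b * y)%R : RR).
    by apply: measurable_funD => //; exact: measurable_funM.
  by move=> /(_ measurableT _ mA).
rewrite (_ : _ @^-1` _ = [set y : RR | A (a * x + b * y)%R]); last first.
  by apply/seteqP; split => y /=; rewrite addrC.
by rewrite -(setIT [set y | _]) -integral_indic.
Qed.

Lemma integral_diracT d (T : measurableType d) (x : T) (f : T -> \bar R) :
  measurable_fun setT f -> \int[\d_x]_y f y = f x.
Proof. by move=> mf; rewrite integral_dirac// diracE in_setT mul1e. Qed.

End NormalStability.

Section StableStep.
Context {R : realType}.
Local Notation RR := (measurableTypeR R).
Local Open Scope ereal_scope.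
Variables (n : nat) (a b c : R).

(** The operations are parameters so that one notion serves both the line, where scalars act by
    multiplication, and row vectors. *)
Definition stable d (T : measurableType d) (comb : R -> T -> R -> T -> T)
    (scal : R -> T -> T) (nu : probability T R) := forall f : T -> \bar R,
  measurable_fun setT f -> (forall x, 0 <= f x) ->
  \int[nu]_x \int[nu]_y f (comb a x b y) = \int[nu]_x f (scal c x).

Local Notation stableR :=
  (@stable _ RR (fun a (x : RR) b y => (a * x + b * y)%R : RR)
    (fun c (x : RR) => (c * x)%R : RR)).
Local Notation stableV := (stable
  (fun a (x : 'rV[R]_n) b y => (a *: x + b *: y)%R) (fun c x => (c *: x)%R)).

Let measurable_lin (x : 'rV[R]_n) (g : 'rV[R]_n -> \bar R) :
  measurable_fun setT g -> measurable_fun setT (fun y : 'rV[R]_n => g (a *: x + b *: y)%R).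
Proof.
move=> mg; apply: (measurableT_comp mg); apply: measurable_rVD => //.
by apply: measurable_rVZ.
Qed.

Let measurable_lin_integral (nu : probability 'rV[R]_n R) (g : 'rV[R]_n -> \bar R) :
  measurable_fun setT g -> (forall x, 0 <= g x) ->
  measurable_fun setT (fun x : 'rV[R]_n => \int[nu]_y g (a *: x + b *: y)%R).
Proof.
move=> mg g0; apply: (measurable_fun_fubini_tonelli_F
  (fun z : 'rV[R]_n * 'rV[R]_n => g (a *: z.1 + b *: z.2)%R)) => //.
apply: (measurableT_comp mg).
by apply: measurable_rVD => //; apply: measurable_rVZ.
Qed.

Lemma stable_dirac : stableV (\d_(0%R : 'rV[R]_n)).
Proof.
move=> f mf f0.
rewrite integral_diracT; last exact: measurable_lin_integral.
rewrite integral_diracT; last exact: measurable_lin.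
rewrite integral_diracT ?scaler0 ?addr0//.
by apply: (measurableT_comp mf); exact: measurable_rVZ.
Qed.

Variables (gamma : probability RR R) (nu nu' : probability 'rV[R]_n R) (v : 'rV[R]_n).
Hypothesis nu'E : forall f, measurable_fun setT f -> (forall x, 0 <= f x) ->
  \int[nu']_y f y = \int[nu]_y \int[gamma]_x f (y + x *: v)%R.

(** With [x + u v] and [y + w v] in place of [x] and [y], the combination splits as
    [(a x + b y) + (a u + b w) v]; stability of [nu] deals with the first term and that of [gamma]
    with the second. *)
Lemma stable_step : stableR gamma -> stableV nu -> stableV nu'.
Proof.
move=> sgamma snu f mf f0.
pose h (z : 'rV[R]_n) := \int[gamma]_x f (z + (c * x) *: v)%R.
have mf' : measurable_fun [set: 'rV[R]_n * RR] (fun z => f (z.1 + (c * z.2) *: v)%R).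
  apply: (measurableT_comp mf); apply: measurable_rVD => //.
  by apply: measurable_rVZ => //; exact: measurable_funM.
have mh : measurable_fun setT h.
  exact: (measurable_fun_fubini_tonelli_F
    (fun z : 'rV[R]_n * RR => f (z.1 + (c * z.2) *: v)%R) mf' (fun=> f0 _)).
have h0 z : 0 <= h z by apply: integral_ge0.
rewrite nu'E; last 2 first.
- exact: measurable_lin_integral.
- by move=> x; exact: integral_ge0.
have mcf : measurable_fun setT (fun x : 'rV[R]_n => f (c *: x)%R).
  by apply: (measurableT_comp mf); apply: measurable_rVZ.
apply: (etrans _ (esym (nu'E mcf (fun=> f0 _)))).
transitivity (\int[nu]_x h (c *: x)%R); last first.
  by apply: eq_integral => x _; rewrite /h; apply: eq_integral => y _;
    rewrite scalerDr scalerA.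
rewrite -snu//; apply: eq_integral => x _.
pose k (z : RR * 'rV[R]_n) :=
  \int[gamma]_y f (a *: (x + z.1 *: v) + b *: (z.2 + y *: v))%R.
have k0 z : 0 <= k z by exact: integral_ge0.
have mk : measurable_fun setT k.
  apply: (measurable_fun_fubini_tonelli_F (fun z : RR * 'rV[R]_n * RR =>
    f (a *: (x + z.1.1 *: v) + b *: (z.1.2 + z.2 *: v))%R)) => //.
  have m1 : measurable_fun [set: RR * 'rV[R]_n * RR] (fun z => z.1.1).
    exact: (measurableT_comp measurable_fst measurable_fst).
  have m2 : measurable_fun [set: RR * 'rV[R]_n * RR] (fun z => z.1.2).
    exact: (measurableT_comp measurable_snd measurable_fst).
  apply: (measurableT_comp mf); apply: measurable_rVD => //;
    apply: measurable_rVZ => //; apply: measurable_rVD => //;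
    exact: measurable_rVZ.
transitivity (\int[gamma]_u \int[nu]_y k (u, y)).
  apply: eq_integral => u _.
  by rewrite (nu'E (measurable_lin _ mf)).
(* The integral over [u] moves inside the one over [y], next to the other integral against [gamma],
   so that stability on the line applies. *)
apply: (etrans (fubini_tonelli k mk k0)); apply: eq_integral => y _.
pose g (s : RR) := f (a *: x + b *: y + s *: v)%R.
have mg : measurable_fun setT g.
  apply: (measurableT_comp mf); apply: measurable_rVD => //.
  by apply: measurable_rVZ.
apply: (etrans _ (sgamma g mg (fun=> f0 _))).
apply: eq_integral => u _; apply: eq_integral => w _; rewrite /g; congr f.
by rewrite !scalerDr !scalerA scalerDl addrACA.
Qed.

End StableStep.

Section GaussLawStable.
Context {R : realType}.
Local Open Scope ereal_scope.

Lemma gauss_law_stable n (bs : seq 'rV[R]_n) (a b c : R) (f : 'rV[R]_n -> \bar R) :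
  (c ^+ 2 = a ^+ 2 + b ^+ 2)%R -> measurable_fun setT f -> (forall x, 0 <= f x) ->
  \int[gauss_law bs]_x \int[gauss_law bs]_y f (a *: x + b *: y)%R =
  \int[gauss_law bs]_x f (c *: x)%R.
Proof.
move=> cab; elim: bs f => [|v bs IH] f mf f0.
  exact: (@stable_dirac R n a b c f mf f0).
apply: (@stable_step R n a b c (normal_prob (0 : R) 1) (gauss_law bs)
  (gauss_law (v :: bs)) v) => //.
- by move=> g mg g0; rewrite ge0_integral_gauss_cons.
- by move=> g mg g0; exact: normal_stable.
Qed.

End GaussLawStable.

(** * Moments of normal laws *)

Section NormalMoments.
Context {R : realType}.
Local Notation mu := (@lebesgue_measure R).
Local Notation RR := (measurableTypeR R).
Local Notation gamma := (normal_prob (0 : R) 1).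
Local Notation phi := (normal_pdf (0 : R) 1).

Let normal_pdf01E x : phi x = normal_peak 1 * expR (- (2^-1 * x ^+ 2)).
Proof.
rewrite normal_pdfE ?oner_neq0// /normal_fun; congr (_ * expR _).
by rewrite subr0 expr1n mulNr mulrC.
Qed.

(** Since [phi' = - x phi], integrating this derivative trades the second moment for the total mass,
    up to boundary terms. *)
Let is_derive_xphi (x : R) :
  is_derive x 1 (fun y : R => y * phi y) (phi x - x ^+ 2 * phi x).
Proof.
have dE : is_derive x (1 : R) (fun y : R => expR (- (2^-1 * y ^+ 2)))
    (expR (- (2^-1 * x ^+ 2)) * (- (x))).
  apply: (@is_derive1_comp _ expR (fun y => - (2^-1 * y ^+ 2))).
  by apply: is_derive_eq; rewrite /GRing.scale /=; field.
rewrite (_ : (fun y => _) =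
  (fun y => normal_peak 1 * (y * expR (- (2^-1 * y ^+ 2))))); last first.
  by apply/funext => y; rewrite normal_pdf01E mulrCA.
apply: is_derive_eq; rewrite normal_pdf01E /GRing.scale /=; ring.
Qed.

Let phi_cvg0 : (fun n : nat => 2 * (n.+1%:R * phi n.+1%:R)) @ \oo --> (0 : R).
Proof.
apply: (@squeeze_cvgr _ _ _ _ (fun=> 0)
  (fun n => 2 * (normal_peak 1 * (2 * harmonic n)))).
- near=> n; apply/andP; split; first by rewrite !mulr_ge0 ?normal_pdf_ge0.
  rewrite ler_wpM2l// normal_pdf01E /harmonic; set m : R := n.+1%:R.
  have m0 : 0 < m by rewrite ltr0n.
  rewrite mulrCA ler_wpM2l ?normal_peak_ge0// expRN ler_pdivrMr ?expR_gt0//.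
  (* The bound [expR t >= 1 + t] at [t = m^2 / 2] makes [m * phi m] of order [1 / m]. *)
  apply: (@le_trans _ _ (2 * m^-1 * (1 + 2^-1 * m ^+ 2))); last first.
    by rewrite ler_wpM2l ?mulr_ge0 ?invr_ge0 ?(ltW m0)// expR_ge1Dx.
  rewrite (_ : 2 * m^-1 * _ = 2 * m^-1 + m); last by field; rewrite lt0r_neq0.
  by rewrite lerDr mulr_ge0 ?invr_ge0 ?ltW.
- exact: cvg_cst.
- rewrite [X in _ --> X](_ : 0 = 2 * (normal_peak 1 * (2 * 0))); last first.
    by rewrite !mulr0.
  do 3 (apply: cvgM; first exact: cvg_cst); exact: cvg_harmonic.
Unshelve. all: by end_near. Qed.

Let measurable_sqr_phi : measurable_fun [set: RR] (fun x : RR => x ^+ 2 * phi x).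
Proof. by apply: measurable_funM => //; exact: measurable_normal_pdf. Qed.

Let continuous_xphi : continuous (fun y : R => y * phi y).
Proof.
move=> x; apply: differentiable_continuous; apply/derivable1_diffP.
by have [] := is_derive_xphi x.
Qed.

Let continuous_phi : continuous phi.
Proof. by apply: continuous_normal_pdf; rewrite oner_neq0. Qed.

(** [n.+1] keeps the segment nondegenerate, as the fundamental theorem of calculus requires. *)
Let itvn (n : nat) : set R := `[- n.+1%:R, n.+1%:R].

Let itvn_nd : nondecreasing_seq itvn.
Proof.
move=> k l kl; apply/subsetPset => x; rewrite /itvn /= !in_itv /= => /andP[h1 h2].
have kl' : k.+1%:R <= l.+1%:R :> R by rewrite ler_nat.
by rewrite (le_trans _ h1) ?lerN2// (le_trans h2).
Qed.

Let bigcup_itvn : \bigcup_n itvn n = setT.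
Proof.
apply/seteqP; split => // x _; exists (Num.truncn `|x|) => //.
rewrite /itvn /= in_itv /= -ler_norml ltW//; exact: truncnS_gt.
Qed.

Let segment_sqr_phi n :
  (\int[mu]_(x in itvn n) (x ^+ 2 * phi x)%:E + (2 * (n.+1%:R * phi n.+1%:R))%:E =
   \int[mu]_(x in itvn n) (phi x)%:E)%E.
Proof.
have mI : measurable (itvn n) by exact: measurable_itv.
have iphi : mu.-integrable (itvn n) (EFin \o phi).
  by apply: (integrableS measurableT) => //; exact: integrable_normal_pdf.
have cF : continuous (fun x : R => phi x - x ^+ 2 * phi x).
  move=> x; apply: cvgB; first exact: continuous_phi.
  apply: cvgM; last exact: continuous_phi.
  exact: exprn_continuous.
have ilin : mu.-integrable (itvn n) (EFin \o (fun x => phi x - x ^+ 2 * phi x)).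
  apply: continuous_compact_integrable; first exact: segment_compact.
  exact: continuous_subspaceT.
have ftc : (\int[mu]_(x in itvn n) (phi x - x ^+ 2 * phi x)%:E =
    (2 * (n.+1%:R * phi n.+1%:R))%:E)%E.
  rewrite (@continuous_FTC2 _ _ (fun y => y * phi y)).
  - rewrite -EFinB; congr EFin; rewrite !normal_pdf01E sqrrN; ring.
  - by rewrite gtrN// ltr0n.
  - exact: continuous_subspaceT.
  - split.
    + by move=> x _; have [] := is_derive_xphi x.
    + by apply: cvg_at_right_filter; exact: continuous_xphi.
    + by apply: cvg_at_left_filter; exact: continuous_xphi.
  - by move=> x _; rewrite derive1E; have [] := is_derive_xphi x.
rewrite -ftc -integralD//.
- by apply: eq_integral => x _; rewrite -EFinD addrC subrK.
- apply: continuous_compact_integrable; first exact: segment_compact.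
  apply: continuous_subspaceT => x.
  apply: cvgM; last exact: continuous_phi.
  exact: exprn_continuous.
Qed.

Lemma integral_sqr_normal : (\int[gamma]_x (x ^+ 2)%:E = 1)%E.
Proof.
rewrite ge0_integral_normal_prob; last 2 first.
- by apply/measurable_EFinP; exact: measurable_funX.
- by move=> x; rewrite lee_fin sqr_ge0.
under eq_integral do rewrite -EFinM.
have lim1 : (\int[mu]_(x in itvn i) (x ^+ 2 * phi x)%:E @[i --> \oo] -->
    \int[mu]_x (x ^+ 2 * phi x)%:E)%E.
  rewrite -bigcup_itvn; apply: ge0_nondecreasing_set_cvg_integral => //.
  - by move=> i; exact: measurable_itv.
  - by move=> i; apply/measurable_funTS/measurable_EFinP.
  - by move=> i x _; rewrite lee_fin mulr_ge0 ?sqr_ge0 ?normal_pdf_ge0.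
have lim2 : (\int[mu]_(x in itvn i) (phi x)%:E @[i --> \oo] --> 1)%E.
  rewrite -(integral_normal_pdf (0 : R) 1) -bigcup_itvn.
  apply: ge0_nondecreasing_set_cvg_integral => //.
  - by move=> i; exact: measurable_itv.
  - by move=> i; apply/measurable_funTS/measurable_EFinP; exact: measurable_normal_pdf.
  - by move=> i x _; rewrite lee_fin normal_pdf_ge0.
have lim3 : (\int[mu]_(x in itvn i) (phi x)%:E @[i --> \oo] -->
    \int[mu]_x (x ^+ 2 * phi x)%:E + 0)%E.
  under eq_cvg do rewrite -segment_sqr_phi.
  apply: cvgeD; [exact: fin_num_adde_defl|exact: lim1|].
  by apply/fine_cvgP; split; [near=> n|exact: phi_cvg0].
by have := cvg_unique _ lim2 lim3; rewrite adde0 => ->.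
Unshelve. all: by end_near. Qed.

End NormalMoments.

(** Dominates first moments by second moments; it comes from the square of [|x| - 1]. *)
Lemma normr_le1Dsqr {R : realDomainType} (x : R) : `|x| <= `|1 + x ^+ 2|.
Proof.
rewrite [leRHS]ger0_norm ?addr_ge0 ?sqr_ge0//.
have := sqr_ge0 (`|x| - 1); rewrite -[x ^+ 2]real_normK ?num_real//; nra.
Qed.

Section Transfer.
Context {R : realType}.
Local Notation RR := (measurableTypeR R).
Local Notation gamma := (normal_prob (0 : R) 1).
Local Open Scope ereal_scope.

Lemma measurable_dot n (t : 'rV[R]_n) :
  measurable_fun [set: 'rV[R]_n] (fun y => (y *m t^T) ord0 ord0).
Proof.
under eq_fun do rewrite mxE.
by apply: measurable_sum => j; apply: measurable_funM => //; exact: measurable_coord.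
Qed.

Lemma integrable_normal_id : gamma.-integrable setT (fun x : RR => (x : R)%:E).
Proof.
apply: (@le_integrable _ _ _ _ _ measurableT _ (fun x : RR => (1 + x ^+ 2)%:E)).
- exact/measurable_EFinP.
- by move=> x _ /=; rewrite lee_fin; exact: normr_le1Dsqr.
- apply/integrableP; split.
    by apply/measurable_EFinP; apply: measurable_funD => //; exact: measurable_funX.
  under eq_integral do rewrite gee0_abs ?lee_fin ?addr_ge0 ?sqr_ge0// EFinD.
  rewrite ge0_integralD//; last 2 first.
  - by move=> x _; rewrite lee_fin sqr_ge0.
  - by apply/measurable_EFinP; exact: measurable_funX.
  rewrite integral_sqr_normal integral_probability_cst ltry//.
Qed.

(** The law is invariant under change of sign, so the mean equals its opposite. *)
Lemma integral_normal_id : \int[gamma]_x (x : R)%:E = 0.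
Proof.
have mN : measurable_fun [set: RR] (fun x : RR => (-1 * x)%R : RR).
  exact: measurable_funM.
pose N := HB.pack_for {mfun RR >-> RR} (fun x : RR => (-1 * x)%R : RR)
  (isMeasurableFun.Build _ _ _ _ _ mN).
have intN : gamma.-integrable setT (fun x : RR => (-1 * x)%R%:E).
  by under eq_fun do rewrite EFinM; apply: integrableZl => //; exact: integrable_normal_id.
have eN : \int[gamma]_x (x : R)%:E = \int[distribution gamma N]_x (x : R)%:E.
  apply: eq_measure_integral => A mA _.
  have := normal_scale (-1)%R mA.
  rewrite sqrrN expr1n /normal_law1 (negbTE (oner_neq0 _)) sqrtr1 => h.
  exact: (esym h).
have fi : \int[gamma]_x (x : R)%:E \is a fin_num.
  by apply: integrable_fin_num => //; exact: integrable_normal_id.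
move: eN; rewrite integral_distribution//=.
under [in X in _ = X]eq_integral do rewrite EFinM.
rewrite integralZl//; last exact: integrable_normal_id.
rewrite -(fineK fi) -EFinM => -[] h; congr EFin; move: h.
set u := fine _; lra.
Qed.

Variables (n : nat) (bs : seq 'rV[R]_n) (t : 'rV[R]_n).
Let v : R := (\sum_(b <- bs) ((b *m t^T) ord0 ord0) ^+ 2)%R.
Let v0 : (0 <= v)%R. Proof. by apply: sumr_ge0 => b _; exact: sqr_ge0. Qed.

Let dot_fun (y : 'rV[R]_n) : RR := (y *m t^T) ord0 ord0.
Let mdot : measurable_fun setT dot_fun. Proof. exact: measurable_dot. Qed.
Let dotm : {mfun 'rV[R]_n >-> RR} := HB.pack_for {mfun 'rV[R]_n >-> RR} dot_fun
  (isMeasurableFun.Build _ _ _ _ _ mdot).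
Let scal_fun (x : RR) : RR := (Num.sqrt v * x)%R.
Let mscal : measurable_fun setT scal_fun. Proof. exact: measurable_funM. Qed.
Let scalm : {mfun RR >-> RR} := HB.pack_for {mfun RR >-> RR} scal_fun
  (isMeasurableFun.Build _ _ _ _ _ mscal).

(** A linear functional under [gauss_law] has the law of [sqrt v] times a standard normal variable;
    the moments below are carried over from the line. *)
Let gauss_dotE (A : set RR) : measurable A ->
  distribution (gauss_law bs) dotm A = distribution gamma scalm A.
Proof.
move=> mA; have := normal_scale (Num.sqrt v) mA; rewrite sqr_sqrtr// => h.
have := gauss_law_marginal bs t mA; rewrite -h; exact.
Qed.

Lemma integral_gauss_sqr :
  \int[gauss_law bs]_y (((y *m t^T) ord0 ord0) ^+ 2)%:E = v%:E.
Proof.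
pose f (x : RR) := (x ^+ 2)%:E.
have mf : measurable_fun setT f by apply/measurable_EFinP; exact: measurable_funX.
have f0 x : 0 <= f x by rewrite lee_fin sqr_ge0.
transitivity (\int[distribution (gauss_law bs) dotm]_x f x).
  by rewrite ge0_integral_distribution.
transitivity (\int[distribution gamma scalm]_x f x).
  by apply: eq_measure_integral => A mA _; exact: gauss_dotE.
rewrite ge0_integral_distribution//=.
under eq_integral do rewrite /f /scal_fun exprMn sqr_sqrtr// EFinM.
rewrite ge0_integralZl//; last by move=> x _; rewrite lee_fin sqr_ge0.
by rewrite integral_sqr_normal mule1.
Qed.

Lemma integrable_gauss_dot :
  (gauss_law bs).-integrable setT (fun y => ((y *m t^T) ord0 ord0)%:E).
Proof.
apply: (@le_integrable _ _ _ _ _ measurableT _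
    (fun y => (1 + ((y *m t^T) ord0 ord0) ^+ 2)%:E)).
- by apply/measurable_EFinP; exact: measurable_dot.
- by move=> y _ /=; rewrite lee_fin; exact: normr_le1Dsqr.
- apply/integrableP; split.
    apply/measurable_EFinP; apply: measurable_funD => //.
    by apply: measurable_funX; exact: measurable_dot.
  under eq_integral do rewrite gee0_abs ?lee_fin ?addr_ge0 ?sqr_ge0// EFinD.
  rewrite ge0_integralD//; last 2 first.
  - by move=> x _; rewrite lee_fin sqr_ge0.
  - by apply/measurable_EFinP; apply: measurable_funX; exact: measurable_dot.
  by rewrite integral_gauss_sqr integral_probability_cst ltry.
Qed.

Lemma integral_gauss_dot :
  \int[gauss_law bs]_y ((y *m t^T) ord0 ord0)%:E = 0.
Proof.
pose f (x : RR) := (x : R)%:E.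
have mf : measurable_fun setT f by exact/measurable_EFinP.
transitivity (\int[distribution (gauss_law bs) dotm]_x f x).
  by rewrite integral_distribution//; exact: integrable_gauss_dot.
transitivity (\int[distribution gamma scalm]_x f x).
  by apply: eq_measure_integral => A mA _; exact: gauss_dotE.
have isc : gamma.-integrable setT (f \o scalm).
  rewrite (_ : _ \o _ = (fun x : RR => (Num.sqrt v)%:E * (x : R)%:E)).
    by apply: integrableZl => //; exact: integrable_normal_id.
  by apply/funext => x; rewrite /f /= /scal_fun EFinM.
rewrite integral_distribution//=.
under eq_integral do rewrite /f /scal_fun EFinM.
rewrite integralZl//; last exact: integrable_normal_id.
by rewrite integral_normal_id mule0.
Qed.

End Transfer.

(** * Covariance matrices as sums of rank-one matrices *)

Section RankOneDecomposition.
Context {R : realType} {n : nat}.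
Implicit Types (C : 'M[R]_n) (t b : 'rV[R]_n).

Definition posdef_semi C := forall t, 0 <= (t *m C *m t^T) ord0 ord0.

Let mul_delta (k l : 'I_n) C :
  (delta_mx ord0 k *m C *m (delta_mx ord0 l)^T) (ord0 : 'I_1) (ord0 : 'I_1) = C k l.
Proof. by rewrite -rowE trmx_delta -colE !mxE. Qed.

Let quad_delta C (x : R) i (t : 'rV[R]_n) : C^T = C ->
  ((x *: delta_mx ord0 i + t) *m C *m (x *: delta_mx ord0 i + t)^T) ord0 ord0 =
  x ^+ 2 * C i i + 2 * x * (t *m C) ord0 i + (t *m C *m t^T) ord0 ord0.
Proof.
move=> sC.
have dE : delta_mx ord0 i *m C *m (delta_mx (ord0 : 'I_1) i)^T = (C i i)%:M.
  by apply/matrixP => k l; rewrite !ord1 mul_delta mxE eqxx.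
have tE : t *m C *m (delta_mx (ord0 : 'I_1) i)^T = ((t *m C) ord0 i)%:M.
  apply/matrixP => k l; rewrite !ord1 trmx_delta -colE !mxE eqxx mulr1n.
  by [].
have tE' : delta_mx ord0 i *m C *m t^T = ((t *m C) ord0 i)%:M.
  have := congr1 trmx tE; rewrite !trmx_mul trmxK tr_scalar_mx sC => <-.
  by rewrite mulmxA.
rewrite linearD /= linearZ /= mulmxDr !mulmxDl -!scalemxAl -!scalemxAr dE tE tE'.
by rewrite !mxE eqxx !mulr1n; ring.
Qed.

Let zero_row C i j : C^T = C -> posdef_semi C -> C i i = 0 -> C i j = 0.
Proof.
move=> sC pC Ci; apply: contrapT => /eqP Cij.
(* This multiple of the [i]-th basis vector brings the quadratic form down to [-1]. *)
have := pC ((- (C j j + 1) / (2 * C i j)) *: delta_mx ord0 i + delta_mx ord0 j).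
rewrite quad_delta// Ci mulr0 add0r mul_delta -rowE mxE.
have cji : C j i = C i j by rewrite -[in LHS]sC mxE.
rewrite cji (_ : 2 * _ * _ = - (C j j + 1)); last by field.
by rewrite opprD addrAC addNr sub0r oppr_ge0 leNgt ltr01.
Qed.

(* Cholesky elimination of one index at a time. *)
Lemma rank_one_decomposition C : C^T = C -> posdef_semi C ->
  exists bs : seq 'rV[R]_n, C = \sum_(b <- bs) b^T *m b.
Proof.
(* Induction on the number [k] of rows still to be eliminated: the first [n - k] rows are zero. *)
suff H k : forall C, C^T = C -> posdef_semi C ->
    (forall i j : 'I_n, (i < n - k)%N -> C i j = 0) ->
    exists bs : seq 'rV[R]_n, C = \sum_(b <- bs) b^T *m b.
  by move=> sC pC; apply: (H n C) => // i j; rewrite subnn.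
elim: k => [|k IH] {}C sC pC C0.
  exists [::]; rewrite big_nil; apply/matrixP => i j.
  by rewrite C0 ?mxE// subn0.
have [nk|kn] := leqP n k.
  by apply: IH => // i j ik; apply: C0; lia.
have i0n : (n - k.+1 < n)%N by lia.
pose i0 := Ordinal i0n.
have [Ci0|Ci0] := eqVneq (C i0 i0) 0.
  apply: IH => // i j ik; have : (i <= n - k.+1)%N by lia.
  rewrite leq_eqVlt => /orP[/eqP ii0|]; last exact: C0.
  by rewrite (_ : i = i0); [exact: zero_row|exact: val_inj].
have Cp : 0 < C i0 i0.
  by rewrite lt_neqAle eq_sym Ci0 /= -mul_delta; exact: pC.
pose b : 'rV[R]_n := (Num.sqrt (C i0 i0))^-1 *: row i0 C.
have bbE i j : (b^T *m b) i j = C i0 i * C i0 j / C i0 i0.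
  rewrite mxE big_ord1 !mxE mulrACA -invfM -expr2 sqr_sqrtr ?(ltW Cp)// mulrC.
  by [].
have sCi i : C i i0 = C i0 i by rewrite -[in LHS]sC mxE.
have [|||bs bsE] := IH (C - b^T *m b).
- by rewrite linearB /= trmx_mul trmxK sC.
- move=> t.
  (* The shift of [t] along the pivot that minimizes the form; the minimum is the form of the Schur
     complement at [t]. *)
  have := pC ((- ((t *m C) ord0 i0 / C i0 i0)) *: delta_mx ord0 i0 + t).
  rewrite quad_delta//.
  have -> : (t *m (C - b^T *m b) *m t^T) ord0 ord0 =
      (t *m C *m t^T) ord0 ord0 - ((t *m C) ord0 i0) ^+ 2 / C i0 i0.
    rewrite mulmxBr mulmxBl [LHS]mxE [X in _ + X = _]mxE; congr (_ - _).
    have btE : (b *m t^T) ord0 ord0 = (Num.sqrt (C i0 i0))^-1 * (t *m C) ord0 i0.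
      rewrite !mxE mulr_sumr; apply: eq_bigr => j _; rewrite !mxE sCi; ring.
    have -> : t *m (b^T *m b) *m t^T = (b *m t^T)^T *m (b *m t^T).
      by rewrite trmx_mul trmxK !mulmxA.
    rewrite mxE big_ord1 mxE btE mulrACA -invfM -expr2 sqr_sqrtr ?(ltW Cp)//.
    by rewrite mulrC expr2.
  move=> h; apply: le_trans h _; rewrite le_eqVlt; apply/orP; left; apply/eqP.
  by field.
- move=> i j ik; rewrite !mxE big_ord1.
  have := bbE i j; rewrite mxE big_ord1 => ->.
  have : (i <= n - k.+1)%N by lia.
  rewrite leq_eqVlt => /orP[/eqP ii0|ii0].
    by rewrite (_ : i = i0); [rewrite mulrAC divff// mul1r subrr|exact: val_inj].
  by rewrite -sCi (C0 i j ii0) (C0 i i0 ii0) !mul0r subrr.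
by exists (b :: bs); rewrite big_cons -bsE addrC subrK.
Qed.

Lemma quad_rank_one (bs : seq 'rV[R]_n) (t : 'rV[R]_n) :
  (t *m (\sum_(b <- bs) b^T *m b) *m t^T) ord0 ord0 =
  \sum_(b <- bs) ((b *m t^T) ord0 ord0) ^+ 2.
Proof.
elim: bs => [|b bs IH]; first by rewrite !big_nil mulmx0 mul0mx mxE.
rewrite !big_cons mulmxDr mulmxDl mxE IH; congr (_ + _).
have -> : t *m (b^T *m b) *m t^T = (b *m t^T)^T *m (b *m t^T).
  by rewrite trmx_mul trmxK !mulmxA.
by rewrite mxE big_ord1 mxE expr2.
Qed.

End RankOneDecomposition.

(** * Smooth test functions *)

Section RowNorm.
Context {R : realDomainType} {n : nat}.

Lemma coord_le_norm (x : 'rV[R]_n) i : `|x ord0 i| <= `|x|.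
Proof.
by rewrite [leRHS]mx_normrE; apply: (@le_bigmax _ _ _ _ (fun ij : 'I_1 * 'I_n => `|x ij.1 ij.2|) (ord0, i)).
Qed.

Lemma norm_rV_le (x : 'rV[R]_n) c : 0 <= c -> (forall i, `|x ord0 i| <= c) -> `|x| <= c.
Proof.
move=> c0 xc; rewrite [leLHS]mx_normrE; apply/bigmax_leP; split => // -[i j] _ /=.
by rewrite ord1.
Qed.

End RowNorm.

Section TaylorClass.
Context {R : realType} {n : nat}.
Implicit Types (H : 'rV[R]_n -> R) (x v : 'rV[R]_n).

Definition linf (b v : 'rV[R]_n) : R := \sum_i b ord0 i * v ord0 i.
Definition quadf (c : 'M[R]_n) v : R := \sum_i \sum_j c i j * (v ord0 i * v ord0 j).

(* The smooth test functions of the Lindeberg argument. *)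
Definition taylor_class H := exists (b : 'rV[R]_n -> 'rV[R]_n)
    (c : 'rV[R]_n -> 'M[R]_n) (K : R),
  [/\ measurable_fun setT H /\ (forall x, `|H x| <= K),
      forall i, measurable_fun setT (fun x => b x ord0 i) /\
        forall x, `|b x ord0 i| <= K,
      forall i j, measurable_fun setT (fun x => c x i j) /\
        forall x, `|c x i j| <= K &
      forall x v, `|H (x + v) - H x - linf (b x) v - quadf (c x) v| <= K * `|v| ^+ 3].

Lemma linf_le (b : 'rV[R]_n) v (K : R) : (forall i, `|b ord0 i| <= K) -> `|linf b v| <= n%:R * K * `|v|.
Proof.
move=> bK; rewrite (le_trans (ler_norm_sum _ _ _))//.
rewrite -mulrA mulr_natl -[X in _ *+ X]card_ord -sumr_const ler_sum// => i _.
by rewrite normrM ler_pM// coord_le_norm.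
Qed.

Lemma quadf_le (c : 'M[R]_n) v (K : R) : (forall i j, `|c i j| <= K) ->
  `|quadf c v| <= n%:R * n%:R * K * `|v| ^+ 2.
Proof.
move=> cK; rewrite (le_trans (ler_norm_sum _ _ _))//.
rewrite -!mulrA mulr_natl -[X in _ *+ X]card_ord -sumr_const ler_sum// => i _.
rewrite (le_trans (ler_norm_sum _ _ _))//.
rewrite mulr_natl -[X in _ *+ X]card_ord -sumr_const ler_sum// => j _.
by rewrite !normrM ler_pM ?mulr_ge0// expr2 ler_pM// coord_le_norm.
Qed.

Lemma taylor_class_cst (r : R) : taylor_class (fun=> r).
Proof.
exists (fun=> 0), (fun=> 0), `|r|; split.
- by split.
- by move=> i; split => [|x]; rewrite mxE// normr0.
- by move=> i j; split => [|x]; rewrite mxE// normr0.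
- move=> x v; rewrite subrr sub0r /linf /quadf !big1 ?oppr0 ?addr0 ?normr0.
  + by rewrite mulr_ge0// exprn_ge0.
  + by move=> i _; rewrite big1// => j _; rewrite mxE mul0r.
  + by move=> i _; rewrite mxE mul0r.
Qed.

Let maxK2 (k1 k2 : R) : 0 <= k1 -> 0 <= k2 -> k1 <= k1 + k2 /\ k2 <= k1 + k2.
Proof. by move=> k10 k20; rewrite lerDl lerDr. Qed.

Lemma taylor_classD H1 H2 : taylor_class H1 -> taylor_class H2 ->
  taylor_class (fun x => H1 x + H2 x).
Proof.
move=> [b1 [c1 [K1 [[mH1 H1K] b1K c1K R1]]]] [b2 [c2 [K2 [[mH2 H2K] b2K c2K R2]]]].
exists (fun x => b1 x + b2 x), (fun x => c1 x + c2 x), (K1 + K2); split.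
- by split; [exact: measurable_funD|move=> x; rewrite (le_trans (ler_normD _ _))// lerD].
- move=> i; have [? h1] := b1K i; have [? h2] := b2K i; split => [|x].
    by under eq_fun do rewrite mxE; exact: measurable_funD.
  by rewrite mxE (le_trans (ler_normD _ _))// lerD.
- move=> i j; have [? h1] := c1K i j; have [? h2] := c2K i j; split => [|x].
    by under eq_fun do rewrite mxE; exact: measurable_funD.
  by rewrite mxE (le_trans (ler_normD _ _))// lerD.
- move=> x v.
  have -> : linf (b1 x + b2 x) v = linf (b1 x) v + linf (b2 x) v.
    by rewrite -big_split; apply: eq_bigr => i _; rewrite mxE mulrDl.
  have -> : quadf (c1 x + c2 x) v = quadf (c1 x) v + quadf (c2 x) v.
    rewrite -big_split; apply: eq_bigr => i _; rewrite -big_split.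
    by apply: eq_bigr => j _; rewrite mxE mulrDl.
  rewrite mulrDl (le_trans _ (lerD (R1 x v) (R2 x v)))//.
  by rewrite (le_trans _ (ler_normD _ _))// le_eqVlt; apply/orP; left; apply/eqP;
    congr `|_|; ring.
Qed.

(** For [s <= 1] the product is expanded, and each of the seven terms left has order at least 3. For
    [s > 1] the expansion would produce powers up to 6, so the seven terms are bounded as they
    stand, using that both factors are bounded by [B]. *)
Let prod_remainder (B s h1 h2 l1 l2 q1 q2 r1 r2 : R) : 0 <= s -> 0 <= B ->
  `|h1| <= B -> `|h2| <= B -> `|h1 + l1 + q1 + r1| <= B -> `|h2 + l2 + q2 + r2| <= B ->
  `|l1| <= B * s -> `|l2| <= B * s -> `|q1| <= B * s ^+ 2 -> `|q2| <= B * s ^+ 2 ->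
  `|r1| <= B * s ^+ 3 -> `|r2| <= B * s ^+ 3 ->
  `|(h1 + l1 + q1 + r1) * (h2 + l2 + q2 + r2) - h1 * h2 - (h1 * l2 + h2 * l1) -
    (h1 * q2 + h2 * q1 + l1 * l2)| <= 8 * B ^+ 2 * s ^+ 3.
Proof.
move=> s0 B0 h1B h2B H1B H2B l1B l2B q1B q2B r1B r2B.
have M (a b p q : R) : `|a| <= p -> `|b| <= q -> `|a * b| <= p * q.
  by move=> ap bq; rewrite normrM ler_pM.
have ns (k : nat) : 0 <= s ^+ k by rewrite exprn_ge0.
have B2 : 0 <= B ^+ 2 by rewrite exprn_ge0.
have L (a q : R) : `|a| <= q -> q <= B ^+ 2 * s ^+ 3 ->
    - (B ^+ 2 * s ^+ 3) <= a <= B ^+ 2 * s ^+ 3.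
  by move=> aq q3; rewrite -ler_norml (le_trans aq).
have [s1|s1] := leP s 1.
- have s43 : s ^+ 4 <= s ^+ 3 by rewrite ler_wiXn2l.
  have /L t1 := M _ _ _ _ l1B q2B.
  have /L t2 := M _ _ _ _ q1B l2B.
  have /L t3 := M _ _ _ _ q1B q2B.
  have /L t4 := M _ _ _ _ h1B r2B.
  have /L t5 := M _ _ _ _ l1B r2B.
  have /L t6 := M _ _ _ _ q1B r2B.
  have /L t7 := M _ _ _ _ r1B H2B.
  have -> : (h1 + l1 + q1 + r1) * (h2 + l2 + q2 + r2) - h1 * h2 -
    (h1 * l2 + h2 * l1) - (h1 * q2 + h2 * q1 + l1 * l2) =
    l1 * q2 + q1 * l2 + q1 * q2 + h1 * r2 + l1 * r2 + q1 * r2 +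
    r1 * (h2 + l2 + q2 + r2) by ring.
  have p4 : B * s * (B * s ^+ 3) <= B ^+ 2 * s ^+ 3.
    rewrite (_ : _ * _ = B ^+ 2 * s ^+ 4); last by ring.
    by rewrite ler_wpM2l.
  have p4' : B * s ^+ 2 * (B * s ^+ 2) <= B ^+ 2 * s ^+ 3.
    rewrite (_ : _ * _ = B ^+ 2 * s ^+ 4); last by ring.
    by rewrite ler_wpM2l.
  have p5 : B * s ^+ 2 * (B * s ^+ 3) <= B ^+ 2 * s ^+ 3.
    rewrite (_ : _ * _ = B ^+ 2 * s ^+ 5); last by ring.
    by rewrite ler_wpM2l// ler_wiXn2l.
  have /andP[a1 b1] := t1 ltac:(nra). have /andP[a2 b2] := t2 ltac:(nra).
  have /andP[a3 b3] := t3 p4'. have /andP[a4 b4] := t4 ltac:(nra).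
  have /andP[a5 b5] := t5 p4. have /andP[a6 b6] := t6 p5.
  have /andP[a7 b7] := t7 ltac:(nra).
  have n3 := mulr_ge0 B2 (ns 3).
  by rewrite ler_norml; apply/andP; split; lra.
- have s1' := ltW s1.
  have s3 : 1 <= s ^+ 3 by rewrite exprn_ege1.
  have s13 : s <= s ^+ 3 by rewrite -[leLHS]expr1 ler_weXn2l.
  have s23 : s ^+ 2 <= s ^+ 3 by rewrite ler_weXn2l.
  have p0 : B * B <= B ^+ 2 * s ^+ 3 by rewrite -expr2 ler_peMr.
  have p1 : B * (B * s) <= B ^+ 2 * s ^+ 3 by rewrite mulrA -expr2 ler_wpM2l.
  have p2 : B * (B * s ^+ 2) <= B ^+ 2 * s ^+ 3 by rewrite mulrA -expr2 ler_wpM2l.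
  have p2' : B * s * (B * s) <= B ^+ 2 * s ^+ 3.
    by rewrite mulrACA -!expr2 ler_wpM2l.
  have /andP[a1 b1] := L _ _ (M _ _ _ _ H1B H2B) p0.
  have /andP[a2 b2] := L _ _ (M _ _ _ _ h1B h2B) p0.
  have /andP[a3 b3] := L _ _ (M _ _ _ _ h1B l2B) p1.
  have /andP[a4 b4] := L _ _ (M _ _ _ _ h2B l1B) p1.
  have /andP[a5 b5] := L _ _ (M _ _ _ _ h1B q2B) p2.
  have /andP[a6 b6] := L _ _ (M _ _ _ _ h2B q1B) p2.
  have /andP[a7 b7] := L _ _ (M _ _ _ _ l1B l2B) p2'.
  have n3 := mulr_ge0 B2 (ns 3).
  by rewrite ler_norml; apply/andP; split; lra.
Qed.

Lemma taylor_classM H1 H2 : taylor_class H1 -> taylor_class H2 ->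
  taylor_class (fun x => H1 x * H2 x).
Proof.
move=> [b1 [c1 [K1 [[mH1 H1K] b1K c1K R1]]]] [b2 [c2 [K2 [[mH2 H2K] b2K c2K R2]]]].
have K10 : 0 <= K1 by rewrite (le_trans _ (H1K 0)).
have K20 : 0 <= K2 by rewrite (le_trans _ (H2K 0)).
pose K := K1 + K2; have [K1K K2K] := maxK2 K10 K20.
(* One constant above the values, the linear parts ([n K]) and the quadratic parts ([n^2 K]). *)
pose B := (1 + n%:R + n%:R * n%:R) * K.
have n0 : 0 <= n%:R :> R by [].
have KB : K <= B /\ n%:R * K <= B /\ n%:R * n%:R * K <= B.
  have := mulr_ge0 n0 n0.
  have K0 : 0 <= K by rewrite addr_ge0.
  move=> nn0; rewrite /B; have := mulr_ge0 n0 K0; have := mulr_ge0 nn0 K0; split; [lra|split; lra].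
have [KB0 [KB1 KB2]] := KB.
have B0 : 0 <= B by rewrite (le_trans _ KB0)// addr_ge0.
have H1K' x : `|H1 x| <= K by rewrite (le_trans (H1K x)).
have H2K' x : `|H2 x| <= K by rewrite (le_trans (H2K x)).
have b1K' x i : `|b1 x ord0 i| <= K by rewrite (le_trans ((b1K i).2 x)).
have b2K' x i : `|b2 x ord0 i| <= K by rewrite (le_trans ((b2K i).2 x)).
have c1K' x i j : `|c1 x i j| <= K by rewrite (le_trans ((c1K i j).2 x)).
have c2K' x i j : `|c2 x i j| <= K by rewrite (le_trans ((c2K i j).2 x)).
have K0 : 0 <= K by rewrite addr_ge0.
have KK : K * K <= B ^+ 2 by rewrite expr2 ler_pM.
have B20 : 0 <= B ^+ 2 by rewrite exprn_ge0.
have M (a b : R) : `|a| <= K -> `|b| <= K -> `|a * b| <= B ^+ 2.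
  by move=> ap bq; rewrite (le_trans _ KK)// normrM ler_pM.
exists (fun x => H1 x *: b2 x + H2 x *: b1 x),
  (fun x => H1 x *: c2 x + H2 x *: c1 x + (b1 x)^T *m b2 x), (8 * B ^+ 2); split.
- split; first exact: measurable_funM.
  by move=> x; rewrite (le_trans (M _ _ (H1K' x) (H2K' x)))//; lra.
- move=> i; have [? h1] := b1K i; have [? h2] := b2K i; split => [|x].
    under eq_fun do rewrite !mxE.
    by apply: measurable_funD; apply: measurable_funM.
  rewrite !mxE (le_trans (ler_normD _ _))//.
  have := M _ _ (H1K' x) (b2K' x i); have := M _ _ (H2K' x) (b1K' x i); lra.
- move=> i j; have [? h1] := c1K i j; have [? h2] := c2K i j.
  have [? _] := b1K i; have [? _] := b2K j.
  have E x : (H1 x *: c2 x + H2 x *: c1 x + (b1 x)^T *m b2 x) i j =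
      H1 x * c2 x i j + H2 x * c1 x i j + b1 x ord0 i * b2 x ord0 j.
    by rewrite !mxE big_ord1 mxE.
  split => [|x].
    under eq_fun do rewrite E.
    by apply: measurable_funD; [apply: measurable_funD|]; apply: measurable_funM.
  rewrite E !(le_trans (ler_normD _ _))//.
  rewrite (le_trans (lerD (ler_normD _ _) (lexx _)))//.
  have := M _ _ (H1K' x) (c2K' x i j); have := M _ _ (H2K' x) (c1K' x i j).
  have := M _ _ (b1K' x i) (b2K' x j); lra.
- move=> x v.
  have -> : linf (H1 x *: b2 x + H2 x *: b1 x) v =
      H1 x * linf (b2 x) v + H2 x * linf (b1 x) v.
    rewrite !mulr_sumr -big_split; apply: eq_bigr => i _.
    by rewrite !mxE mulrDl !mulrA.
  have -> : quadf (H1 x *: c2 x + H2 x *: c1 x + (b1 x)^T *m b2 x) v =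
      H1 x * quadf (c2 x) v + H2 x * quadf (c1 x) v + linf (b1 x) v * linf (b2 x) v.
    rewrite /quadf /linf mulr_suml !mulr_sumr -!big_split; apply: eq_bigr => i _ /=.
    rewrite !mulr_sumr -!big_split; apply: eq_bigr => j _ /=.
    by rewrite !mxE big_ord1 mxE; ring.
  pose r1 := H1 (x + v) - H1 x - linf (b1 x) v - quadf (c1 x) v.
  pose r2 := H2 (x + v) - H2 x - linf (b2 x) v - quadf (c2 x) v.
  have e1 : H1 (x + v) = H1 x + linf (b1 x) v + quadf (c1 x) v + r1 by rewrite /r1; ring.
  have e2 : H2 (x + v) = H2 x + linf (b2 x) v + quadf (c2 x) v + r2 by rewrite /r2; ring.
  have s3 : 0 <= `|v| ^+ 3 by rewrite exprn_ge0.
  have s2 : 0 <= `|v| ^+ 2 by rewrite exprn_ge0.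
  have := prod_remainder (normr_ge0 v) B0 (le_trans (H1K' x) KB0) (le_trans (H2K' x) KB0).
  move=> /(_ (linf (b1 x) v) (linf (b2 x) v) (quadf (c1 x) v) (quadf (c2 x) v) r1 r2).
  rewrite -e1 -e2; apply.
  + exact: le_trans (H1K' _) KB0.
  + exact: le_trans (H2K' _) KB0.
  + by rewrite (le_trans (linf_le v (b1K' x)))// ler_wpM2r.
  + by rewrite (le_trans (linf_le v (b2K' x)))// ler_wpM2r.
  + by rewrite (le_trans (quadf_le v (c1K' x)))// ler_wpM2r.
  + by rewrite (le_trans (quadf_le v (c2K' x)))// ler_wpM2r.
  + by rewrite (le_trans (R1 x v))// ler_wpM2r// (le_trans K1K).
  + by rewrite (le_trans (R2 x v))// ler_wpM2r// (le_trans K2K).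
Qed.

Lemma taylor_class_sum (I : Type) (s : seq I) (H : I -> 'rV[R]_n -> R) :
  (forall i, taylor_class (H i)) -> taylor_class (fun x => \sum_(i <- s) H i x).
Proof.
move=> tH; elim: s => [|i s IH].
  by under eq_fun do rewrite big_nil; exact: taylor_class_cst.
by under eq_fun do rewrite big_cons; exact: taylor_classD.
Qed.

Lemma taylor_class_prod (I : Type) (s : seq I) (H : I -> 'rV[R]_n -> R) :
  (forall i, taylor_class (H i)) -> taylor_class (fun x => \prod_(i <- s) H i x).
Proof.
move=> tH; elim: s => [|i s IH].
  by under eq_fun do rewrite big_nil; exact: taylor_class_cst.
by under eq_fun do rewrite big_cons; exact: taylor_classM.
Qed.

Lemma taylor_class_coord (g b c : R -> R) (K : R) i :
  measurable_fun setT g -> measurable_fun setT b -> measurable_fun setT c ->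
  (forall y, `|g y| <= K) -> (forall y, `|b y| <= K) -> (forall y, `|c y| <= K) ->
  (forall y u, `|g (y + u) - g y - b y * u - c y * u ^+ 2| <= K * `|u| ^+ 3) ->
  taylor_class (fun x => g (x ord0 i)).
Proof.
move=> mg mb mc gK bK cK rK.
have K0 : 0 <= K by rewrite (le_trans _ (gK 0)).
exists (fun x => b (x ord0 i) *: delta_mx ord0 i),
  (fun x => c (x ord0 i) *: delta_mx i i), K; split.
- by split => //; apply: (measurableT_comp mg); exact: measurable_coord.
- move=> j; split.
    under eq_fun do rewrite !mxE; apply: measurable_funM => //.
    by apply: (measurableT_comp mb); exact: measurable_coord.
  move=> x; rewrite !mxE eqxx /=; case: eqP => _; rewrite ?mulr1 ?mulr0 ?normr0//.
- move=> j k; split.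
    under eq_fun do rewrite !mxE; apply: measurable_funM => //.
    by apply: (measurableT_comp mc); exact: measurable_coord.
  by move=> x; rewrite !mxE; case: (_ && _); rewrite /= ?mulr1 ?mulr0 ?normr0.
- move=> x v.
  have -> : linf (b (x ord0 i) *: delta_mx ord0 i) v = b (x ord0 i) * v ord0 i.
    rewrite /linf (bigD1 i)//= !mxE !eqxx mulr1 big1 ?addr0// => j /negPf ji.
    by rewrite !mxE eqxx ji /= mulr0 mul0r.
  have -> : quadf (c (x ord0 i) *: delta_mx i i) v = c (x ord0 i) * v ord0 i ^+ 2.
    rewrite /quadf (bigD1 i)//= addrC big1 ?add0r => [|j /negPf ji]; last first.
      by rewrite big1// => k _; rewrite !mxE ji /= mulr0 mul0r.
    rewrite (bigD1 i)//= !mxE !eqxx mulr1 expr2 big1 ?addr0// => j /negPf ji.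
    by rewrite !mxE eqxx ji /= mulr0 mul0r.
  rewrite mxE; apply: (le_trans (rK _ _)); rewrite ler_wpM2l//.
  by apply: lerXn2r; rewrite ?nnegrE// coord_le_norm.
Qed.

End TaylorClass.

(** * Cubic B-splines *)

Section CubicSpline.
Context {R : realType}.
Implicit Types y u : R.

Let pos y : R := Num.max 0 y.

Let posP y : (0 <= y /\ pos y = y) \/ (y <= 0 /\ pos y = 0).
Proof.
by rewrite /pos; have [y0|y0] := leP 0 y; [left|right; split => //; exact: ltW].
Qed.

Let measurable_pos (a t : R) : measurable_fun setT (fun y => pos (a * y + t)).
Proof.
by apply: (measurable_maxr (f := cst 0)) => //; apply: measurable_funD => //;
  exact: measurable_funM.
Qed.

(** The cube of the positive part is twice continuously differentiable and its third derivative
    takes the values 0 and 6 only, hence the constant 1. *)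
Let pos_taylor y u :
  `|pos (y + u) ^+ 3 - pos y ^+ 3 - 3 * pos y ^+ 2 * u - 3 * pos y * u ^+ 2| <= `|u| ^+ 3.
Proof.
have [[y0 ->]|[y0 ->]] := posP y; have [[yu ->]|[yu ->]] := posP (y + u).
- rewrite (_ : _ - _ = u ^+ 3); last by ring.
  by rewrite normrX.
- have u0 : u <= 0 by lra.
  rewrite (ler0_norm u0) ler_norml; apply/andP; split.
    rewrite (_ : 0 ^+ 3 - _ - _ - _ = u ^+ 3 - (y + u) ^+ 3); last by ring.
    rewrite exprNn -signr_odd /= expr1 mulN1r opprK lerDl oppr_ge0.
    by rewrite exprn_odd_le0.
  rewrite (_ : 0 ^+ 3 - _ - _ - _ = u ^+ 3 - (y + u) ^+ 3); last by ring.
  have h1 : (- (y + u)) ^+ 3 <= (- u) ^+ 3 by apply: lerXn2r; rewrite ?nnegrE; lra.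
  have h2 : u ^+ 3 <= 0 by rewrite exprn_odd_le0.
  have e1 : (- (y + u)) ^+ 3 = - (y + u) ^+ 3 by ring.
  by move: h1; rewrite e1; lra.
- have u0 : 0 <= u by lra.
  rewrite (_ : _ - _ = (y + u) ^+ 3); last by ring.
  rewrite (ger0_norm u0) ger0_norm ?exprn_ge0//.
  by apply: lerXn2r; rewrite ?nnegrE; lra.
- rewrite (_ : _ - _ = 0); last by ring.
  by rewrite normr0 exprn_ge0.
Qed.

(** Fourth difference of a truncated power. For [k = 3] it is six times the cubic B-spline with
    knots [0, 1, 2, 3, 4]; [k = 2] and [k = 1] give the first two derivatives of the spline up to
    constants. *)
Let diff4 (k : nat) y : R := pos y ^+ k - 4 * pos (y - 1) ^+ k +
  6 * pos (y - 2) ^+ k - 4 * pos (y - 3) ^+ k + pos (y - 4) ^+ k.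

(** Beyond 4 it is the fourth difference of a polynomial of degree at most 3, which vanishes, so
    only [[0, 4]] matters. There 16 is the sum of the binomial coefficients and [64 = 4^3] bounds
    each power. *)
Let diff4_bound k y : (0 < k <= 3)%N -> `|diff4 k y| <= 16 * 64.
Proof.
move=> /andP[k0 k3].
have pos0 z : z <= 0 -> pos z ^+ k = 0.
  by move=> z0; have [[z0' ->]|[_ ->]] := posP z; rewrite ?expr0n ?(gtn_eqF k0)//
    (_ : z = 0) ?expr0n ?(gtn_eqF k0)//; lra.
have [y0|y0] := leP y 0.
  by rewrite /diff4 !pos0; [rewrite !mulr0 !subr0 !addr0 normr0; lra|lra..].
have [y4|y4] := leP 4 y.
  have posE z : 0 <= z -> pos z = z.
    by move=> z0; have [[_ ->]|[z0' ->]] := posP z => //; lra.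
  rewrite /diff4 !posE; [|lra..].
  have : k = 1%N \/ k = 2%N \/ k = 3%N by lia.
  by move=> [->|[->|->]]; rewrite [X in `|X|](_ : _ = 0) ?normr0; [lra|ring|lra|ring|lra|ring].
have B z : z <= 4 -> `|pos z ^+ k| <= 64.
  move=> z4; have [[z0 ->]|[_ ->]] := posP z; last first.
    by rewrite expr0n (gtn_eqF k0) normr0; lra.
  rewrite ger0_norm ?exprn_ge0//.
  apply: (@le_trans _ _ (4 ^+ k)); first by apply: lerXn2r; rewrite ?nnegrE.
  by apply: (@le_trans _ _ (4 ^+ 3)); [rewrite ler_weXn2l//; lra|lra].
have := B y ltac:(lra); have := B (y - 1) ltac:(lra); have := B (y - 2) ltac:(lra).
have := B (y - 3) ltac:(lra); have := B (y - 4) ltac:(lra).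
rewrite /diff4 !ler_norml.
by move=> /andP[? ?] /andP[? ?] /andP[? ?] /andP[? ?] /andP[? ?]; apply/andP; split; lra.
Qed.

Definition bspline y : R := diff4 3 y / 6.

(** A smooth step rising from 0 to 1 on [[0, 3]]. Its unit differences are the B-splines, so sums of
    translates telescope. *)
Let step y : R :=
  (pos y ^+ 3 - 3 * pos (y - 1) ^+ 3 + 3 * pos (y - 2) ^+ 3 - pos (y - 3) ^+ 3) / 6.

Let bsplineE y : bspline y = step y - step (y - 1).
Proof.
rewrite /bspline /step /diff4.
rewrite (_ : y - 1 - 1 = y - 2); last by ring.
rewrite (_ : y - 1 - 2 = y - 3); last by ring.
rewrite (_ : y - 1 - 3 = y - 4); last by ring.
by field.
Qed.

Let step0 y : y <= 0 -> step y = 0.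
Proof.
move=> y0; rewrite /step.
have pos0 z : z <= 0 -> pos z = 0.
  by move=> z0; have [[z0' ->]|[_ ->]] := posP z => //; lra.
by rewrite !pos0; [field|lra..].
Qed.

Let step1 y : 3 <= y -> step y = 1.
Proof.
move=> y0; rewrite /step.
have posE z : 0 <= z -> pos z = z.
  by move=> z0; have [[_ ->]|[z0' ->]] := posP z => //; lra.
by rewrite !posE; [field|lra..].
Qed.

Lemma bspline_ge0 y : 0 <= bspline y.
Proof.
rewrite /bspline mulr_ge0// ?invr_ge0// /diff4.
have [[y0 ->]|[y0 ->]] := posP y; have [[y1 ->]|[y1 ->]] := posP (y - 1);
have [[y2 ->]|[y2 ->]] := posP (y - 2); have [[y3 ->]|[y3 ->]] := posP (y - 3);
(* [lra] closes the inconsistent sign patterns and those where the spline vanishes; the cases left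
   are the pieces [[3, 4]], [[2, 3]], [[1, 2]] and [[0, 1]], in this order. *)
have [[y4 ->]|[y4 ->]] := posP (y - 4); try lra.
- rewrite [leRHS](_ : _ = (4 - y) ^+ 3); last by ring.
  by rewrite exprn_ge0//; lra.
- rewrite [leRHS](_ : _ = (4 - y) ^+ 3 - 4 * (3 - y) ^+ 3); last by ring.
  have : 0 <= 3 - y <= 1 by apply/andP; split; lra.
  rewrite (_ : 4 - y = 3 - y + 1); last by ring.
  move: (3 - y) => z /andP[z0 z1]; have z2 : 0 <= z ^+ 2 by rewrite sqr_ge0.
  rewrite [leRHS](_ : _ = 1 + 3 * z + 3 * z ^+ 2 * (1 - z)); last by ring.
  have : 0 <= z ^+ 2 * (1 - z) by rewrite mulr_ge0// subr_ge0.
  by lra.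
- rewrite [leRHS](_ : _ = (y - 1 + 1) ^+ 3 - 4 * (y - 1) ^+ 3); last by ring.
  have : 0 <= y - 1 <= 1 by apply/andP; split; lra.
  move: (y - 1) => z /andP[z0 z1]; have z2 : 0 <= z ^+ 2 by rewrite sqr_ge0.
  rewrite [leRHS](_ : _ = 1 + 3 * z + 3 * z ^+ 2 * (1 - z)); last by ring.
  have : 0 <= z ^+ 2 * (1 - z) by rewrite mulr_ge0// subr_ge0.
  by lra.
- rewrite [leRHS](_ : _ = y ^+ 3); last by ring.
  by rewrite exprn_ge0.
Qed.

Lemma bspline_supp y : bspline y != 0 -> 0 <= y <= 4.
Proof.
apply: contraNT => y04; rewrite bsplineE.
have : y <= 0 \/ 4 <= y.
  by move: y04; rewrite negb_and -!ltNge => /orP[/ltW|/ltW]; [left|right].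
move=> [y0|y4]; first by rewrite !step0 ?subrr//; lra.
by rewrite !step1 ?subrr//; lra.
Qed.

Let telescope M y : \sum_(k < M) bspline (y - k%:R) = step y - step (y - M%:R).
Proof.
elim: M => [|M IH]; first by rewrite big_ord0 subr0 subrr.
have -> : y - M.+1%:R = y - M%:R - 1 by rewrite -natr1; ring.
by rewrite big_ord_recr /= IH bsplineE; ring.
Qed.

(** Telescoping down to an argument where [step] vanishes writes [step y] as a sum of B-splines. *)
Let step_ge0 y : 0 <= step y.
Proof.
have := telescope (Num.truncn `|y|).+1 y; rewrite [X in _ - X]step0 ?subr0.
  by move=> <-; apply: sumr_ge0 => i _; exact: bspline_ge0.
by rewrite subr_le0 (le_trans (ler_norm _))// ltW// truncnS_gt.
Qed.

(** Telescoping up to an argument where [step] is 1 writes [1 - step y] as a sum of B-splines. *)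
Let step_le1 y : step y <= 1.
Proof.
pose M := (Num.truncn `|3 - y|).+1.
have h : 3 - y <= M%:R by rewrite (le_trans (ler_norm _))// ltW// truncnS_gt.
have := telescope M (y + M%:R); rewrite addrK [X in X - _]step1; last by lra.
move=> /(congr1 (fun z => 0 <= z)); rewrite sumr_ge0 => [|i _]; last exact: bspline_ge0.
by move=> /esym; rewrite subr_ge0.
Qed.

Lemma bspline_sum_ge0le1 M y : 0 <= \sum_(k < M) bspline (y - k%:R) <= 1.
Proof.
apply/andP; split; first by apply: sumr_ge0 => i _; exact: bspline_ge0.
by rewrite telescope lerBlDr (le_trans (step_le1 y))// lerDl.
Qed.

Lemma bspline_partition M y : 3 <= y <= M%:R ->
  \sum_(k < M) bspline (y - k%:R) = 1.
Proof.
by move=> /andP[y3 yM]; rewrite telescope step1// step0 ?subr0// subr_le0.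
Qed.

Lemma taylor_class_bspline n (l t : R) (i : 'I_n) : 0 < l ->
  taylor_class (fun x : 'rV[R]_n => bspline (l * x ord0 i + t)).
Proof.
move=> l0.
(* The first derivative and half the second derivative of the rescaled spline, from [pos y ^+ 2 / 2]
   and [pos y / 2] for [pos y ^+ 3 / 6]. *)
pose b y := l * (diff4 2 (l * y + t) / 2).
pose c y := l ^+ 2 * (diff4 1 (l * y + t) / 2).
have mdiff k : measurable_fun setT (fun y => diff4 k (l * y + t)).
  have mp z : measurable_fun setT (fun y => pos (l * y + t - z) ^+ k).
    by apply: measurable_funX; under eq_fun do rewrite -addrA; exact: measurable_pos.
  rewrite /diff4; apply: measurable_funD; last exact: mp.
  apply: measurable_funB; last exact: measurable_funM.
  apply: measurable_funD; last exact: measurable_funM.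
  apply: measurable_funB; last exact: measurable_funM.
  by apply: measurable_funX; exact: measurable_pos.
(* [512 = 16 * 64 / 2] comes from [diff4_bound]; the powers of [l] come from rescaling the
   derivatives. *)
pose K := 512 * (1 + l + l ^+ 2 + l ^+ 3).
have l2 : 0 <= l ^+ 2 by rewrite exprn_ge0// ltW.
have l3 : 0 <= l ^+ 3 by rewrite exprn_ge0// ltW.
have l3K : l ^+ 3 <= 1 + l + l ^+ 2 + l ^+ 3 by rewrite lerDr !addr_ge0// ltW.
apply: (@taylor_class_coord _ _ (fun y => bspline (l * y + t)) b c K).
- exact: measurable_funM.
- by apply: measurable_funM => //; exact: measurable_funM.
- by apply: measurable_funM => //; exact: measurable_funM.
- move=> y; rewrite /bspline normrM [`|6^-1|]ger0_norm ?invr_ge0//.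
  have := @diff4_bound 3 (l * y + t) isT; rewrite /K; lra.
- move=> y; rewrite /b !normrM [`|2^-1|]ger0_norm ?invr_ge0// (ger0_norm (ltW l0)).
  have h := @diff4_bound 2 (l * y + t) isT.
  have := ler_wpM2l (ltW l0) h; rewrite /K; lra.
- move=> y; rewrite /c normrM (ger0_norm l2) normrM [`|2^-1|]ger0_norm ?invr_ge0//.
  have h := @diff4_bound 1 (l * y + t) isT.
  have := ler_wpM2l l2 h; rewrite /K; lra.
- move=> y u; rewrite /b /c /bspline.
  rewrite (_ : l * (y + u) + t = l * y + t + l * u); last by ring.
  have T z : - (`|l * u| ^+ 3) <= pos (l * y + t + l * u - z) ^+ 3 -
      pos (l * y + t - z) ^+ 3 - 3 * pos (l * y + t - z) ^+ 2 * (l * u) -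
      3 * pos (l * y + t - z) * (l * u) ^+ 2 <= `|l * u| ^+ 3.
    rewrite -ler_norml (_ : l * y + t + l * u - z = l * y + t - z + l * u).
      exact: pos_taylor.
    by ring.
  have := T 0; rewrite !subr0 => /andP[a0 b0].
  have /andP[a1 b1] := T 1; have /andP[a2 b2] := T 2.
  have /andP[a3 b3] := T 3; have /andP[a4 b4] := T 4.
  have e3 : `|l * u| ^+ 3 = l ^+ 3 * `|u| ^+ 3.
    by rewrite normrM exprMn (ger0_norm (ltW l0)).
  have u3 : 0 <= `|u| ^+ 3 by rewrite exprn_ge0.
  apply: (@le_trans _ _ (512 * (l ^+ 3 * `|u| ^+ 3))); last first.
    rewrite mulrA; apply: ler_wpM2r; first exact: exprn_ge0.
    by apply: ler_wpM2l; [exact: ler0n|exact: l3K].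
  have u33 : 0 <= l ^+ 3 * `|u| ^+ 3 by rewrite mulr_ge0.
  move: a0 b0 a1 b1 a2 b2 a3 b3 a4 b4; rewrite /diff4 e3 !expr1.
  move=> *; rewrite ler_norml; apply/andP; split; lra.
Qed.

End CubicSpline.

Section UniformContinuity.
Context {R : realType} {n : nat}.

(** Only [x] is confined to the cube; [y] may leave it, as grid points and perturbed variables near
    the boundary do. *)
Lemma continuous_unif_cube (h : 'rV[R]_n -> R) (L e : R) : continuous h -> 0 < e ->
  exists2 dlt : R, 0 < dlt & forall x, `|x| <= L ->
    forall y, `|x - y| <= dlt -> `|h x - h y| <= e.
Proof.
move=> ch e0.
pose A := [set v : 'rV[R]_n | forall i, `[- L, L]%classic (v ord0 i)].
have : compact A.
  by apply: (@rV_compact R n (fun=> `[- L, L]%classic)) => i; exact: segment_compact.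
(* The filter is the one of small positive [dlt]: each point of the cube brings a [dlt] that is good
   nearby, and compactness makes it uniform. *)
move/compact_near_coveringP => /(_ R (0^'+)
  (fun (dlt : R) x => forall y, `|x - y| <= dlt -> `|h x - h y| <= e) _) [].
  move=> x Ax.
  have e2 : 0 < e / 2 by rewrite divr_gt0.
  have /cvgrPdist_lt/(_ _ e2)/nbhs_normP[r /= r0 hr] := ch x.
  have r2 : 0 < r / 2 by rewrite divr_gt0.
  exists (ball x (r / 2), [set dlt | dlt < r / 2]) => /=.
    by split; [exact: nbhsx_ballx|exact: (nbhs_right_lt r2)].
  move=> [x' dlt] /= [xx' dr] y yx'.
  have xx : `|x - x'| < r / 2 by move: xx'; rewrite -ball_normE.
  have h1 : `|h x - h x'| < e / 2 by apply: hr => /=; lra.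
  have h2 : `|h x - h y| < e / 2.
    apply: hr => /=; rewrite -(subrKA x').
    by rewrite (le_lt_trans (ler_normD _ _))//; lra.
  rewrite -(subrKA (h x)) (le_trans (ler_normD _ _))// distrC; lra.
move=> r /= r0 hr; exists (r / 2); first by rewrite divr_gt0.
move=> x xL y xy; apply: (hr (r / 2)) xy => //=.
- by rewrite sub0r normrN gtr0_norm ?divr_gt0//; lra.
- by rewrite divr_gt0.
- by move=> i; rewrite /= in_itv /= -ler_norml (le_trans (coord_le_norm _ _)).
Qed.

End UniformContinuity.

Section SmoothApproximation.
Context {R : realType} {n : nat}.

(* Interpolate h on a grid of mesh 1 / l by tensor products of B-splines, which
   form a partition of unity on the cube. *)
Lemma taylor_class_approx (h : 'rV[R]_n -> R) (M L e : R) : continuous h ->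
  (forall x, `|h x| <= M) -> 0 < e ->
  exists H, [/\ taylor_class H, forall x, `|H x| <= M &
    forall x, `|x| <= L -> `|h x - H x| <= e].
Proof.
move=> ch hM e0.
have [dlt dlt0 hdlt] := continuous_unif_cube L ch e0.
(* The splines have support of length 4, so at mesh [1 / l] a grid point with nonzero weight lies
   within [dlt] of [x]. *)
pose l := 4 / dlt; have l0 : 0 < l by rewrite divr_gt0.
(* For [x] in the cube, the coordinates of [l x] shifted by [N] land in [[3, 2 N]], where the
   [K = 2 N] translates sum to 1. *)
pose N := (Num.truncn (l * `|L| + 3)).+1.
have lN : l * `|L| + 3 <= N%:R by rewrite ltW// truncnS_gt.
pose K := (N + N)%N.
pose pt (j : {ffun 'I_n -> 'I_K}) : 'rV[R]_n := \row_i (((j i)%:R - N%:R) / l).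
pose w (j : {ffun 'I_n -> 'I_K}) (x : 'rV[R]_n) :=
  \prod_(i < n) bspline (l * x ord0 i + (N%:R - (j i)%:R)).
have w0 j x : 0 <= w j x by apply: prodr_ge0 => i _; exact: bspline_ge0.
have wE x : \sum_j w j x = \prod_(i < n) \sum_(k < K) bspline (l * x ord0 i + N%:R - k%:R).
  rewrite bigA_distr_bigA /=; apply: eq_bigr => j _; apply: eq_bigr => i _.
  by rewrite addrA.
have w1 x : \sum_j w j x <= 1.
  rewrite wE; apply: prodr_ile1 => i _; exact: bspline_sum_ge0le1.
have wL x : `|x| <= L -> \sum_j w j x = 1.
  move=> xL; rewrite wE big1// => i _; apply: bspline_partition.
  have xi : `|x ord0 i| <= `|L|.
    by rewrite (le_trans (coord_le_norm _ _))// (le_trans xL) ?ler_norm.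
  have : `|l * x ord0 i| <= l * `|L| by rewrite normrM (gtr0_norm l0) ler_wpM2l// ltW.
  by rewrite ler_norml => /andP[? ?]; rewrite natrD; apply/andP; split; lra.
have M0 : 0 <= M by rewrite (le_trans _ (hM 0)).
exists (fun x => \sum_j h (pt j) * w j x); split.
- apply: taylor_class_sum => j; apply: taylor_classM; first exact: taylor_class_cst.
  by apply: taylor_class_prod => i; exact: taylor_class_bspline.
- move=> x; rewrite (le_trans (ler_norm_sum _ _ _))//.
  apply: (@le_trans _ _ (\sum_j M * w j x)); last first.
    by rewrite -mulr_sumr ler_piMr.
  by apply: ler_sum => j _; rewrite normrM ler_pM// ger0_norm.
- move=> x xL; rewrite -[h x]mulr1 -(wL x xL) mulr_sumr -sumrB.
  rewrite (le_trans (ler_norm_sum _ _ _))//.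
  apply: (@le_trans _ _ (\sum_j e * w j x)); last by rewrite -mulr_sumr wL// mulr1.
  apply: ler_sum => j _; rewrite -mulrBl normrM (ger0_norm (w0 j x)).
  have [wj0|wj] := eqVneq (w j x) 0; first by rewrite wj0 !mulr0.
  rewrite ler_wpM2r//; apply: hdlt => //; apply: norm_rV_le => [|i]; first exact: ltW.
  have : bspline (l * x ord0 i + (N%:R - (j i)%:R)) != 0.
    by apply: contraNneq wj => b0; rewrite /w (bigD1 i)//= b0 mul0r.
  move=> /bspline_supp /andP[b0 b4]; rewrite !mxE.
  rewrite (_ : x ord0 i - _ = (l * x ord0 i + (N%:R - (j i)%:R)) / l); last first.
    by field; rewrite gt_eqF.
  rewrite normrM normfV (gtr0_norm l0) (ger0_norm b0) ler_pdivrMr// (le_trans b4)//.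
  by rewrite /l mulrC divfK// gt_eqF.
Qed.

End SmoothApproximation.

(** * The central limit theorem *)

Section BoundedIntegral.
Context {d} {T : measurableType d} {R : realType} (P : probability T R).
Implicit Types (f g : T -> R) (A : R).

Lemma integrable_bounded f A : measurable_fun setT f -> (forall x, `|f x| <= A) ->
  P.-integrable setT (EFin \o f).
Proof.
move=> mf fA; apply: (@le_integrable _ _ _ _ _ measurableT _ (cst A%:E)).
- exact/measurable_EFinP.
- by move=> x _; rewrite /= lee_fin (le_trans (fA x))// ler_norm.
- exact: finite_measure_integrable_cst.
Qed.

Lemma EFin_Rintegral f : P.-integrable setT (EFin \o f) ->
  (\int[P]_x (f x)%:E = (\int[P]_x f x)%R%:E)%E.
Proof. by move=> fi; rewrite /Rintegral fineK//; exact: integrable_fin_num. Qed.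

(** Adding the bound makes the integrand nonnegative; this is how Tonelli-type identities for
    nonnegative functions are transferred to bounded ones. *)
Lemma Rintegral_shift f A : measurable_fun setT f -> (forall x, `|f x| <= A) ->
  (\int[P]_x (f x + A)%:E = (\int[P]_x f x + A)%R%:E)%E.
Proof.
move=> mf fA; have fi := integrable_bounded mf fA.
rewrite EFinD -EFin_Rintegral// -[X in (_ + X)%E](integral_probability_cst P).
rewrite -integralD//; last exact: finite_measure_integrable_cst.
Qed.

Lemma Rintegral_sum (I : Type) (s : seq I) (f : I -> T -> R) :
  (forall i, P.-integrable setT (EFin \o f i)) ->
  P.-integrable setT (EFin \o (fun x => \sum_(i <- s) f i x)) /\
  \int[P]_x (\sum_(i <- s) f i x) = \sum_(i <- s) \int[P]_x f i x.
Proof.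
move=> fi; elim: s => [|i s [IH1 IH2]].
  split; last by under eq_Rintegral do rewrite big_nil;
    rewrite Rintegral_probability_cst big_nil.
  rewrite (_ : _ \o _ = cst 0%E); first exact: integrable0.
  by apply/funext => x /=; rewrite big_nil.
have E : (fun x => \sum_(j <- i :: s) f j x) = (fun x => f i x + \sum_(j <- s) f j x).
  by apply/funext => x; rewrite big_cons.
rewrite E big_cons RintegralD// IH2; split => //.
exact: (integrableD measurableT (fi i) IH1).
Qed.

Lemma normr_Rintegral_le f g : P.-integrable setT (EFin \o f) ->
  P.-integrable setT (EFin \o g) -> (forall x, `|f x| <= g x) ->
  `|\int[P]_x f x| <= \int[P]_x g x.
Proof.
move=> fi gi fg; apply: (le_trans (le_normr_Rintegral _ _)) => //.
apply: le_Rintegral => //; exact: integrable_norm.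
Qed.

Lemma normr_Rintegral_bound f A : measurable_fun setT f -> (forall x, `|f x| <= A) ->
  `|\int[P]_x f x| <= A.
Proof.
move=> mf fA; rewrite -[A](Rintegral_probability_cst P); apply: normr_Rintegral_le => //.
  exact: (integrable_bounded mf fA).
exact: finite_measure_integrable_cst.
Qed.

End BoundedIntegral.

Section TaylorBounded.
Context {R : realType} {n : nat}.
Implicit Types (A : R) (K H : 'rV[R]_n -> R).

(** The expansion is used at one fixed point at a time, so its coefficients are quantified
    pointwise, whereas in [taylor_class] they are measurable fields, to be integrated. *)
Definition taylor_bounded A K := [/\ measurable_fun setT K, forall x, `|K x| <= A &
  forall x, exists (b : 'rV[R]_n) (c : 'M[R]_n),
    [/\ forall i, `|b ord0 i| <= A, forall i j, `|c i j| <= A &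
        forall v, `|K (x + v) - K x - linf b v - quadf c v| <= A * `|v| ^+ 3]].

Lemma measurable_shift (x : 'rV[R]_n) (a : R) :
  measurable_fun [set: 'rV[R]_n] (fun y => x + a *: y).
Proof. by apply: measurable_rVD => //; apply: measurable_rVZ. Qed.

Lemma measurable_smoothing (nu : probability 'rV[R]_n R) H A (a : R) :
  measurable_fun setT H -> (forall x, `|H x| <= A) ->
  measurable_fun setT (fun x : 'rV[R]_n => \int[nu]_y H (x + a *: y)).
Proof.
move=> mH HA.
have mHx x : measurable_fun setT (fun y : 'rV[R]_n => H (x + a *: y)).
  exact: (measurableT_comp mH (measurable_shift x a)).
pose F (x : 'rV[R]_n) := (\int[nu]_y (H (x + a *: y) + A)%:E)%E.
have mF : measurable_fun setT F.
  apply: (measurable_fun_fubini_tonelli_F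
    (fun z : 'rV[R]_n * 'rV[R]_n => (H (z.1 + a *: z.2) + A)%:E)).
    apply/measurable_EFinP; apply: measurable_funD => //; apply: (measurableT_comp mH).
    by apply: measurable_rVD => //; apply: measurable_rVZ.
  move=> z; rewrite lee_fin -lerBlDr sub0r.
  by have := HA (z.1 + a *: z.2); rewrite ler_norml => /andP[].
have FE x : F x = (\int[nu]_y H (x + a *: y) + A)%:E by exact: Rintegral_shift.
have mG : measurable_fun setT (fun x : 'rV[R]_n => \int[nu]_y H (x + a *: y) + A).
  by apply/measurable_EFinP; apply: eq_measurable_fun mF => x _; rewrite FE.
rewrite (_ : (fun x => _) = (fun x => \int[nu]_y H (x + a *: y) + A - A)).
  exact: measurable_funB.
by apply/funext => x; rewrite addrK.
Qed.

(** Integrating the expansion of [H] expands its smoothing. The constant depends neither on [nu] nor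
    on [a], so that one constant serves every replacement step. *)
Lemma taylor_bounded_smoothing H : taylor_class H -> exists A, 0 <= A /\
  forall (nu : probability 'rV[R]_n R) (a : R),
    taylor_bounded A (fun x => \int[nu]_y H (x + a *: y)).
Proof.
move=> [b [c [A [[mH HA] bA cA rA]]]]; exists A; split.
  by rewrite (le_trans _ (HA 0)).
move=> nu a; split.
- exact: (measurable_smoothing nu a mH HA).
- move=> x; apply: normr_Rintegral_bound => //.
  exact: (measurableT_comp mH (measurable_shift x a)).
move=> x.
have mcomp (f : 'rV[R]_n -> R) z : measurable_fun setT f ->
    measurable_fun setT (fun y : 'rV[R]_n => f (z + a *: y)).
  by move=> mf; exact: (measurableT_comp mf (measurable_shift z a)).
have ib i : nu.-integrable setT (EFin \o (fun y : 'rV[R]_n => b (x + a *: y) ord0 i)).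
  by apply: (@integrable_bounded _ _ _ nu _ A); [apply: (mcomp (fun y => b y ord0 i));
    exact: (bA i).1|move=> y; exact: (bA i).2].
have ic i j : nu.-integrable setT (EFin \o (fun y : 'rV[R]_n => c (x + a *: y) i j)).
  by apply: (@integrable_bounded _ _ _ nu _ A); [apply: (mcomp (fun y => c y i j));
    exact: (cA i j).1|move=> y; exact: (cA i j).2].
have iH z : nu.-integrable setT (EFin \o (fun y : 'rV[R]_n => H (z + a *: y))).
  by apply: (@integrable_bounded _ _ _ nu _ A) => //; exact: mcomp.
exists (\row_i \int[nu]_y b (x + a *: y) ord0 i),
  (\matrix_(i, j) \int[nu]_y c (x + a *: y) i j); split.
- move=> i; rewrite mxE; apply: normr_Rintegral_bound.
    by apply: (mcomp (fun y => b y ord0 i)); exact: (bA i).1.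
  by move=> y; exact: (bA i).2.
- move=> i j; rewrite mxE; apply: normr_Rintegral_bound.
    by apply: (mcomp (fun y => c y i j)); exact: (cA i j).1.
  by move=> y; exact: (cA i j).2.
- move=> v.
  have [il lE] := Rintegral_sum (index_enum 'I_n) (fun i =>
    (integrableZr measurableT (v ord0 i) (ib i) :
     nu.-integrable setT (EFin \o (fun y : 'rV[R]_n => b (x + a *: y) ord0 i * v ord0 i)))).
  have iq1 i := Rintegral_sum (index_enum 'I_n) (fun j =>
    (integrableZr measurableT (v ord0 i * v ord0 j) (ic i j) :
     nu.-integrable setT (EFin \o (fun y : 'rV[R]_n => c (x + a *: y) i j * (v ord0 i * v ord0 j))))).
  have [iq qE] := Rintegral_sum (index_enum 'I_n) (fun i => (iq1 i).1).
  have -> : linf (\row_i \int[nu]_y b (x + a *: y) ord0 i) v =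
      \int[nu]_y linf (b (x + a *: y)) v.
    rewrite /linf lE; apply: eq_bigr => i _.
    by rewrite mxE RintegralZr//; exact: ib.
  have -> : quadf (\matrix_(i, j) \int[nu]_y c (x + a *: y) i j) v =
      \int[nu]_y quadf (c (x + a *: y)) v.
    rewrite /quadf qE; apply: eq_bigr => i _; rewrite (iq1 i).2.
    by apply: eq_bigr => j _; rewrite mxE RintegralZr//; exact: ic.
  have iD : nu.-integrable setT (EFin \o (fun y : 'rV[R]_n => H (x + v + a *: y) - H (x + a *: y))).
    exact: (integrableB measurableT (iH (x + v)) (iH x)).
  have iDl : nu.-integrable setT (EFin \o (fun y : 'rV[R]_n => H (x + v + a *: y) - H (x + a *: y)
      - linf (b (x + a *: y)) v)).
    exact: (integrableB measurableT iD il).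
  rewrite -(RintegralB measurableT (iH (x + v)) (iH x)).
  rewrite -(RintegralB measurableT iD il).
  rewrite -(RintegralB measurableT iDl iq).
  rewrite -[leRHS](Rintegral_probability_cst nu); apply: normr_Rintegral_le.
  + exact: (integrableB measurableT iDl iq).
  + exact: finite_measure_integrable_cst.
  + by move=> y; have := rA (x + a *: y) v; rewrite [x + _ + v]addrAC.
Qed.

End TaylorBounded.

(** * Replacement of one summand *)

Section OneStep.
Context {R : realType} {n : nat} {d : measure_display} {S : measurableType d}.
Variables (P : probability S R) (Z : S -> 'rV[R]_n) (C : 'M[R]_n).
Hypothesis mZ : measurable_fun setT Z.
Hypothesis iZ : forall i, P.-integrable setT (fun w => (Z w ord0 i)%:E).
Hypothesis Z0 : forall i, \int[P]_w (Z w ord0 i) = 0.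
Hypothesis iZZ : forall i j, P.-integrable setT (fun w => (Z w ord0 i * Z w ord0 j)%:E).
Hypothesis ZC : forall i j, \int[P]_w (Z w ord0 i * Z w ord0 j) = C i j.

(** Up to the factor [s^2], the minimum of the square and the cube of [s t]: with [t] the norm of
    [Z], it is integrable under second moments alone and its mean tends to 0 with [s]. *)
Definition cubic_min (t s : R) : R := Num.min (t ^+ 2) (s * t ^+ 3).

Lemma measurable_norm_fun : measurable_fun setT (fun w => `|Z w|).
Proof. exact: (measurableT_comp (@measurable_normr R n) mZ). Qed.

Lemma measurable_cubic_min s : measurable_fun setT (fun w => cubic_min `|Z w| s).
Proof.
apply: (measurable_minr (f := fun w => `|Z w| ^+ 2)).
  by apply: measurable_funX; exact: measurable_norm_fun.
by apply: measurable_funM => //; apply: measurable_funX; exact: measurable_norm_fun.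
Qed.

Lemma normr_sqr_le (v : 'rV[R]_n) : `|v| ^+ 2 <= \sum_i (v ord0 i * v ord0 i).
Proof.
have S0 : 0 <= \sum_i (v ord0 i * v ord0 i).
  by apply: sumr_ge0 => i _; rewrite -expr2 sqr_ge0.
rewrite -[leRHS]sqr_sqrtr// lerXn2r ?nnegrE ?sqrtr_ge0//.
apply: norm_rV_le => [|i]; first exact: sqrtr_ge0.
rewrite -sqrtr_sqr ler_wsqrtr// (bigD1 i)//= expr2 lerDl.
by apply: sumr_ge0 => j _; rewrite -expr2 sqr_ge0.
Qed.

Lemma integrable_norm_sqr : P.-integrable setT (fun w => (`|Z w| ^+ 2)%:E).
Proof.
have [iS _] := Rintegral_sum (index_enum 'I_n) (fun i => iZZ i i).
apply: (le_integrable measurableT _ _ iS).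
  by apply/measurable_EFinP; apply: measurable_funX; exact: measurable_norm_fun.
move=> w _ /=; rewrite lee_fin ger0_norm ?sqr_ge0// (le_trans (normr_sqr_le _))//.
exact: ler_norm.
Qed.

Lemma cubic_min_ge0 t s : 0 <= t -> 0 <= s -> 0 <= cubic_min t s.
Proof. by move=> t0 s0; rewrite le_min sqr_ge0 mulr_ge0// exprn_ge0. Qed.

Lemma integrable_cubic_min s : 0 <= s ->
  P.-integrable setT (fun w => (cubic_min `|Z w| s)%:E).
Proof.
move=> s0; apply: (le_integrable measurableT _ _ integrable_norm_sqr).
  by apply/measurable_EFinP; exact: measurable_cubic_min.
move=> w _ /=; rewrite lee_fin ger0_norm ?cubic_min_ge0// ger0_norm ?sqr_ge0//.
by rewrite ge_min lexx.
Qed.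

(** For increments larger than 1, the bounds on [K] and on the coefficients give a quadratic bound,
    which then beats the cubic one. The factor [3 + n + n^2] covers the values, the linear part and
    the quadratic part. *)
Let remainder_min (A : R) (K : 'rV[R]_n -> R) (x b : 'rV[R]_n) (c : 'M[R]_n) v : 0 <= A ->
  (forall x, `|K x| <= A) ->
  (forall i, `|b ord0 i| <= A) -> (forall i j, `|c i j| <= A) ->
  `|K (x + v) - K x - linf b v - quadf c v| <= A * `|v| ^+ 3 ->
  `|K (x + v) - K x - linf b v - quadf c v| <=
    (3 + n%:R + n%:R * n%:R) * A * Num.min (`|v| ^+ 2) (`|v| ^+ 3).
Proof.
move=> A0 KA bA cA rA.
have n0 : 0 <= n%:R :> R by [].
have nn0 := mulr_ge0 n0 n0.
have nA := mulr_ge0 n0 A0; have nnA := mulr_ge0 nn0 A0.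
have B0 : 0 <= (3 + n%:R + n%:R * n%:R) * A by rewrite mulr_ge0// !addr_ge0.
have v0 := normr_ge0 v.
have v2 : 0 <= `|v| ^+ 2 by rewrite exprn_ge0.
have v3 : 0 <= `|v| ^+ 3 by rewrite exprn_ge0.
have [v1|v1] := leP `|v| 1.
  rewrite min_r; last by rewrite ler_wiXn2l.
  rewrite (le_trans rA)// ler_wpM2r//; lra.
rewrite min_l; last by rewrite ler_weXn2l// ltW.
have le1 : 1 <= `|v| ^+ 2 by rewrite exprn_ege1// ltW.
have le2 : `|v| <= `|v| ^+ 2 by rewrite -[leLHS]expr1 ler_weXn2l// ltW.
have h1 := linf_le v bA; have h2 := quadf_le v cA.
have h3 := KA (x + v); have h4 := KA x.
have h5 : A <= A * `|v| ^+ 2 by rewrite ler_peMr.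
have h6 : n%:R * A * `|v| <= n%:R * A * `|v| ^+ 2 by rewrite ler_wpM2l.
move: h1 h2 h3 h4; rewrite !ler_norml.
move=> /andP[? ?] /andP[? ?] /andP[? ?] /andP[? ?]; apply/andP; split; lra.
Qed.

(** The linear term integrates to 0 and the quadratic one to a quantity that depends on [Z] only
    through its covariance [C]. *)
Lemma taylor_step (A : R) (K : 'rV[R]_n -> R) (x b : 'rV[R]_n) (c : 'M[R]_n) (s : R) :
  0 <= A -> 0 <= s -> measurable_fun setT K -> (forall x, `|K x| <= A) ->
  (forall i, `|b ord0 i| <= A) -> (forall i j, `|c i j| <= A) ->
  (forall v, `|K (x + v) - K x - linf b v - quadf c v| <= A * `|v| ^+ 3) ->
  `|\int[P]_w K (x + s *: Z w) - (K x + s ^+ 2 * \sum_i \sum_j c i j * C i j)| <=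
   (3 + n%:R + n%:R * n%:R) * A * s ^+ 2 * \int[P]_w (cubic_min `|Z w| s).
Proof.
move=> A0 s0 mK KA bA cA rA.
have [il lE] := Rintegral_sum (index_enum 'I_n) (fun i =>
  (integrableZl measurableT (s * b ord0 i) (iZ i) :
   P.-integrable setT (EFin \o (fun w => (s * b ord0 i) * Z w ord0 i)))).
have iq1 i := Rintegral_sum (index_enum 'I_n) (fun j =>
  (integrableZl measurableT (s ^+ 2 * c i j) (iZZ i j) :
   P.-integrable setT (EFin \o (fun w => (s ^+ 2 * c i j) * (Z w ord0 i * Z w ord0 j))))).
have [iq qE] := Rintegral_sum (index_enum 'I_n) (fun i => (iq1 i).1).
have lsE w : linf b (s *: Z w) = \sum_i (s * b ord0 i) * Z w ord0 i.
  by apply: eq_bigr => i _; rewrite mxE; ring.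
have qsE w : quadf c (s *: Z w) =
    \sum_i \sum_j (s ^+ 2 * c i j) * (Z w ord0 i * Z w ord0 j).
  by apply: eq_bigr => i _; apply: eq_bigr => j _; rewrite !mxE; ring.
have l0 : \int[P]_w linf b (s *: Z w) = 0.
  under eq_Rintegral do rewrite lsE.
  rewrite lE big1// => i _; rewrite RintegralZl ?Z0 ?mulr0//; exact: iZ.
have q0 : \int[P]_w quadf c (s *: Z w) = s ^+ 2 * \sum_i \sum_j c i j * C i j.
  under eq_Rintegral do rewrite qsE.
  rewrite qE mulr_sumr; apply: eq_bigr => i _; rewrite (iq1 i).2 mulr_sumr.
  apply: eq_bigr => j _; rewrite RintegralZl ?ZC ?mulrA//; exact: iZZ.
have il' : P.-integrable setT (EFin \o (fun w => linf b (s *: Z w))).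
  by rewrite (_ : (fun w => _) = (fun w => \sum_i (s * b ord0 i) * Z w ord0 i))//;
    apply/funext => w.
have iq' : P.-integrable setT (EFin \o (fun w => quadf c (s *: Z w))).
  by rewrite (_ : (fun w => _) =
    (fun w => \sum_i \sum_j (s ^+ 2 * c i j) * (Z w ord0 i * Z w ord0 j)))//;
    apply/funext => w.
have mKs : measurable_fun setT (fun w => K (x + s *: Z w)).
  apply: (measurableT_comp mK); apply: measurable_rVD => //.
  by apply: measurable_rVZ.
have iK := integrable_bounded P mKs (fun w => KA _).
have iKx : P.-integrable setT (EFin \o cst (K x)) by exact: finite_measure_integrable_cst.
(* The vanishing linear integral is inserted as well, so that the whole Taylor remainder sits under
   one integral. *)
rewrite opprD addrA -q0 -[K x](Rintegral_probability_cst P).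
rewrite -[X in X - \int[P]_w quadf _ _]subr0 -[X in _ - X - \int[P]_w quadf _ _]l0.
rewrite -(RintegralB measurableT iK iKx).
rewrite -(RintegralB measurableT (integrableB measurableT iK iKx) il').
rewrite -(RintegralB measurableT
  (integrableB measurableT (integrableB measurableT iK iKx) il') iq').
rewrite -RintegralZl//; last exact: integrable_cubic_min.
apply: normr_Rintegral_le.
- exact: (integrableB measurableT
   (integrableB measurableT (integrableB measurableT iK iKx) il') iq').
- exact: (integrableZl measurableT _ (integrable_cubic_min s0)).
move=> w; apply: (le_trans (remainder_min A0 KA bA cA (rA _))).
rewrite -[leRHS]mulrA ler_wpM2l ?mulr_ge0 ?addr_ge0//.
have e1 : `|s *: Z w| = s * `|Z w| by rewrite normrZ ger0_norm.
have e2 : `|s *: Z w| ^+ 2 = s ^+ 2 * `|Z w| ^+ 2 by rewrite e1 exprMn.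
have e3 : `|s *: Z w| ^+ 3 = s ^+ 2 * (s * `|Z w| ^+ 3) by rewrite e1; ring.
by rewrite e2 e3 /cubic_min minr_pMr ?exprn_ge0.
Qed.

End OneStep.

Section CubicMinLimit.
Context {R : realType} {n : nat} {d : measure_display} {S : measurableType d}.
Variables (P : probability S R) (Z : S -> 'rV[R]_n).
Hypothesis mZ : measurable_fun setT Z.
Hypothesis iZZ : forall i j, P.-integrable setT (fun w => (Z w ord0 i * Z w ord0 j)%:E).

(** Dominated convergence: the squared norm dominates, and the cubic branch tends to 0 pointwise. *)
Lemma cubic_min_cvg (s : nat -> R) : (forall k, 0 <= s k) -> s @ \oo --> (0 : R) ->
  (fun k => \int[P]_w (cubic_min `|Z w| (s k))) @ \oo --> (0 : R).
Proof.
move=> s0 scvg.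
have mf_ k : measurable_fun setT (fun w => (cubic_min `|Z w| (s k))%:E).
  by apply/measurable_EFinP; exact: measurable_cubic_min.
have f_f : {ae P, forall w, setT w -> (cubic_min `|Z w| (s k))%:E @[k --> \oo] --> 0%E}.
  apply: aeW => w _; apply/fine_cvgP; split; first exact: nearW.
  apply: (@squeeze_cvgr _ _ _ _ (fun=> 0) (fun k => s k * `|Z w| ^+ 3)).
  + by apply: nearW => k; rewrite /= cubic_min_ge0//= ge_min lexx orbT.
  + exact: cvg_cst.
  + by rewrite -[X in _ --> X](mul0r (`|Z w| ^+ 3)); apply: cvgM => //; exact: cvg_cst.
have f_g : {ae P, forall w k, setT w ->
    (`|(cubic_min `|Z w| (s k))%:E| <= (`|Z w| ^+ 2)%:E)%E}.
  apply: aeW => w k _; rewrite /= lee_fin ger0_norm ?cubic_min_ge0//.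
  by rewrite ge_min lexx.
have [_ _] := dominated_convergence measurableT mf_ (measurable_cst 0%E) f_f
  (integrable_norm_sqr mZ iZZ) f_g.
by rewrite integral0 => /fine_cvgP[].
Qed.

End CubicMinLimit.

Section Lindeberg.
Context {R : realType} {n : nat} {dO d : measure_display}
  {Omega : measurableType dO} {T : measurableType d}.
Variables (Pr : probability Omega R) (Q : probability T R).
Variables (X : nat -> {RV Pr >-> T}) (iidX : iid_from X Q).
Variables (V : T -> 'rV[R]_n) (C : 'M[R]_n) (nu : probability 'rV[R]_n R).
Hypothesis mV : measurable_fun setT V.
Hypothesis iV : forall i, Q.-integrable setT (fun x => (V x ord0 i)%:E).
Hypothesis V0 : forall i, \int[Q]_x (V x ord0 i) = 0.
Hypothesis iVV : forall i j, Q.-integrable setT (fun x => (V x ord0 i * V x ord0 j)%:E).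
Hypothesis VC : forall i j, \int[Q]_x (V x ord0 i * V x ord0 j) = C i j.
Hypothesis inu : forall i, nu.-integrable setT (fun y => (y ord0 i)%:E).
Hypothesis nu0 : forall i, \int[nu]_y (y ord0 i) = 0.
Hypothesis inunu : forall i j, nu.-integrable setT (fun y => (y ord0 i * y ord0 j)%:E).
Hypothesis nuC : forall i j, \int[nu]_y (y ord0 i * y ord0 j) = C i j.
Hypothesis nu_stable : forall (a b c : R) (f : 'rV[R]_n -> \bar R),
  c ^+ 2 = a ^+ 2 + b ^+ 2 -> measurable_fun setT f -> (forall x, 0 <= f x)%E ->
  (\int[nu]_x \int[nu]_y f (a *: x + b *: y)%R = \int[nu]_x f (c *: x)%R)%E.

Let smooth (H : 'rV[R]_n -> R) (a : R) (x : 'rV[R]_n) := \int[nu]_y H (x + a *: y).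

(** By stability, one more Gaussian step only enlarges the scale of the smoothing. *)
Let smooth_comp (H : 'rV[R]_n -> R) (A a s c : R) x : measurable_fun setT H -> (forall x, `|H x| <= A) ->
  c ^+ 2 = s ^+ 2 + a ^+ 2 ->
  \int[nu]_y smooth H a (x + s *: y) = smooth H c x.
Proof.
move=> mH HA cas.
have mHx z t : measurable_fun setT (fun y : 'rV[R]_n => H (z + t *: y)).
  exact: (measurableT_comp mH (measurable_shift z t)).
pose f (z : 'rV[R]_n) := (H (x + z) + A)%:E.
have mf : measurable_fun setT f.
  apply/measurable_EFinP; apply: measurable_funD => //; apply: (measurableT_comp mH).
  exact: measurable_rVD.
have f0 z : (0 <= f z)%E.
  rewrite lee_fin -lerBlDr sub0r.
  by have := HA (x + z); rewrite ler_norml => /andP[].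
have msm := measurable_smoothing nu a mH HA.
have smA z : `|smooth H a z| <= A by exact: normr_Rintegral_bound.
have := nu_stable cas mf f0.
rewrite [RHS](Rintegral_shift nu (mHx x c)) => [|y]; last exact: HA.
rewrite (eq_integral (fun y : 'rV[R]_n => (smooth H a (x + s *: y) + A)%:E)) => [|y _]; last first.
  rewrite -(Rintegral_shift nu (mHx (x + s *: y) a)) => [|z]; last exact: HA.
  by apply: eq_integral => z _; rewrite /f addrA.
rewrite (Rintegral_shift nu) => [[] /addIr//| |y]; last exact: smA.
exact: (measurableT_comp msm (measurable_shift x s)).
Qed.

Let S k w := \sum_(i < k) V (X i w).

Let mS k : measurable_fun setT (S k).
Proof.
apply: measurable_rV_sum => // i; apply: (measurableT_comp mV); exact: measurable_funP.
Qed.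

Let measurable_expect (K : 'rV[R]_n -> R) (A s : R) : measurable_fun setT K ->
  (forall x, `|K x| <= A) ->
  measurable_fun setT (fun x : 'rV[R]_n => \int[Q]_z K (x + s *: V z)).
Proof.
move=> mK KA.
pose f (z : 'rV[R]_n * T) := (K (z.1 + s *: V z.2) + A)%:E.
have mf : measurable_fun setT f.
  apply/measurable_EFinP; apply: measurable_funD => //; apply: (measurableT_comp mK).
  apply: measurable_rVD => //; apply: measurable_rVZ => //.
  exact: (measurableT_comp mV measurable_snd).
have f0 z : (0 <= f z)%E.
  rewrite lee_fin -lerBlDr sub0r.
  by have := KA (z.1 + s *: V z.2); rewrite ler_norml => /andP[].
have mKV (x : 'rV[R]_n) : measurable_fun setT (fun z => K (x + s *: V z)).
  apply: (measurableT_comp mK); apply: measurable_rVD => //.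
  by apply: measurable_rVZ.
have FE x : (\int[Q]_z f (x, z) = (\int[Q]_z K (x + s *: V z) + A)%:E)%E.
  by rewrite -(Rintegral_shift Q (mKV x)).
have mFA : measurable_fun setT (fun x : 'rV[R]_n => \int[Q]_z K (x + s *: V z) + A).
  apply/measurable_EFinP.
  apply: eq_measurable_fun (measurable_fun_fubini_tonelli_F f mf f0) => x _.
  exact: FE.
rewrite (_ : (fun x => _) = (fun x => \int[Q]_z K (x + s *: V z) + A - A)).
  exact: measurable_funB.
by apply/funext => w; rewrite addrK.
Qed.

Let expect_step (K : 'rV[R]_n -> R) (A s : R) k : measurable_fun setT K -> (forall x, `|K x| <= A) ->
  \int[Pr]_w K (s *: S k.+1 w) = \int[Pr]_w \int[Q]_z K (s *: S k w + s *: V z).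
Proof.
move=> mK KA.
have mKV (x : 'rV[R]_n) : measurable_fun setT (fun z => K (x + s *: V z)).
  apply: (measurableT_comp mK); apply: measurable_rVD => //.
  by apply: measurable_rVZ.
pose f (z : 'rV[R]_n * T) := (K (s *: z.1 + s *: V z.2) + A)%:E.
have mf : measurable_fun setT f.
  apply/measurable_EFinP; apply: measurable_funD => //; apply: (measurableT_comp mK).
  apply: measurable_rVD => //; apply: measurable_rVZ => //.
  exact: (measurableT_comp mV measurable_snd).
have f0 z : (0 <= f z)%E.
  rewrite lee_fin -lerBlDr sub0r.
  by have := KA (s *: z.1 + s *: V z.2); rewrite ler_norml => /andP[].
have KQA x : `|\int[Q]_z K (x + s *: V z)| <= A by exact: normr_Rintegral_bound.
have mS' := measurable_rVZ measurableT (measurable_cst s) (mS k.+1).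
have FE w : (\int[Q]_z f (S k w, z) = (\int[Q]_z K (s *: S k w + s *: V z) + A)%:E)%E.
  by rewrite -(Rintegral_shift Q (mKV (s *: S k w))).
have mG : measurable_fun setT (fun w => \int[Q]_z K (s *: S k w + s *: V z)).
  apply: (measurableT_comp (measurable_expect s mK KA)).
  exact: (measurable_rVZ measurableT (measurable_cst s) (mS k)).
have := sum_step_tonelli iidX k mV mf f0.
rewrite (eq_integral (fun w => (K (s *: S k.+1 w) + A)%:E)) => [|w _]; last first.
  by rewrite /f /= /S big_ord_recr /= scalerDr.
rewrite [RHS](eq_integral (fun w => (\int[Q]_z K (s *: S k w + s *: V z) + A)%:E))
  => [|w _]; last exact: FE.
rewrite (Rintegral_shift Pr) => [| |w]; last exact: KA; last first.
  exact: (measurableT_comp mK mS').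
by rewrite (Rintegral_shift Pr)// => -[] /addIr.
Qed.

Let rho s := \int[Q]_x (cubic_min `|V x| s) + \int[nu]_y (cubic_min `|y| s).

(** The data and the Gaussian vector share their first two moments, so the main terms of the two
    expansions cancel. *)
Let compare_step (K : 'rV[R]_n -> R) (A s : R) x : 0 <= A -> 0 <= s -> taylor_bounded A K ->
  `|\int[Q]_z K (x + s *: V z) - \int[nu]_y K (x + s *: y)| <=
   (3 + n%:R + n%:R * n%:R) * A * s ^+ 2 * rho s.
Proof.
move=> A0 s0 [mK KA /(_ x)[b [c [bA cA rA]]]].
have h1 := taylor_step mV iV V0 iVV VC A0 s0 mK KA bA cA rA.
have h2 := taylor_step (@measurable_id _ _ setT) inu nu0 inunu nuC A0 s0 mK KA bA cA rA.
rewrite /rho mulrDr; apply: le_trans (lerD h1 h2).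
rewrite [in leRHS](distrC (\int[nu]_w _)).
by rewrite (le_trans _ (ler_normD _ _))// addrA subrK.
Qed.

Lemma lindeberg H : taylor_class H -> exists A, 0 <= A /\ forall k, (0 < k)%N ->
  let s := (Num.sqrt k%:R)^-1 in
  `|\int[Pr]_w H (s *: S k w) - \int[nu]_y H y| <= A * rho s.
Proof.
move=> tH; have [A [A0 hA]] := taylor_bounded_smoothing tH.
have [mH [A' HA']] : measurable_fun setT H /\ exists A', forall x, `|H x| <= A'.
  by case: tH => b [c [A' [[? ?] _ _ _]]]; split => //; exists A'.
exists ((3 + n%:R + n%:R * n%:R) * A); split.
  by rewrite mulr_ge0// !addr_ge0// mulr_ge0.
move=> m m0; set s := _^-1; cbv zeta.
have sm0 : 0 < Num.sqrt m%:R :> R by rewrite sqrtr_gt0 ltr0n.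
have s0 : 0 <= s by rewrite invr_ge0 ltW.
have s2 : m%:R * s ^+ 2 = 1.
  by rewrite exprVn sqr_sqrtr// mulfV// pnatr_eq0 -lt0n.
(* [K j] is [H] with [j] Gaussian summands integrated out, and [a k] is the mean when the first [k]
   summands are data and the other [m - k] Gaussian; the proof telescopes from [a 0] to [a m]. *)
pose K j := smooth H (Num.sqrt j%:R * s).
pose a k := \int[Pr]_w K (m - k)%N (s *: S k w).
have am : a m = \int[Pr]_w H (s *: S m w).
  apply: eq_Rintegral => w _; rewrite /K subnn sqrtr0 mul0r /smooth.
  under eq_Rintegral do rewrite scale0r addr0.
  by rewrite Rintegral_probability_cst.
have a0 : a 0%N = \int[nu]_y H y.
  transitivity (\int[Pr]_w (\int[nu]_y H y)); last by rewrite Rintegral_probability_cst.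
  apply: eq_Rintegral => w _; rewrite /K /S big_ord0 scaler0 subn0 /smooth.
  rewrite mulfV ?gt_eqF//.
  by under eq_Rintegral do rewrite add0r scale1r.
pose e := (3 + n%:R + n%:R * n%:R) * A * s ^+ 2 * rho s.
have step k : (k < m)%N -> `|a k.+1 - a k| <= e.
  move=> km; rewrite /a; have [mK KA _] := hA nu (Num.sqrt (m - k.+1)%:R * s).
  rewrite (expect_step s k mK KA).
  (* Absorbs the Gaussian summand that the new datum replaces: the squared scales satisfy
     [(m - k) s^2 = s^2 + (m - k - 1) s^2]. *)
  have KE x : \int[nu]_y K (m - k.+1)%N (x + s *: y) = K (m - k)%N x.
    rewrite (smooth_comp (c := Num.sqrt (m - k)%:R * s) x mH HA')//.
    rewrite !exprMn !sqr_sqrtr// -[X in _ = X + _]mul1r -mulrDl; congr (_ * _).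
    by rewrite addrC natr1 subnSK.
  have msS := measurable_rVZ measurableT (measurable_cst s) (mS k).
  have iQ : Pr.-integrable setT
      (EFin \o (fun w => \int[Q]_z K (m - k.+1)%N (s *: S k w + s *: V z))).
    apply: (@integrable_bounded _ _ _ Pr _ A).
      exact: (measurableT_comp (measurable_expect s mK KA) msS).
    move=> w; apply: normr_Rintegral_bound; last by move=> z; exact: KA.
    apply: (measurableT_comp mK); apply: measurable_rVD => //.
    by apply: measurable_rVZ.
  have inuK : Pr.-integrable setT (EFin \o (fun w => K (m - k)%N (s *: S k w))).
    have [mK' KA' _] := hA nu (Num.sqrt (m - k)%:R * s).
    apply: (@integrable_bounded _ _ _ Pr _ A); last by move=> w; exact: KA'.
    exact: (measurableT_comp mK' msS).
  rewrite -(RintegralB measurableT iQ inuK); apply: normr_Rintegral_bound.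
    apply: measurable_funB.
      exact: (measurableT_comp (measurable_expect s mK KA) msS).
    have [mK' _ _] := hA nu (Num.sqrt (m - k)%:R * s).
    exact: (measurableT_comp mK' msS).
  by move=> w; rewrite -KE; apply: compare_step => //; exact: hA.
have chain k : (k <= m)%N -> `|a k - a 0%N| <= k%:R * e.
  elim: k => [|k IH] km; first by rewrite subrr normr0 mul0r.
  have h1 := step k km; have h2 := IH (ltnW km).
  have := ler_normD (a k.+1 - a k) (a k - a 0%N); rewrite subrKA.
  rewrite -natr1 mulrDl mul1r; clearbody a e; lra.
(* There are [m] errors, each carrying the factor [s^2], and [m s^2 = 1]. *)
rewrite -am -a0; apply: (le_trans (chain m (leqnn m))); rewrite /e.
move: (_ * A) (rho s) => B r; rewrite (_ : m%:R * _ = m%:R * s ^+ 2 * (B * r)).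
  by rewrite s2 mul1r.
by ring.
Qed.

End Lindeberg.

Section ProbabilityBounds.
Context {d} {T : measurableType d} {R : realType} (P : probability T R).

Lemma markov_set (f : T -> R) (c t : R) : measurable_fun setT f ->
  (forall x, 0 <= f x) -> (\int[P]_x (f x)%:E <= c%:E)%E -> 0 < t ->
  measurable [set x | t < f x] /\ (P [set x | (t < f x)%R] <= (c / t)%:E)%E.
Proof.
move=> mf f0 fc t0.
have mB : measurable [set x | t < f x].
  rewrite (_ : [set x | _] = f @^-1` `]t, +oo[); last first.
    by apply/seteqP; split => x /=; rewrite in_itv /= andbT.
  by rewrite -[X in measurable X]setTI; exact: mf.
split => //; rewrite EFinM muleC lee_pdivlMl//.
rewrite -[X in (_ * P X)%E]setIT -integral_indic// -ge0_integralZl//; last first.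
- by rewrite lee_fin ltW.
- by apply/measurable_EFinP.
apply: le_trans fc; apply: ge0_le_integral => //.
- by move=> x _; rewrite -EFinM lee_fin mulr_ge0// ltW.
- by apply: measurable_funeM; apply/measurable_EFinP.
- exact/measurable_EFinP.
- move=> x _; rewrite -EFinM lee_fin indicE; case: (boolP (x \in [set x | t < f x])) => [|_].
    by rewrite inE /= mulr1 => /ltW.
  by rewrite mulr0.
Qed.

Lemma normr_Rintegral_event (f : T -> R) (B : set T) (a b eta : R) :
  measurable_fun setT f -> measurable B -> (P B <= eta%:E)%E -> 0 <= a -> 0 <= b ->
  (forall x, `|f x| <= b) -> (forall x, ~ B x -> `|f x| <= a) ->
  `|\int[P]_x f x| <= a + b * eta.
Proof.
move=> mf mB PB a0 b0 fb fa.
have iB : P.-integrable setT (EFin \o (fun x => b * \1_B x)).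
  apply: (@integrable_bounded _ _ _ P _ b).
    by apply: measurable_funM => //; exact: measurable_indic.
  move=> x; rewrite indicE normrM (ger0_norm b0) normr_nat ler_piMr// lern1.
  by case: (x \in B).
have ia : P.-integrable setT (EFin \o cst a) by exact: finite_measure_integrable_cst.
have PBfin : P B \is a fin_num by exact: fin_num_measure.
apply: (@le_trans _ _ (\int[P]_x (a + b * \1_B x))).
  apply: normr_Rintegral_le.
  - exact: (integrable_bounded P mf fb).
  - exact: (integrableD measurableT ia iB).
  - move=> x; have [Bx|Bx] := pselect (B x).
      by rewrite (le_trans (fb x))// indicE mem_set// mulr1 lerDr.
    by rewrite (le_trans (fa x Bx))// lerDl mulr_ge0// indicE.
rewrite (RintegralD measurableT ia iB) Rintegral_probability_cst lerD2l.
rewrite RintegralZl//; last first.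
  apply: (@integrable_bounded _ _ _ P _ 1); first exact: measurable_indic.
  by move=> x; rewrite indicE normr_nat lern1; case: (x \in B).
rewrite ler_wpM2l// /Rintegral integral_indic// setIT -lee_fin fineK//.
Qed.

(* Stated through exceptional events because the sets [E k] need not be measurable. *)
Definition whp (E : nat -> set T) := forall e : R, 0 < e -> \forall k \near \oo,
  exists B, [/\ measurable B, (P B <= e%:E)%E & ~` B `<=` E k].

Lemma whpS (E F : nat -> set T) : (\forall k \near \oo, E k `<=` F k) -> whp E -> whp F.
Proof.
move=> EF wE e e0; apply: filterS2 EF (wE e e0) => k EFk [B [mB PB BE]].
by exists B; split => //; exact: subset_trans BE EFk.
Qed.

Lemma whpI (E F : nat -> set T) : whp E -> whp F -> whp (fun k => E k `&` F k).
Proof.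
move=> wE wF e e0; have e2 : 0 < e / 2 by rewrite divr_gt0.
apply: filterS2 (wE _ e2) (wF _ e2) => k [B [mB PB BE]] [C [mC PC CF]].
exists (B `|` C); split; first exact: measurableU.
  by rewrite (le_trans (measureU2 _ _ _))// [e](splitr e) EFinD leeD.
by rewrite setCU => x [Bx Cx]; split; [exact: BE|exact: CF].
Qed.

Lemma whp_bigI (I : finType) (E : I -> nat -> set T) : (forall i, whp (E i)) ->
  whp (fun k => [set w | forall i, E i k w]).
Proof.
move=> wE.
suff H (s : seq I) : whp (fun k => [set w | forall i, i \in s -> E i k w]).
  apply: whpS (H (enum I)); apply: nearW => k w /= Hw i; apply: Hw.
  by rewrite mem_enum.
elim: s => [|i s IH].
  by move=> e e0; apply: nearW => k; exists set0; split => //; rewrite measure0 lee_fin ltW.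
apply: whpS (whpI (wE i) IH); apply: nearW => k w [/= h1 h2] j.
by rewrite inE => /predU1P[->//|]; exact: h2.
Qed.

End ProbabilityBounds.

(** * From smooth to continuous test functions *)

Section Portmanteau.
Context {R : realType} {n : nat} {dO : measure_display} {Omega : measurableType dO}.
Variables (Pr : probability Omega R) (nu : probability 'rV[R]_n R).
Variables (Y W : nat -> Omega -> 'rV[R]_n).
Hypothesis mY : forall k, measurable_fun setT (Y k).
Hypothesis mW : forall k, measurable_fun setT (W k).
Hypothesis tightW : forall e : R, 0 < e -> exists L : R, forall k, exists B,
  [/\ measurable B, (Pr B <= e%:E)%E & forall w, ~ B w -> `|W k w| <= L].
Hypothesis tight_nu : forall e : R, 0 < e -> exists L : R, exists B,
  [/\ measurable B, (nu B <= e%:E)%E & forall y, ~ B y -> `|y| <= L].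
Hypothesis YW : forall dlt : R, 0 < dlt -> whp Pr (fun k => [set w | `|Y k w - W k w| <= dlt]).
Hypothesis cvgW : forall H, taylor_class H ->
  (fun k => \int[Pr]_w H (W k w)) @ \oo --> \int[nu]_y H y.

(** A bounded continuous [h] is replaced by an [H] that is close to it only on a cube; tightness of
    [W] and of [nu] controls the rest. The passage from [Y] to [W] happens in the same step, by
    uniform continuity of [h] near the cube. *)
Lemma cvg_in_distribution_taylor : cvg_in_distribution Pr Y nu.
Proof.
move=> h ch [M0 hM0].
pose M := `|M0| + 1; have M1 : 1 <= M by rewrite lerDr.
have hM y : `|h y| <= M by rewrite (le_trans (hM0 y))// (le_trans (ler_norm _))// lerDl.
have Mp : 0 < M by rewrite (lt_le_trans ltr01).
apply/cvgrPdist_le => e e0.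
(* The three estimates below add up to [4 a + 6 M eta = 7 e / 8]. *)
pose a := e / 8; have a0 : 0 < a by rewrite divr_gt0.
pose eta := e / (16 * M); have eta0 : 0 < eta by rewrite divr_gt0// mulr_gt0.
have [L1 hL1] := tightW eta0; have [L2 [D [mD PD hL2]]] := tight_nu eta0.
pose L := Num.max L1 L2.
have [dlt dlt0 hdlt] := continuous_unif_cube L ch a0.
have [H [tH HM hH]] := taylor_class_approx L ch hM a0.
have mH : measurable_fun setT H by case: tH => ? [? [? [[]]]].
have mh : measurable_fun setT h by exact: continuous_measurable_Rn.
have ih k := integrable_bounded Pr (measurableT_comp mh (mY k)) (fun w => hM (Y k w)).
have iH k := integrable_bounded Pr (measurableT_comp mH (mW k)) (fun w => HM (W k w)).
have ihn := integrable_bounded nu mh hM.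
have iHn := integrable_bounded nu mH HM.
have Meta : M * eta = e / 16 by rewrite /eta; field; rewrite gt_eqF.
near=> k.
have [B [mB PB BE]] : exists B, [/\ measurable B, (Pr B <= eta%:E)%E &
    ~` B `<=` [set w | `|Y k w - W k w| <= dlt]].
  by near: k; exact: YW.
have [C [mC PC CW]] := hL1 k.
have h1 : `|\int[Pr]_w h (Y k w) - \int[Pr]_w H (W k w)| <= 2 * a + 2 * M * (2 * eta).
  rewrite -(RintegralB measurableT (ih k) (iH k)).
  apply: (@normr_Rintegral_event _ _ _ Pr _ (B `|` C)).
  - apply: measurable_funB; [exact: (measurableT_comp mh)|exact: (measurableT_comp mH)].
  - exact: measurableU.
  - by rewrite (le_trans (measureU2 _ _ _))// mulr_natl mulr2n EFinD leeD.
  - by rewrite mulr_ge0// ltW.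
  - by rewrite mulr_ge0// ltW.
  - move=> w; rewrite (le_trans (ler_normB _ _))//.
    by have := hM (Y k w); have := HM (W k w); lra.
  - move=> w /not_orP[Bw Cw].
    have WL : `|W k w| <= L by rewrite (le_trans (CW w Cw))// le_max lexx.
    have YWd : `|W k w - Y k w| <= dlt by rewrite distrC; exact: BE.
    have e1 := hdlt _ WL _ YWd; have e2 := hH _ WL.
    rewrite -(subrKA (h (W k w))) (le_trans (ler_normD _ _))//.
    by move: e1 e2; rewrite (distrC (h (W k w)) (h (Y k w))); lra.
have h2 : `|\int[nu]_y h y - \int[nu]_y H y| <= a + 2 * M * eta.
  rewrite -(RintegralB measurableT ihn iHn).
  apply: (@normr_Rintegral_event _ _ _ nu _ D) => //.
  - exact: measurable_funB.
  - exact: ltW.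
  - by rewrite mulr_ge0// ltW.
  - move=> y; rewrite (le_trans (ler_normB _ _))//.
    by have := hM y; have := HM y; lra.
  - by move=> y Dy; apply: hH; rewrite (le_trans (hL2 y Dy))// le_max lexx orbT.
have h3 : `|\int[nu]_y H y - \int[Pr]_w H (W k w)| <= a.
  by near: k; move: (cvgW tH) => /cvgrPdist_le; apply.
move: h1 h2 h3 Meta; rewrite /a.
move: (\int[Pr]_w h _) (\int[Pr]_w H _) (\int[nu]_y h y) (\int[nu]_y H y).
move=> i1 i2 i3 i4 h1 h2 h3 Meta.
have := ler_normD (i3 - i4) (i4 - i2 + (i2 - i1)).
have := ler_normD (i4 - i2) (i2 - i1).
rewrite !subrKA (distrC i2 i1); lra.
Unshelve. all: by end_near. Qed.

End Portmanteau.

Section NormalExistence.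
Context {R : realType} {n : nat}.

Lemma tight_second_moment (nu : probability 'rV[R]_n R) :
  (forall i j, nu.-integrable setT (fun y => (y ord0 i * y ord0 j)%:E)) ->
  forall e : R, 0 < e -> exists L : R, exists B,
    [/\ measurable B, (nu B <= e%:E)%E & forall y, ~ B y -> `|y| <= L].
Proof.
move=> iyy e e0; have inorm := integrable_norm_sqr (@measurable_id _ _ setT) iyy.
pose c := \int[nu]_y (`|y| ^+ 2).
have c0 : 0 <= c by apply: Rintegral_ge0 => y _; exact: sqr_ge0.
pose t := (c + 1) / e; have t0 : 0 < t by rewrite divr_gt0// ltr_wpDl.
have mf : measurable_fun [set: 'rV[R]_n] (fun y => `|y| ^+ 2).
  by apply: measurable_funX; exact: measurable_normr.
have [mB PB] := @markov_set _ _ _ nu (fun y => `|y| ^+ 2) (c + 1) t mf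
  (fun y => sqr_ge0 _) ltac:(by rewrite (EFin_Rintegral inorm) lee_fin lerDl) t0.
exists (Num.sqrt t), [set y | t < `|y| ^+ 2]; split => //.
  by rewrite (le_trans PB)// lee_fin /t invf_div mulrC divfK// gt_eqF// ltr_wpDl.
by move=> y /negP; rewrite -leNgt => yt; rewrite -[leLHS]normr_id -sqrtr_sqr ler_wsqrtr.
Qed.

(** Besides normality, the conclusion records what the Lindeberg argument asks of the Gaussian side:
    moments and stability. *)
Lemma exists_multivariate_normal (C : 'M[R]_n) : C^T = C -> posdef_semi C ->
  exists nu : probability 'rV[R]_n R, is_multivariate_normal nu 0 C /\
  [/\ forall i, nu.-integrable setT (fun y => (y ord0 i)%:E) /\ \int[nu]_y (y ord0 i) = 0,
      forall i j, nu.-integrable setT (fun y => (y ord0 i * y ord0 j)%:E) /\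
        \int[nu]_y (y ord0 i * y ord0 j) = C i j &
      forall (a b c : R) (f : 'rV[R]_n -> \bar R),
        c ^+ 2 = a ^+ 2 + b ^+ 2 -> measurable_fun setT f -> (forall x, 0 <= f x)%E ->
      (\int[nu]_x \int[nu]_y f (a *: x + b *: y)%R = \int[nu]_x f (c *: x)%R)%E].
Proof.
move=> sC pC; have [bs CE] := rank_one_decomposition sC pC.
exists (gauss_law bs); split.
  move=> t A mA; rewrite mul0mx mxE CE quad_rank_one.
  exact: gauss_law_marginal.
have yE (y : 'rV[R]_n) i : (y *m (delta_mx (ord0 : 'I_1) i)^T) ord0 ord0 = y ord0 i.
  by rewrite trmx_delta -colE mxE.
have i1 i : (gauss_law bs).-integrable setT (fun y => (y ord0 i)%:E).
  have := integrable_gauss_dot bs (delta_mx ord0 i).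
  by under eq_fun do rewrite yE.
have sqrE (t : 'rV[R]_n) : (gauss_law bs).-integrable setT
    (fun y => (((y *m t^T) ord0 ord0) ^+ 2)%:E) /\
    \int[gauss_law bs]_y (((y *m t^T) ord0 ord0) ^+ 2) = (t *m C *m t^T) ord0 ord0.
  have h := integral_gauss_sqr bs t.
  rewrite CE quad_rank_one /Rintegral h; split => //.
  apply/integrableP; split.
    by apply/measurable_EFinP; apply: measurable_funX; exact: measurable_dot.
  by under eq_integral do rewrite gee0_abs ?lee_fin ?sqr_ge0//; rewrite h ltry.
(* Polarization: mixed moments are read off the second moments of linear functionals. *)
have prodE i j (y : 'rV[R]_n) : y ord0 i * y ord0 j =
    2^-1 * ((y *m (delta_mx (ord0 : 'I_1) i + delta_mx ord0 j)^T) ord0 ord0 ^+ 2 -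
     (y *m (delta_mx (ord0 : 'I_1) i)^T) ord0 ord0 ^+ 2 -
     (y *m (delta_mx (ord0 : 'I_1) j)^T) ord0 ord0 ^+ 2).
  by rewrite linearD /= mulmxDr [X in 2^-1 * (X ^+ 2 - _ - _)]mxE !yE; field.
split.
- move=> i; split; first exact: i1.
  rewrite /Rintegral (eq_integral (fun y => ((y *m (delta_mx (ord0 : 'I_1) i)^T) ord0 ord0)%:E)).
    by rewrite integral_gauss_dot.
  by move=> y _; rewrite yE.
- move=> i j.
  have [a1 e1] := sqrE (delta_mx ord0 i + delta_mx ord0 j).
  have [a2 e2] := sqrE (delta_mx ord0 i); have [a3 e3] := sqrE (delta_mx ord0 j).
  have a12 := integrableB measurableT a1 a2.
  have a123 := integrableB measurableT a12 a3.
  split.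
    under eq_fun do rewrite prodE EFinM.
    exact: (integrableZl measurableT _ a123).
  under eq_Rintegral do rewrite prodE.
  rewrite (RintegralZl _ measurableT a123) (RintegralB measurableT a12 a3).
  rewrite (RintegralB measurableT a1 a2) e1 e2 e3.
  have dE (k l : 'I_n) :
      (delta_mx (ord0 : 'I_1) k *m C *m (delta_mx (ord0 : 'I_1) l)^T) ord0 ord0 = C k l.
    by rewrite -rowE trmx_delta -colE !mxE.
  rewrite linearD /= mulmxDr !mulmxDl.
  have cji : C j i = C i j by rewrite -[in LHS]sC mxE.
  rewrite [X in 2^-1 * (X - _ - _)]mxE [X in 2^-1 * (X + _ - _ - _)]mxE.
  by rewrite [X in 2^-1 * (_ + X - _ - _)]mxE !dE cji; field.
- by move=> a b c f cab mf f0; exact: gauss_law_stable.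
Qed.

End NormalExistence.

Section CentralLimit.
Context {R : realType} {n : nat} {dO d : measure_display}
  {Omega : measurableType dO} {T : measurableType d}.
Variables (Pr : probability Omega R) (Q : probability T R).
Variables (X : nat -> {RV Pr >-> T}) (iidX : iid_from X Q).
Variables (V : T -> 'rV[R]_n).
Hypothesis mV : measurable_fun setT V.
Hypothesis iV : forall i, Q.-integrable setT (fun x => (V x ord0 i)%:E).
Hypothesis V0 : forall i, \int[Q]_x (V x ord0 i) = 0.
Hypothesis iVV : forall i j, Q.-integrable setT (fun x => (V x ord0 i * V x ord0 j)%:E).

Definition cov_matrix : 'M[R]_n := \matrix_(i, j) \int[Q]_x (V x ord0 i * V x ord0 j).

Definition scaled_sum k w := (Num.sqrt k%:R)^-1 *: \sum_(i < k) V (X i w).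

Lemma measurable_scaled_sum k : measurable_fun setT (scaled_sum k).
Proof.
apply: measurable_rVZ => //; apply: measurable_rV_sum => // i.
apply: (measurableT_comp mV); exact: measurable_funP.
Qed.

Lemma tight_scaled_sum (e : R) : 0 < e -> exists L : R, forall k, exists B,
  [/\ measurable B, (Pr B <= e%:E)%E & forall w, ~ B w -> `|scaled_sum k w| <= L].
Proof.
move=> e0.
pose c := \sum_i \int[Q]_x (V x ord0 i * V x ord0 i).
have c0 : 0 <= c.
  by apply: sumr_ge0 => i _; apply: Rintegral_ge0 => x _; rewrite -expr2 sqr_ge0.
(* The bound [c] on the second moment holds for every [k], so that [t] does too; the [+ 1] keeps [t]
   positive when [c = 0]. *)
pose t := (c + 1) / e; have t0 : 0 < t by rewrite divr_gt0// ltr_wpDl.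
exists (Num.sqrt t) => k.
have mf : measurable_fun setT (fun w => `|scaled_sum k w| ^+ 2).
  by apply: measurable_funX; exact: (measurable_norm_fun (measurable_scaled_sum k)).
have intc : (\int[Pr]_w (`|scaled_sum k w| ^+ 2)%:E <= (c + 1)%:E)%E.
  apply: (@le_trans _ _ (\int[Pr]_w (\sum_(i < n) (scaled_sum k w ord0 i ^+ 2)%:E))%E).
    apply: ge0_le_integral => //.
    - exact/measurable_EFinP.
    - apply: emeasurable_sum => i; apply/measurable_EFinP; apply: measurable_funX.
      exact: (measurable_coord_fun i (measurable_scaled_sum k)).
    - by move=> w _; rewrite sumEFin lee_fin; exact: normr_sqr_le.
  rewrite ge0_integral_sum//; last 2 first.
  - move=> i; apply/measurable_EFinP; apply: measurable_funX.
    exact: (measurable_coord_fun i (measurable_scaled_sum k)).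
  - by move=> i w _; rewrite lee_fin sqr_ge0.
  apply: (@le_trans _ _ (c%:E)); last by rewrite lee_fin lerDl.
  rewrite /c -sumEFin; apply: lee_sum => i _.
  pose s : R := (Num.sqrt k%:R)^-1.
  rewrite (eq_integral (fun w =>
    (s ^+ 2)%:E * ((\sum_(j < k) V (X j w)) ord0 i ^+ 2)%:E)%E); last first.
    by move=> w _; rewrite /scaled_sum mxE exprMn EFinM.
  rewrite ge0_integralZl//; first last.
  - by rewrite lee_fin sqr_ge0.
  - by move=> w _; rewrite lee_fin sqr_ge0.
  - apply/measurable_EFinP; apply: measurable_funX; apply: measurable_coord_fun.
    apply: measurable_rV_sum => // j; apply: (measurableT_comp mV); exact: measurable_funP.
  have iV2 : Q.-integrable setT (fun x => (V x ord0 i ^+ 2)%:E).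
    by have := iVV i i; under eq_fun do rewrite -expr2.
  have V0E : (\int[Q]_x (V x ord0 i)%:E = 0)%E.
    by rewrite (EFin_Rintegral (iV i)) V0.
  rewrite (sum_second_moment iidX k mV (iV i) iV2 V0E) muleA -EFinM.
  rewrite (EFin_Rintegral iV2) -EFinM lee_fin /s exprVn sqr_sqrtr//.
  under [leRHS]eq_Rintegral do rewrite -expr2.
  (* For [k = 0] the sum is empty and the left side is 0. *)
  have [->|k0] := eqVneq k 0%N.
    by rewrite mulr0 mul0r; apply: Rintegral_ge0 => x _; exact: sqr_ge0.
  by rewrite mulVf ?pnatr_eq0// mul1r.
have [mB PB] := markov_set mf (fun w => sqr_ge0 _) intc t0.
exists [set w | t < `|scaled_sum k w| ^+ 2]; split => //.
  by rewrite (le_trans PB)// lee_fin /t invf_div mulrC divfK// gt_eqF// ltr_wpDl.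
by move=> w /negP; rewrite -leNgt => yt; rewrite -[leLHS]normr_id -sqrtr_sqr ler_wsqrtr.
Qed.

(** Slutsky's theorem is part of the conclusion: it speaks of every [Y] asymptotically close to the
    scaled sums, which is how the estimator enters. *)
Theorem central_limit : exists nu : probability 'rV[R]_n R,
  is_multivariate_normal nu 0 cov_matrix /\
  forall Y : nat -> Omega -> 'rV[R]_n, (forall k, measurable_fun setT (Y k)) ->
    (forall dlt, 0 < dlt -> whp Pr (fun k => [set w | `|Y k w - scaled_sum k w| <= dlt])) ->
    cvg_in_distribution Pr Y nu.
Proof.
have sC : cov_matrix^T = cov_matrix.
  apply/matrixP => i j; rewrite !mxE; apply: eq_Rintegral => x _; exact: mulrC.
have pC : posdef_semi cov_matrix.
  move=> t.
  have iq1 i := Rintegral_sum (index_enum 'I_n) (fun j =>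
    (integrableZl measurableT (t ord0 i * t ord0 j) (iVV i j) :
     Q.-integrable setT (EFin \o (fun x => t ord0 i * t ord0 j * (V x ord0 i * V x ord0 j))))).
  have [_ qE] := Rintegral_sum (index_enum 'I_n) (fun i => (iq1 i).1).
  rewrite (_ : _ ord0 ord0 = \int[Q]_x (\sum_i \sum_j
      t ord0 i * t ord0 j * (V x ord0 i * V x ord0 j))).
    apply: Rintegral_ge0 => x _.
    rewrite (_ : \sum_i _ = (\sum_i t ord0 i * V x ord0 i) ^+ 2) ?sqr_ge0//.
    rewrite expr2 mulr_suml; apply: eq_bigr => i _; rewrite mulr_sumr.
    by apply: eq_bigr => j _; ring.
  rewrite qE mxE; under eq_bigr do rewrite mxE mulr_suml.
  rewrite exchange_big /=; apply: eq_bigr => i _; rewrite (iq1 i).2.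
  apply: eq_bigr => j _; rewrite RintegralZl//; last exact: iVV.
  by rewrite !mxE mulrAC.
have [nu [nuN [nu1 nu2 nus]]] := exists_multivariate_normal sC pC.
exists nu; split => // Y mY YW.
have VC i j : \int[Q]_x (V x ord0 i * V x ord0 j) = cov_matrix i j by rewrite mxE.
apply: (@cvg_in_distribution_taylor _ _ _ _ Pr nu Y scaled_sum) => //.
- exact: measurable_scaled_sum.
- exact: tight_scaled_sum.
- by apply: tight_second_moment => i j; exact: (nu2 i j).1.
- move=> H tH.
  have [A [A0 hA]] := lindeberg iidX mV iV V0 iVV VC (fun i => (nu1 i).1)
    (fun i => (nu1 i).2) (fun i j => (nu2 i j).1) (fun i j => (nu2 i j).2) nus tH.
  pose s (k : nat) : R := (Num.sqrt k%:R)^-1.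
  have s0 k : 0 <= s k by rewrite invr_ge0.
  have scvg : s @ \oo --> (0 : R).
    apply/cvgr0Pnorm_le => e e0; near=> k; rewrite ger0_norm ?s0// /s.
    have ek : e^-1 ^+ 2 <= k%:R by near: k; exact: nbhs_infty_ger.
    have ei : 0 < e^-1 by rewrite invr_gt0.
    have ks : e^-1 <= Num.sqrt k%:R.
      by rewrite -[leLHS]ger0_norm ?(ltW ei)// -sqrtr_sqr ler_wsqrtr.
    by rewrite -[leRHS]invrK lef_pV2// posrE (lt_le_trans ei).
  have r1 := cubic_min_cvg mV iVV s0 scvg.
  have r2 := cubic_min_cvg (@measurable_id _ _ setT) (fun i j => (nu2 i j).1) s0 scvg.
  apply/cvgrPdist_le => e e0.
  have : (fun k => A * (\int[Q]_x (cubic_min `|V x| (s k)) +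
      \int[nu]_y (cubic_min `|y| (s k)))) @ \oo --> (0 : R).
    rewrite -(mulr0 A) -[X in A * X](addr0 0); apply: cvgM; first exact: cvg_cst.
    exact: cvgD r1 r2.
  move=> /cvgrPdist_le /(_ _ e0) H0; near=> k.
  have k0 : (0 < k)%N by near: k; exact: nbhs_infty_gt.
  have := hA k k0; rewrite -/(s k) => h; rewrite distrC; apply: (le_trans h).
  have : `|0 - A * (\int[Q]_x (cubic_min `|V x| (s k)) +
      \int[nu]_y (cubic_min `|y| (s k)))| <= e by near: k.
  by rewrite sub0r normrN => /(le_trans (ler_norm _)).
Unshelve. all: by end_near. Qed.

End CentralLimit.

(** * M-estimators *)

Section LawOfLargeNumbers.
Context {R : realType} {dO d : measure_display}
  {Omega : measurableType dO} {T : measurableType d}.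
Variables (Pr : probability Omega R) (Q : probability T R).
Variables (X : nat -> {RV Pr >-> T}) (iidX : iid_from X Q).

Definition avg (f : T -> R) k w : R := k%:R^-1 * \sum_(i < k) f (X i w).

Lemma measurable_avg f k : measurable_fun setT f -> measurable_fun setT (avg f k).
Proof.
move=> mf; apply: measurable_funM => //; apply: measurable_sum => i.
apply: (measurableT_comp mf); exact: measurable_funP.
Qed.

Lemma avg_markov (f : T -> R) (c t : R) k : measurable_fun setT f ->
  (forall x, 0 <= f x) -> (\int[Q]_x (f x)%:E <= c%:E)%E -> 0 < t ->
  exists B, [/\ measurable B, (Pr B <= (c / t)%:E)%E & forall w, ~ B w -> avg f k w <= t].
Proof.
move=> mf f0 fc t0.
have c0 : 0 <= c.
  by rewrite -lee_fin (le_trans _ fc)//; apply: integral_ge0 => x _; rewrite lee_fin.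
have a0 w : 0 <= avg f k w.
  by rewrite mulr_ge0 ?invr_ge0//; apply: sumr_ge0 => i _; exact: f0.
have mavg := measurable_avg k mf.
have mfX i : measurable_fun setT (fun w => (f (X i w))%:E).
  apply/measurable_EFinP; apply: (measurableT_comp mf); exact: measurable_funP.
have ic : (\int[Pr]_w (avg f k w)%:E <= c%:E)%E.
  rewrite (eq_integral (fun w => ((k%:R^-1)%:E * \sum_(i < k) (f (X i w))%:E)%E)); last first.
    by move=> w _; rewrite /avg EFinM sumEFin.
  rewrite ge0_integralZl//; first last.
  - by move=> w _; apply: sume_ge0 => i _; rewrite lee_fin.
  - exact: emeasurable_sum.
  rewrite ge0_integral_sum//; last by move=> i w _; rewrite lee_fin.
  apply: (@le_trans _ _ ((k%:R^-1)%:E * \sum_(i < k) c%:E)%E).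
    apply: lee_wpmul2l; first by rewrite lee_fin invr_ge0.
    apply: lee_sum => i _; apply: le_trans fc.
    rewrite (integral_iid iidX i (f := fun x => (f x)%:E))//.
    exact/measurable_EFinP.
  rewrite sumEFin -EFinM lee_fin sumr_const card_ord -[c *+ k]mulr_natl.
  have [->|k0] := eqVneq k 0%N; first by rewrite mul0r mulr0.
  by rewrite mulrA mulVf ?pnatr_eq0// mul1r.
have [mB PB] := markov_set mavg a0 ic t0.
by exists [set w | t < avg f k w]; split => // w /negP; rewrite -leNgt.
Qed.

(** Chebyshev's inequality; [g] is viewed as a row vector with one coordinate to reuse the second
    moment of sums. *)
Let bounded_law (g : T -> R) (M : R) : measurable_fun setT g ->
  (forall x, `|g x| <= M) -> \int[Q]_x g x = 0 ->
  forall dlt : R, 0 < dlt -> whp Pr (fun k => [set w | `|avg g k w| <= dlt]).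
Proof.
move=> mg gM g0 dlt dlt0 e e0.
have M0 : 0 <= M.
  by have := gM point; apply: le_trans.
pose V x : 'rV[R]_1 := const_mx (g x).
have VE x : V x ord0 ord0 = g x by rewrite mxE.
have mV : measurable_fun setT V.
  by apply: measurable_rV => // i; under eq_fun do rewrite mxE.
have gi := integrable_bounded Q mg gM.
have g2M x : `|g x ^+ 2| <= M ^+ 2.
  by rewrite normrX lerXn2r ?nnegrE.
have mg2 : measurable_fun setT (fun x => g x ^+ 2) by exact: measurable_funX.
have g2i := integrable_bounded Q mg2 g2M.
near=> k.
have k0 : (0 < k)%N by near: k; exact: nbhs_infty_gt.
have kp : 0 < k%:R :> R by rewrite ltr0n.
have sumE w : (\sum_(j < k) V (X j w)) ord0 ord0 = \sum_(j < k) g (X j w).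
  by rewrite summxE; apply: eq_bigr => j _; rewrite VE.
have mavg := measurable_avg k mg.
have i2 : (\int[Pr]_w (avg g k w ^+ 2)%:E <= (M ^+ 2 / k%:R)%:E)%E.
  have V0 : (\int[Q]_x (g x)%:E = 0)%E by rewrite (EFin_Rintegral gi) g0.
  have := @sum_second_moment _ _ _ _ _ Pr Q X iidX 1 V ord0 k mV.
  under [in X in X -> _]eq_fun do rewrite VE.
  under [in X in _ -> X -> _]eq_fun do rewrite VE.
  move=> /(_ gi g2i V0).
  rewrite (eq_integral (fun w => ((k%:R ^+ 2)%:E * (avg g k w ^+ 2)%:E)%E)); last first.
    move=> w _; rewrite sumE -EFinM; congr EFin; rewrite /avg -exprMn mulrA.
    by rewrite mulfV ?gt_eqF// mul1r.
  rewrite ge0_integralZl//; first last.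
  - by move=> w _; rewrite lee_fin sqr_ge0.
  - by apply/measurable_EFinP; exact: measurable_funX.
  move=> h; rewrite -(@lee_pmul2l _ ((k%:R ^+ 2)%:E : \bar R))//; last first.
    by rewrite lte_fin exprn_gt0.
  rewrite h -EFinM (_ : k%:R ^+ 2 * (M ^+ 2 / k%:R) = k%:R * M ^+ 2); last first.
    by field; rewrite gt_eqF.
  rewrite EFinM lee_pmul2l ?lte_fin//.
  rewrite (eq_integral (fun x => (g x ^+ 2)%:E)) => [|x _]; last by rewrite VE.
  rewrite (EFin_Rintegral g2i) lee_fin.
  rewrite -[leRHS](Rintegral_probability_cst Q); apply: le_Rintegral => //.
    exact: finite_measure_integrable_cst.
  by move=> x _; rewrite (le_trans _ (g2M x))// ler_norm.
have d2 : 0 < dlt ^+ 2 by rewrite exprn_gt0.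
have [mB PB] := @markov_set _ _ _ Pr _ _ _ (measurable_funX 2 mavg)
  (fun w => sqr_ge0 _) i2 d2.
exists [set w | dlt ^+ 2 < avg g k w ^+ 2]; split => //.
  rewrite (le_trans PB)// lee_fin ler_pdivrMr// ler_pdivrMr// mulrC -ler_pdivrMr ?mulr_gt0//.
  by near: k; exact: nbhs_infty_ger.
move=> w /negP; rewrite -leNgt => h /=.
by rewrite -sqrtr_sqr -[leRHS]ger0_norm ?(ltW dlt0)// -[leRHS]sqrtr_sqr ler_wsqrtr.
Unshelve. all: by end_near. Qed.

(** Truncation, because [f] is only integrable: the truncated centred part obeys [bounded_law], and
    the tail has a small mean, so that Markov's inequality applies to it. *)
Lemma weak_law (f : T -> R) : measurable_fun setT f ->
  Q.-integrable setT (EFin \o f) ->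
  forall dlt : R, 0 < dlt ->
    whp Pr (fun k => [set w | `|avg f k w - \int[Q]_x f x| <= dlt]).
Proof.
move=> mf fi dlt dlt0 e e0.
pose tr (M : nat) x := f x * \1_[set y | `|f y| <= M%:R] x.
have mA M : measurable [set y | `|f y| <= M%:R].
  rewrite (_ : [set y | _] = f @^-1` `[- M%:R, M%:R]); last first.
    by apply/seteqP; split => x /=; rewrite in_itv /= ler_norml.
  by rewrite -[X in measurable X]setTI; exact: mf.
have mtr M : measurable_fun setT (tr M).
  by apply: measurable_funM => //; exact: measurable_indic.
have trM M x : `|tr M x| <= M%:R.
  rewrite /tr indicE; case: (boolP (x \in _)) => [|_]; last by rewrite mulr0 normr0.
  by rewrite inE /= mulr1.
have trle M x : `|f x - tr M x| <= `|f x|.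
  rewrite /tr indicE; case: (x \in _); first by rewrite mulr1 subrr normr0.
  by rewrite mulr0 subr0.
have cvg0 : (fun M => \int[Q]_x `|f x - tr M x|) @ \oo --> (0 : R).
  have h1 M : measurable_fun setT (fun x => (`|f x - tr M x|)%:E).
    apply/measurable_EFinP; apply: measurableT_comp => //.
    exact: measurable_funB.
  have h2 : {ae Q, forall x, setT x -> (`|f x - tr M x|)%:E @[M --> \oo] --> 0%E}.
    apply: aeW => x _; apply/fine_cvgP; split; first exact: nearW.
    apply: (@cvg_near_cst _ R^o); near=> M => /=.
    rewrite /tr indicE mem_set ?mulr1 ?subrr ?normr0//=.
    by near: M; exact: nbhs_infty_ger.
  have h3 : {ae Q, forall x M, setT x -> (`|(`|f x - tr M x|)%:E| <= (`|f x|)%:E)%E}.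
    by apply: aeW => x M _; rewrite /= lee_fin normr_id.
  have [_ _] := dominated_convergence measurableT h1 (measurable_cst 0%E) h2
    (integrable_norm fi) h3.
  by rewrite integral0 => /fine_cvgP[].
(* [dlt / 3] is for the shift of the mean caused by truncation, [e * dlt / 6] for Markov's bound
   [eta / (dlt / 3) <= e / 2] on the tail. *)
pose eta := Num.min (dlt / 3) (e * dlt / 6).
have eta0 : 0 < eta by rewrite lt_min !divr_gt0// mulr_gt0.
have [M hM] : exists M, \int[Q]_x `|f x - tr M x| <= eta.
  move/cvgrPdist_le: cvg0 => /(_ _ eta0) [M _ /(_ M (leqnn M))] /=.
  rewrite sub0r normrN ger0_norm; first by exists M.
  by apply: Rintegral_ge0.
pose m := \int[Q]_x tr M x.
have itr := integrable_bounded Q (mtr M) (trM M).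
have idf : Q.-integrable setT (EFin \o (fun x => `|f x - tr M x|)).
  exact: (integrable_norm (integrableB measurableT fi itr)).
have mm : `|m - \int[Q]_x f x| <= eta.
  rewrite distrC -(RintegralB measurableT fi itr); apply: le_trans hM.
  apply: le_normr_Rintegral => //; exact: (integrableB measurableT fi itr).
pose g x := tr M x - m.
have mg : measurable_fun setT g by exact: measurable_funB.
have gM x : `|g x| <= M%:R + `|m| by rewrite (le_trans (ler_normB _ _))// lerD2r.
have g0 : \int[Q]_x g x = 0.
  rewrite (RintegralB measurableT itr (finite_measure_integrable_cst Q m measurableT)).
  by rewrite Rintegral_probability_cst subrr.
have d3 : 0 < dlt / 3 by rewrite divr_gt0.
have e2 : 0 < e / 2 by rewrite divr_gt0.
have mdf : measurable_fun setT (fun x => `|f x - tr M x|).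
  by apply: measurableT_comp => //; exact: measurable_funB.
have ieta : (\int[Q]_x (`|f x - tr M x|)%:E <= eta%:E)%E.
  by rewrite (EFin_Rintegral idf) lee_fin.
near=> k.
have k0 : (0 < k)%N by near: k; exact: nbhs_infty_gt.
have [B [mB PB hB]] : exists B, [/\ measurable B, (Pr B <= (e / 2)%:E)%E &
    ~` B `<=` [set w | `|avg g k w| <= dlt / 3]].
  by near: k; exact: (bounded_law mg gM g0 d3 e2).
have [C [mC PC hC]] := avg_markov k mdf (fun x => normr_ge0 _) ieta d3.
exists (B `|` C); split; first exact: measurableU.
  rewrite (le_trans (measureU2 _ _ _))// [e](splitr e) EFinD leeD//.
  rewrite (le_trans PC)// lee_fin ler_pdivrMr//.
  by rewrite (_ : e / 2 * (dlt / 3) = e * dlt / 6) ?ge_min ?lexx ?orbT//; field.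
rewrite setCU => w [Bw Cw] /=.
have avgE : avg f k w = avg (fun x => f x - tr M x) k w + avg g k w + m.
  rewrite /avg -mulrDr -big_split /=.
  rewrite [in RHS](eq_bigr (fun i : 'I_k => f (X i w) - m)) => [|i _]; last by rewrite /g addrA subrK.
  rewrite sumrB sumr_const card_ord -[m *+ k]mulr_natl mulrBr mulrA mulVf ?pnatr_eq0 -?lt0n//.
  by rewrite mul1r subrK.
have h1 : `|avg (fun x => f x - tr M x) k w| <= dlt / 3.
  apply: le_trans (hC w Cw); rewrite /avg normrM ger0_norm ?invr_ge0//.
  by rewrite ler_wpM2l ?invr_ge0// ler_norm_sum.
have h2 : `|avg g k w| <= dlt / 3 by exact: hB.
have h3 : `|m - \int[Q]_x f x| <= dlt / 3 by rewrite (le_trans mm)// ge_min lexx.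
rewrite avgE -addrA.
move: (avg _ k w) (avg g k w) (m - _) h1 h2 h3 => a b c h1 h2 h3.
have := ler_normD (a + b) c; have := ler_normD a b; lra.
Unshelve. all: by end_near. Qed.

End LawOfLargeNumbers.

Section ZEstimator.
Context {R : realType} {r : nat} {dO d : measure_display}
  {Omega : measurableType dO} {T : measurableType d}.
Variables (Pr : probability Omega R) (Q : probability T R).
Variables (X : nat -> {RV Pr >-> T}) (iidX : iid_from X Q).
Variables (phi : T -> 'rV[R]_r) (H : T -> 'M[R]_r) (Gam : 'M[R]_r).
Variables (Psi : 'rV[R]_r -> T -> 'rV[R]_r) (G : set T).
Hypothesis mphi : measurable_fun setT phi.
Hypothesis iphi : forall i, Q.-integrable setT (EFin \o (fun x => phi x ord0 i)).
Hypothesis phi0 : forall i, \int[Q]_x (phi x ord0 i) = 0.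
Hypothesis iphi2 : forall i j,
  Q.-integrable setT (EFin \o (fun x => phi x ord0 i * phi x ord0 j)).
Hypothesis mH : forall i j, measurable_fun setT (fun x => H x i j).
Hypothesis iH : forall i j, Q.-integrable setT (EFin \o (fun x => H x i j)).
Hypothesis EH : forall i j, \int[Q]_x H x i j = Gam i j.
Hypothesis uGam : Gam \in unitmx.
Hypothesis linearization : forall e : R, 0 < e -> exists2 dlt : R, 0 < dlt &
  exists rho : T -> R, [/\ measurable_fun setT rho, forall x, 0 <= rho x,
    (\int[Q]_x (rho x)%:E <= e%:E)%E &
    forall x h, G x -> `|h| <= dlt -> `|Psi h x - phi x - h *m H x| <= rho x * `|h|].
Variable h_ : nat -> Omega -> 'rV[R]_r.
Hypothesis mh : forall k, measurable_fun setT (h_ k).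
Hypothesis h_small : forall dlt : R, 0 < dlt -> whp Pr (fun k => [set w | `|h_ k w| <= dlt]).
Hypothesis h_zero : whp Pr (fun k => [set w |
  (forall i : 'I_k, G (X i w)) /\ \sum_(i < k) Psi (h_ k w) (X i w) = 0]).

(** The influence function: its scaled sum is the leading term of the normalized estimation
    error. *)
Let V x : 'rV[R]_r := - (phi x *m invmx Gam).

Lemma norm_mulmx_le (u : 'rV[R]_r) (A : 'M[R]_r) a : 0 <= a -> (forall i j, `|A i j| <= a) ->
  `|u *m A| <= r%:R * a * `|u|.
Proof.
move=> a0 Aa; apply: norm_rV_le => [|j]; first by rewrite !mulr_ge0.
rewrite mxE (le_trans (ler_norm_sum _ _ _))//.
apply: (@le_trans _ _ (\sum_(i < r) a * `|u|)).
  by apply: ler_sum => i _; rewrite normrM mulrC ler_pM// coord_le_norm.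
by rewrite sumr_const card_ord -[_ *+ r]mulr_natl mulrA.
Qed.

Let VE i x : V x ord0 i = \sum_j (- invmx Gam j i) * phi x ord0 j.
Proof. by rewrite !mxE -sumrN; apply: eq_bigr => j _; rewrite mulrC mulNr. Qed.

Let VVE i j x : V x ord0 i * V x ord0 j =
  \sum_k \sum_l (invmx Gam k i * invmx Gam l j) * (phi x ord0 k * phi x ord0 l).
Proof.
rewrite !VE mulr_suml; apply: eq_bigr => k _; rewrite mulr_sumr.
by apply: eq_bigr => l _; ring.
Qed.

Let i2 i j k := Rintegral_sum (index_enum 'I_r) (fun l =>
  (integrableZl measurableT (invmx Gam k i * invmx Gam l j) (iphi2 k l) :
   Q.-integrable setT (EFin \o (fun x =>
     (invmx Gam k i * invmx Gam l j) * (phi x ord0 k * phi x ord0 l))))).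

Let covV : cov_matrix Q V = (invmx Gam)^T *m cov_matrix Q phi *m invmx Gam.
Proof.
apply/matrixP => i j; rewrite !mxE.
under eq_Rintegral do rewrite VVE.
rewrite (Rintegral_sum (index_enum 'I_r) (fun k => (i2 i j k).1)).2.
under eq_bigr do rewrite (i2 i j _).2.
rewrite exchange_big; apply: eq_bigr => l _ /=.
rewrite mxE mulr_suml; apply: eq_bigr => k _.
rewrite (RintegralZl _ measurableT (iphi2 k l)) !mxE.
by rewrite mulrAC.
Qed.

(* The estimating equation, expanded at h = 0, reads
   h (Gam + o(1)) = - k^-1 sum phi (X_i) + o(|h|). *)
Theorem zestimator_normal : exists nu : probability 'rV[R]_r R,
  is_multivariate_normal nu 0 ((invmx Gam)^T *m cov_matrix Q phi *m invmx Gam) /\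
  cvg_in_distribution Pr (fun k w => Num.sqrt k%:R *: h_ k w) nu.
Proof.
rewrite -covV.
have mV : measurable_fun setT V.
  apply: measurable_rV => // i.
  under eq_fun do rewrite VE.
  apply: measurable_sum => j; apply: measurable_funM => //.
  exact: measurable_coord_fun.
have i1 i := Rintegral_sum (index_enum 'I_r) (fun j =>
  (integrableZl measurableT (- invmx Gam j i) (iphi j) :
   Q.-integrable setT (EFin \o (fun x => (- invmx Gam j i) * phi x ord0 j)))).
have iV i : Q.-integrable setT (fun x => (V x ord0 i)%:E).
  under eq_fun do rewrite VE.
  exact: (i1 i).1.
have V0 i : \int[Q]_x (V x ord0 i) = 0.
  under eq_Rintegral do rewrite VE.
  rewrite (i1 i).2 big1// => j _.
  by rewrite (RintegralZl _ measurableT (iphi j)) phi0 mulr0.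
have iVV i j : Q.-integrable setT (fun x => (V x ord0 i * V x ord0 j)%:E).
  under eq_fun do rewrite VVE.
  exact: (Rintegral_sum (index_enum 'I_r) (fun k => (i2 i j k).1)).1.
have [nu [Nnu clt]] := central_limit iidX mV iV V0 iVV.
exists nu; split => //; apply: clt => [k|dlt dlt0].
  by apply: measurable_rVZ.
move=> e e0; have e4 : 0 < e / 4 by rewrite divr_gt0.
have [L tight] := tight_scaled_sum iidX mV iV V0 iVV e4.
pose c := \sum_i \sum_j `|invmx Gam i j|.
have Gc i j : `|invmx Gam i j| <= c.
  rewrite /c (bigD1 i)//= (bigD1 j)//= -addrA lerDl addr_ge0//.
    by apply: sumr_ge0.
  by apply: sumr_ge0 => k _; exact: sumr_ge0.
have c0 : 0 <= c by apply: sumr_ge0 => i _; exact: sumr_ge0.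
(* The bound [1 / 2] lets the relative error [ep * |Y|] on [Y - W] be absorbed, so that the norm of
   [Y] is at most twice that of [W]; the other bound then makes the error at most [dlt]. *)
pose ep := Num.min (1 / 2) (dlt / (2 * (`|L| + 1))).
have ep0 : 0 < ep by rewrite lt_min !divr_gt0// mulr_gt0// ltr_wpDl.
(* Makes [r c (r eta + eta) <= ep]: the errors of the Hessian average and of the linearization,
   after multiplication by [invmx Gam]. The [+ 1] keeps [D] positive. *)
pose D := (r%:R * c + 1) * (r%:R + 1).
have D0 : 0 < D by rewrite mulr_gt0// ltr_wpDl// mulr_ge0.
pose eta := ep / D; have eta0 : 0 < eta by rewrite divr_gt0.
have rc : r%:R * c * (r%:R * eta + eta) <= ep.
  rewrite (_ : r%:R * c * _ = r%:R * c * (r%:R + 1) / D * ep); last by rewrite /eta; ring.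
  rewrite ler_piMl ?(ltW ep0)// ler_pdivrMr// mul1r /D.
  by rewrite ler_wpM2r ?lerDl// addr_ge0.
(* With this mean for [rho], Markov's inequality at level [eta] costs probability [e / 4]. *)
have e4eta : 0 < e / 4 * eta by rewrite mulr_gt0.
have [dl dl0 [rho [mrho rho0 rhoint lin]]] := linearization e4eta.
have wl : whp Pr (fun k => [set w | forall i j : 'I_r, `|avg X (fun x => H x i j) k w - Gam i j| <= eta]).
  have := @whp_bigI _ _ _ Pr _ _ (fun ij : 'I_r * 'I_r =>
    weak_law iidX (mH ij.1 ij.2) (iH ij.1 ij.2) eta0).
  by apply: whpS; apply: nearW => k w /= hw i j; have := hw (i, j); rewrite EH.
have good := whpI wl (whpI (h_small dl0) h_zero).
have e2 : 0 < e / 2 by rewrite divr_gt0.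
near=> k.
have k0 : (0 < k)%N by near: k; exact: nbhs_infty_gt.
have kp : 0 < k%:R :> R by rewrite ltr0n.
have [B1 [mB1 PB1 hB1]] := tight k.
have [B2 [mB2 PB2 hB2]] := avg_markov iidX k mrho rho0 rhoint eta0.
have [B3 [mB3 PB3 hB3]] : exists B, [/\ measurable B, (Pr B <= (e / 2)%:E)%E & ~` B `<=`
    [set w | forall i j : 'I_r, `|avg X (fun x => H x i j) k w - Gam i j| <= eta] `&`
   ([set w | `|h_ k w| <= dl] `&`
    [set w | (forall i : 'I_k, G (X i w)) /\ \sum_(i < k) Psi (h_ k w) (X i w) = 0])].
  by near: k; exact: (good _ e2).
exists (B1 `|` (B2 `|` B3)); split; first by apply: measurableU => //; exact: measurableU.
  rewrite (le_trans (measureU2 _ _ _))//; first exact: measurableU.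
  rewrite (_ : e = e / 4 + (e / 4 + e / 2)); last by field.
  rewrite EFinD leeD// (le_trans (measureU2 _ _ _))// EFinD leeD// (le_trans PB2)//.
  by rewrite lee_fin mulfK ?gt_eqF.
rewrite !setCU => w [Bw1 [Bw2 Bw3]] /=.
have [Sw [hw [Gw zw]]] := hB3 w Bw3.
have aw := hB2 w Bw2; have Ww := hB1 w Bw1.
move: Sw hw zw => /=; set h := h_ k w => Sw hw zw.
pose err i := Psi h (X i w) - phi (X i w) - h *m H (X i w).
pose S : 'M[R]_r := k%:R^-1 *: \sum_(i < k) H (X i w).
have SE i j : `|(Gam - S) i j| <= eta.
  rewrite !mxE summxE distrC; exact: (Sw i j).
have s0 : 0 < Num.sqrt (k%:R : R) by rewrite sqrtr_gt0.
have errE : `|k%:R^-1 *: \sum_(i < k) err i| <= eta * `|h|.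
  rewrite normrZ ger0_norm ?invr_ge0//.
  apply: (@le_trans _ _ (k%:R^-1 * \sum_(i < k) (rho (X i w) * `|h|))).
    rewrite ler_wpM2l ?invr_ge0// (le_trans (ler_norm_sum _ _ _))//.
    by apply: ler_sum => i _; apply: lin.
  by rewrite -mulr_suml mulrA ler_wpM2r.
(* The estimating equation times the inverse of [Gam]: the error splits into the fluctuation of the
   Hessian average [S] and the averaged linearization error. *)
have key : Num.sqrt k%:R *: h - scaled_sum X V k w =
    (Num.sqrt k%:R *: (h *m (Gam - S) - k%:R^-1 *: \sum_(i < k) err i)) *m invmx Gam.
  have -> : scaled_sum X V k w =
      - (Num.sqrt k%:R *: (k%:R^-1 *: \sum_(i < k) phi (X i w)) *m invmx Gam).
    rewrite /scaled_sum sumrN scalerN; congr (- _).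
    rewrite -mulmx_suml scalemxAl scalerA; congr (_ *: _ *m _).
    by rewrite -[in k%:R^-1](sqr_sqrtr (ltW kp)); field; rewrite gt_eqF.
  have errS : \sum_(i < k) err i = - \sum_(i < k) phi (X i w) - h *m \sum_(i < k) H (X i w).
    by rewrite /err !sumrB zw sub0r mulmx_sumr.
  have hG : h = (h *m Gam) *m invmx Gam by rewrite mulmxK.
  rewrite [in LHS]hG opprK scalemxAl -mulmxDl -scalerDr; congr (_ *: _ *m _).
  by rewrite errS mulmxBr /S -scalemxAr scalerBr scalerN opprB opprK addrA subrK.
set Y := Num.sqrt k%:R *: h; set W := scaled_sum X V k w in key Ww *.
have YW : `|Y - W| <= ep * `|Y|.
  rewrite key (le_trans (norm_mulmx_le _ c0 Gc))// normrZ ger0_norm ?sqrtr_ge0//.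
  apply: (@le_trans _ _ (r%:R * c * (Num.sqrt k%:R * (r%:R * eta * `|h| + eta * `|h|)))).
    rewrite ler_wpM2l ?mulr_ge0// ler_wpM2l ?sqrtr_ge0// (le_trans (ler_normB _ _))//.
    by rewrite lerD// norm_mulmx_le// ltW.
  rewrite (_ : _ * (_ * _) = r%:R * c * (r%:R * eta + eta) * `|Y|).
    by rewrite ler_wpM2r.
  by rewrite /Y normrZ ger0_norm ?sqrtr_ge0//; ring.
have ep1 : ep <= 1 / 2 by rewrite ge_min lexx.
have ep2 : ep * (2 * (`|L| + 1)) <= dlt.
  by rewrite -ler_pdivlMr ?mulr_gt0 ?ltr_wpDl// ge_min lexx orbT.
have YWn : `|Y| <= `|W| + `|Y - W|.
  by rewrite -[X in `|X| <= _](addrNK W) addrC ler_normD.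
have WL : `|W| <= `|L| by rewrite (le_trans Ww)// ler_norm.
have Y0 := normr_ge0 Y.
have hh : ep * `|Y| <= 1 / 2 * `|Y| by rewrite ler_wpM2r.
have Y2 : `|Y| <= 2 * (`|L| + 1) by lra.
rewrite (le_trans YW)// (le_trans _ ep2)// ler_wpM2l// ltW//.
Unshelve. all: by end_near. Qed.

End ZEstimator.

(** * Calculus along lines in the parameter space *)

Section DirectionalCalculus.
Context {R : realType} {r : nat}.
Implicit Types (u : 'rV[R]_r -> R) (a h : 'rV[R]_r).

Lemma derive_sum_partial u a h : differentiable u a ->
  'D_h u a = \sum_j h ord0 j * partial j u a.
Proof.
move=> du; rewrite deriveE// {1}[h]row_sum_delta linear_sum; apply: eq_bigr => j _.
by rewrite linearZ /= /partial deriveE.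
Qed.

Lemma is_derive_line u a h (t : R) : derivable u (a + t *: h) h ->
  is_derive t 1 (fun t : R => u (a + t *: h)) ('D_h u (a + t *: h)).
Proof.
move=> du.
have E : (fun s : R => s^-1 *: (((fun t : R => u (a + t *: h)) \o shift t) (s *: 1) - u (a + t *: h)))
   = (fun s : R => s^-1 *: ((u \o shift (a + t *: h)) (s *: h) - u (a + t *: h))).
  apply/funext => s /=; congr (_ *: (u _ - _)).
  by rewrite scalerDl [s%:A]mulr1 addrCA.
by split; [rewrite /derivable E|rewrite /derive E].
Qed.

Lemma differentiable_is_derive_line u a h (t : R) : differentiable u (a + t *: h) ->
  is_derive t 1 (fun t : R => u (a + t *: h)) (\sum_j h ord0 j * partial j u (a + t *: h)).
Proof.
move=> du; rewrite -derive_sum_partial//; apply: is_derive_line.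
exact: diff_derivable.
Qed.

(** Along the segment the derivative is a sum of [r] partial derivatives weighted by the coordinates
    of [h]; as the norm is the sup norm, the factor [r] appears. *)
Lemma mean_value_bound u a (del b : R) h :
  (forall h, `|h| < del -> differentiable u (a + h)) ->
  (forall h j, `|h| < del -> `|partial j u (a + h)| <= b) ->
  `|h| < del -> `|u (a + h) - u a| <= r%:R * b * `|h|.
Proof.
move=> du bu hd.
have th (t : R) : 0 <= t <= 1 -> `|t *: h| < del.
  move=> /andP[t0 t1]; rewrite normrZ ger0_norm// (le_lt_trans _ hd)//.
  by rewrite ler_piMl.
have dr (t : R) : 0 <= t <= 1 -> is_derive t 1 (fun t : R => u (a + t *: h))
    (\sum_j h ord0 j * partial j u (a + t *: h)).
  by move=> t01; apply: differentiable_is_derive_line; apply: du; exact: th.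
have [||t] := @MVT_segment R (fun t => u (a + t *: h))
   (fun t => \sum_j h ord0 j * partial j u (a + t *: h)) 0 1 ler01.
- move=> t; rewrite in_itv /= => /andP[t0 t1]; apply: dr.
  by rewrite !ltW.
- apply: derivable_within_continuous => t; rewrite in_itv /= => t01.
  by have [] := dr t t01.
rewrite in_itv /= => t01; rewrite scale1r scale0r addr0 subr0 mulr1 => ->.
rewrite (le_trans (ler_norm_sum _ _ _))//.
apply: (@le_trans _ _ (\sum_(j < r) `|h| * b)).
  apply: ler_sum => j _; rewrite normrM ler_pM// ?coord_le_norm//.
  by apply: bu; exact: th.
by rewrite sumr_const card_ord -[_ *+ r]mulr_natl mulrAC mulrA mulrAC.
Qed.

Lemma differentiable_small_o u a : differentiable u a ->
  forall e : R, 0 < e -> exists2 dlt : R, 0 < dlt & forall h, `|h| <= dlt ->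
    `|u (a + h) - u a - \sum_j h ord0 j * partial j u a| <= e * `|h|.
Proof.
move=> du e e0; have /diff_locallyP[_] := du.
move=> /eqaddoP /(_ _ e0) /nbhs_ballP[dl /= dl0 hdl].
exists (dl / 2); rewrite ?divr_gt0// => h hh.
have : ball (0 : 'rV[R]_r) dl h.
  by rewrite -ball_normE /= sub0r normrN (le_lt_trans hh)// ltr_pdivrMr// ltr_pMr// ltr1n.
move=> /hdl /=; rewrite -(derive_sum_partial h du) deriveE//.
by rewrite !fctE /= [h + a]addrC opprD addrA.
Qed.

(** A sequential form, fit for dominated convergence and for measurability of limits. [k.+2] keeps
    each step strictly shorter than [del], inside the ball where hypotheses hold. *)
Lemma partial_quotient_cvg u a i (del : R) : 0 < del -> differentiable u a ->
  (fun k => k.+2%:R / del * (u (a + (del / k.+2%:R) *: delta_mx ord0 i) - u a)) @ \oo -->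
  partial i u a.
Proof.
move=> del0 du; have : derivable u a (delta_mx ord0 i) by exact: diff_derivable.
move=> /cvg_ex [l hl]; have -> : partial i u a = l by exact: cvg_lim.
move/cvgr_dnbhsP: hl => /(_ (fun k : nat => del / k.+2%:R)) H.
have t0 : (fun k : nat => del / k.+2%:R) @ \oo --> (0 : R).
  rewrite -[X in _ --> X](mulr0 del); apply: cvgM; first exact: cvg_cst.
  apply/cvgrPdist_le => e e0; near=> k.
  rewrite sub0r normrN ger0_norm ?invr_ge0//.
  rewrite invf_ple ?posrE//; apply: (@le_trans _ _ k%:R); last by rewrite ler_nat ltnW// ltnW.
  by near: k; exact: nbhs_infty_ger.
have {H} H := H (conj (fun k => lt0r_neq0 (divr_gt0 del0 (ltr0Sn R k.+1))) t0).
apply: cvg_trans H; apply: near_eq_cvg; apply: nearW => k /=.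
by rewrite invf_div [_ + a]addrC.
Unshelve. all: by end_near. Qed.

Lemma partial_at_min u a i (del : R) : 0 < del ->
  (forall h, `|h| < del -> differentiable u (a + h)) ->
  (forall h, `|h| < del -> u a <= u (a + h)) -> partial i u a = 0.
Proof.
move=> del0 du um; pose e : 'rV[R]_r := delta_mx ord0 i.
have ne (t : R) : `|t| < del -> `|t *: e| < del.
  move=> td; rewrite normrZ (le_lt_trans _ td)// ler_piMr//.
  by apply: norm_rV_le => // j; rewrite mxE; case: (_ && _); rewrite ?normr1 ?normr0.
have dt (t : R) : `|t| < del -> is_derive t 1 (fun t => u (a + t *: e)) ('D_e u (a + t *: e)).
  by move=> td; apply: is_derive_line; apply: diff_derivable; apply: du; exact: ne.
have h0 : is_derive (0 : R) 1 (fun t => u (a + t *: e)) 0.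
  apply: (@derive1_at_min _ _ (- del) del).
  - by rewrite (@le_trans _ _ 0)// ?oppr_le0 ltW.
  - by move=> t; rewrite in_itv /= -ltr_norml => /dt [].
  - by rewrite in_itv /= oppr_lt0 del0.
  - by move=> t; rewrite in_itv /= -ltr_norml => /ne /um; rewrite scale0r addr0.
have := dt 0; rewrite normr0 => /(_ del0) h1.
rewrite scale0r addr0 in h1; rewrite /partial -/e.
by rewrite -(@derive_val _ _ _ _ _ _ _ h1) (@derive_val _ _ _ _ _ _ _ h0).
Qed.

Lemma ratr_row_dense a (U : set 'rV[R]_r) : nbhs a U ->
  exists q : {ffun 'I_r -> rat}, U (\row_i ratr (q i)).
Proof.
move=> /nbhs_ballP[e /= e0 eU].
have q_ i : {q : rat | `|a ord0 i - ratr q| < e}.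
  apply: cid; have [|q] := @rat_in_itvoo R (a ord0 i) (a ord0 i + e).
    by rewrite ltrDl.
  rewrite in_itv /= => /andP[q1 q2]; exists q.
  by rewrite distrC gtr0_norm ?subr_gt0 // ltrBlDl.
exists [ffun i => sval (q_ i)]; apply: eU; split => // k i.
by rewrite ord1 !mxE ffunE; exact: (svalP (q_ i)).
Qed.

End DirectionalCalculus.

(** * Minimizers of an empirical loss [F] with a companion [D] of the same mean up to a constant *)

Section MEstimator.
Context {R : realType} {r : nat} {dO d : measure_display}
  {Omega : measurableType dO} {T : measurableType d}.
Variables (Pr : probability Omega R) (Q : probability T R).
Variables (X : nat -> {RV Pr >-> T}) (iidX : iid_from X Q).
Variables (G : set T) (mG : measurable G) (QG : Q (~` G) = 0%E).
Variables (ts : 'rV[R]_r) (del : R) (del0 : 0 < del).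
Variables (F D : 'rV[R]_r -> T -> R) (b1 b2 b3 b4 : T -> R) (c : R).
Let e_ (i : 'I_r) : 'rV[R]_r := delta_mx ord0 i.
Let dF i h x := partial i (F ^~ x) (ts + h).
Let dD i h x := partial i (D ^~ x) (ts + h).
Let ddF i j x := partial j (partial i (F ^~ x)) ts.
Let ddD i j x := partial j (partial i (D ^~ x)) ts.
Hypothesis iF : forall h, `|h| < del -> Q.-integrable G (EFin \o F (ts + h)).
Hypothesis iD : forall h, `|h| < del -> Q.-integrable G (EFin \o D (ts + h)).
Hypothesis DF : forall h, `|h| < del ->
  \int[Q]_(x in G) D (ts + h) x = c + \int[Q]_(x in G) F (ts + h) x.
Hypothesis diffF : forall x h, G x -> `|h| < del -> differentiable (F ^~ x) (ts + h).
Hypothesis diffD : forall x h, G x -> `|h| < del -> differentiable (D ^~ x) (ts + h).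
Hypothesis diff2F : forall x i h, G x -> `|h| < del ->
  differentiable (partial i (F ^~ x)) (ts + h).
Hypothesis diff2D : forall x i, G x -> differentiable (partial i (D ^~ x)) ts.
Hypothesis ib1 : Q.-integrable setT (EFin \o b1).
Hypothesis ib2 : Q.-integrable setT (EFin \o b2).
Hypothesis ib3 : Q.-integrable setT (EFin \o b3).
Hypothesis bF : forall x i h, G x -> `|h| < del -> `|dF i h x| <= b1 x.
Hypothesis bD : forall x i h, G x -> `|h| < del -> `|dD i h x| <= b1 x.
Hypothesis bD2 : forall x i h, G x -> `|h| < del -> `|dD i h x| <= b2 x * `|h|.
Hypothesis bFF : forall x i j h, G x -> `|h| < del ->
  `|partial j (partial i (F ^~ x)) (ts + h)| <= b3 x.
Hypothesis ib4 : Q.-integrable setT (EFin \o b4).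
Hypothesis bF2 : forall x i j, G x -> `|dF i 0 x * dF j 0 x| <= b4 x.

Let norm0 : `|0 : 'rV[R]_r| < del. Proof. by rewrite normr0. Qed.

Let norm_e (t : R) i : `|t *: e_ i| <= `|t|.
Proof.
rewrite normrZ ler_piMr//.
by apply: norm_rV_le => // j; rewrite mxE; case: (_ && _); rewrite ?normr1 ?normr0.
Qed.

Let step_lt (dl : R) i k : 0 < dl -> `|(dl / k.+2%:R) *: e_ i| < dl.
Proof.
move=> dl0; rewrite (le_lt_trans (norm_e _ _))// ger0_norm ?divr_ge0 ?(ltW dl0)//.
by rewrite ltr_pdivrMr// ltr_pMr// ltr1n.
Qed.

(** Serves to differentiate an identity between integrals: [q] will be difference quotients of
    integrands with mean zero. *)
Let mean_zero_limit (q : nat -> T -> R) (v b : T -> R) :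
  Q.-integrable setT (EFin \o b) ->
  (forall k, Q.-integrable G (EFin \o q k)) -> (forall k, \int[Q]_(x in G) q k x = 0) ->
  (forall k x, G x -> `|q k x| <= b x) -> (forall x, G x -> q ^~ x @ \oo --> v x) ->
  Q.-integrable G (EFin \o v) /\ \int[Q]_(x in G) v x = 0.
Proof.
move=> ib iq q0 qb qv.
have mq k : measurable_fun G (fun x => (q k x)%:E) by exact: measurable_int (iq k).
have mv : measurable_fun G v.
  by apply: (measurable_fun_cvg (h := q)) => // k; apply/measurable_EFinP; exact: mq.
have [||||iv _ cvI] := @dominated_convergence _ _ _ Q G mG (fun k x => (q k x)%:E)
    (fun x => (v x)%:E) (fun x => (b x)%:E) mq.
- exact/measurable_EFinP.
- by apply: aeW => x Gx; apply: cvg_EFin; [exact: nearW|exact: qv].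
- exact: integrableS ib.
- by apply: aeW => x k Gx /=; rewrite lee_fin; exact: qb.
split => //; rewrite /Rintegral.
have cv : (fun k => \int[Q]_(x in G) (q k x)%:E)%E @ \oo --> (0 : \bar R).
  rewrite [X in X @ _](_ : _ = (fun=> 0%E)); first exact: cvg_cst.
  apply/funext => k; rewrite -[LHS]fineK; last exact: (integrable_fin_num mG (iq k)).
  by have := q0 k; rewrite /Rintegral => ->.
by rewrite (cvg_unique (@ereal_hausdorff R) cvI cv).
Qed.

Let quotient_bound (u : 'rV[R]_r -> R) a (dl b : R) i k : 0 < dl ->
  (forall h, `|h| < dl -> differentiable u (a + h)) ->
  (forall h j, `|h| < dl -> `|partial j u (a + h)| <= b) ->
  `|k.+2%:R / dl * (u (a + (dl / k.+2%:R) *: e_ i) - u a)| <= r%:R * b.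
Proof.
move=> dl0 du bu.
have b0 : 0 <= b by rewrite (le_trans _ (bu 0 i _)) ?normr0.
have k0 : 0 < k.+2%:R / dl by rewrite divr_gt0.
rewrite normrM gtr0_norm// mulrC -ler_pdivlMr//.
rewrite (le_trans (mean_value_bound du bu (step_lt i k dl0)))//.
rewrite invf_div ler_wpM2l ?mulr_ge0// (le_trans (norm_e _ _))//.
by rewrite ger0_norm ?divr_ge0 ?(ltW dl0).
Qed.

(** Differentiates [DF] once under the integral. It is proved on the whole ball because the result
    is differentiated again. *)
Let integral_dDF i h : `|h| < del ->
  Q.-integrable G (EFin \o (fun x => dD i h x - dF i h x)) /\
  \int[Q]_(x in G) (dD i h x - dF i h x) = 0.
Proof.
move=> hd; pose dl := del - `|h|.
have dl0 : 0 < dl by rewrite subr_gt0.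
have hk h' : `|h'| < dl -> `|h + h'| < del.
  by move=> h'l; rewrite (le_lt_trans (ler_normD _ _))// -ltrBrDl.
pose st k : 'rV[R]_r := (dl / k.+2%:R) *: e_ i.
have hst k : `|h + st k| < del by apply: hk; exact: step_lt.
pose q k x := k.+2%:R / dl * ((D (ts + h + st k) x - D (ts + h) x) -
  (F (ts + h + st k) x - F (ts + h) x)).
have iDk k : Q.-integrable G (EFin \o (fun x => D (ts + h + st k) x - D (ts + h) x)).
  by rewrite -addrA; apply: (integrableB mG (iD (hst k)) (iD hd)).
have iFk k : Q.-integrable G (EFin \o (fun x => F (ts + h + st k) x - F (ts + h) x)).
  by rewrite -addrA; apply: (integrableB mG (iF (hst k)) (iF hd)).
have iDFk k := integrableB mG (iDk k) (iFk k).
apply: (@mean_zero_limit q _ (fun x => r%:R * b1 x + r%:R * b1 x)).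
- have ib := integrableZl measurableT r%:R ib1.
  exact: (integrableD measurableT ib ib).
- by move=> k; exact: (integrableZl mG _ (iDFk k)).
- move=> k; rewrite (RintegralZl _ mG (iDFk k)) (RintegralB mG (iDk k) (iFk k)).
  rewrite -addrA (RintegralB mG (iD (hst k)) (iD hd)) (RintegralB mG (iF (hst k)) (iF hd)).
  by rewrite !DF//; ring.
- move=> k x Gx; rewrite /q mulrBr (le_trans (ler_normB _ _))// lerD//.
    apply: (@quotient_bound (D ^~ x)) => // [h' h'l|h' l h'l]; rewrite -addrA.
      by apply: diffD => //; exact: hk.
    by apply: bD => //; exact: hk.
  apply: (@quotient_bound (F ^~ x)) => // [h' h'l|h' l h'l]; rewrite -addrA.
    by apply: diffF => //; exact: hk.
  by apply: bF => //; exact: hk.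
- move=> x Gx; under eq_fun do rewrite /q mulrBr.
  by apply: cvgB; apply: partial_quotient_cvg => //; [exact: diffD|exact: diffF].
Qed.

Let dD0 i x : G x -> dD i 0 x = 0.
Proof.
move=> Gx; apply/eqP; rewrite -normr_le0.
by have := bD2 i Gx norm0; rewrite normr0 mulr0.
Qed.

Let integral_dF i : Q.-integrable G (EFin \o dF i 0) /\ \int[Q]_(x in G) dF i 0 x = 0.
Proof.
have [i0 e0] := integral_dDF i norm0.
have E : {in G, forall x, dD i 0 x - dF i 0 x = - dF i 0 x}.
  by move=> x /set_mem Gx; rewrite dD0// sub0r.
have i1 : Q.-integrable G (EFin \o (fun x => - dF i 0 x)).
  by apply: eq_integrable i0 => // x Gx /=; rewrite E.
have i2 : Q.-integrable G (EFin \o dF i 0).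
  by apply: (eq_integrable mG _ _ _ (integrableN i1)) => x Gx /=; rewrite opprK.
split => //; move: e0; rewrite (eq_Rintegral Q E).
under eq_Rintegral do rewrite -mulN1r.
by rewrite (RintegralZl _ mG i2) mulN1r => /eqP; rewrite oppr_eq0 => /eqP.
Qed.

(** Quotients of the gradient of [F] are dominated through its second derivatives; those of [D]
    directly by [b2], since the gradient of [D] vanishes at [ts] and grows at most linearly. *)
Let integral_ddDF i j :
  Q.-integrable G (EFin \o (fun x => ddD i j x - ddF i j x)) /\
  \int[Q]_(x in G) (ddD i j x - ddF i j x) = 0.
Proof.
pose st k : 'rV[R]_r := (del / k.+2%:R) *: e_ j.
have hst k : `|st k| < del by exact: step_lt.
pose q k x := k.+2%:R / del * ((dD i (st k) x - dF i (st k) x) - (dD i 0 x - dF i 0 x)).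
have qE k x : q k x = k.+2%:R / del * (dD i (st k) x - dD i 0 x) -
    k.+2%:R / del * (dF i (st k) x - dF i 0 x).
  by rewrite /q -mulrBr; congr (_ * _); ring.
have iq k := integrableB mG (integral_dDF i (hst k)).1 (integral_dDF i norm0).1.
apply: (@mean_zero_limit q _ (fun x => b2 x + r%:R * b3 x)).
- exact: (integrableD measurableT ib2 (integrableZl measurableT r%:R ib3)).
- by move=> k; exact: (integrableZl mG _ (iq k)).
- move=> k; rewrite (RintegralZl _ mG (iq k)).
  rewrite (RintegralB mG (integral_dDF i (hst k)).1 (integral_dDF i norm0).1).
  by rewrite (integral_dDF i (hst k)).2 (integral_dDF i norm0).2 subr0 mulr0.
- move=> k x Gx; rewrite qE (le_trans (ler_normB _ _))// lerD//.
    rewrite dD0// subr0 normrM gtr0_norm ?divr_gt0// mulrC -ler_pdivlMr ?divr_gt0//.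
    rewrite (le_trans (bD2 i Gx (hst k)))// invf_div ler_wpM2l//.
      (* [b2 x] is nonnegative because it bounds an absolute value at some nonzero displacement. *)
      have n0 : 0 < `|st 0%N|.
        rewrite /st normrZ mulr_gt0// ?normr_gt0 ?gt_eqF ?divr_gt0//.
        by apply/eqP => /matrixP /(_ ord0 j); rewrite !mxE !eqxx => /eqP; rewrite oner_eq0.
      by rewrite -(pmulr_lge0 _ n0) (le_trans _ (bD2 i Gx (hst 0%N))).
    by rewrite (le_trans (norm_e _ _))// ger0_norm ?divr_ge0 ?(ltW del0).
  rewrite /dF addr0; apply: (@quotient_bound (partial i (F ^~ x))) => // [h|h l].
    exact: diff2F.
  exact: bFF.
- move=> x Gx; under eq_fun do rewrite qE /dF /dD addr0.
  apply: cvgB; apply: partial_quotient_cvg => //; first exact: diff2D.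
  by have := diff2F i Gx norm0; rewrite addr0.
Qed.

Let measurable_dF i h : `|h| < del -> measurable_fun G (dF i h).
Proof.
move=> hd; pose dl := del - `|h|.
have dl0 : 0 < dl by rewrite subr_gt0.
have hk h' : `|h'| < dl -> `|h + h'| < del.
  by move=> h'l; rewrite (le_lt_trans (ler_normD _ _))// -ltrBrDl.
apply: (measurable_fun_cvg (h := fun k x => k.+2%:R / dl *
   (F (ts + h + (dl / k.+2%:R) *: delta_mx ord0 i) x - F (ts + h) x))) => [k|x Gx].
  apply: measurable_funM => //; apply: measurable_funB.
    rewrite -addrA; apply/measurable_EFinP; apply: (@measurable_int _ _ _ Q).
    by apply: iF; apply: hk; exact: step_lt.
  by apply/measurable_EFinP; apply: (@measurable_int _ _ _ Q); exact: iF.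
by apply: partial_quotient_cvg => //; exact: diffF.
Qed.

Let iFF i j : Q.-integrable G (EFin \o (fun x => dF i 0 x * dF j 0 x)).
Proof.
apply: (@le_integrable _ _ _ Q G mG _ (EFin \o b4)).
- apply/measurable_EFinP; apply: measurable_funM; exact: measurable_dF.
- by move=> x Gx /=; rewrite lee_fin (le_trans (bF2 i j Gx))// ler_norm.
- exact: integrableS ib4.
Qed.

Let measurable_ddF i j : measurable_fun G (ddF i j).
Proof.
apply: (measurable_fun_cvg (h := fun k x => k.+2%:R / del *
   (dF i ((del / k.+2%:R) *: delta_mx ord0 j) x - dF i 0 x))) => [k|x Gx].
  apply: measurable_funM => //; apply: measurable_funB; apply: measurable_dF => //.
  exact: step_lt.
rewrite /dF addr0; apply: partial_quotient_cvg => //.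
by have := diff2F i Gx norm0; rewrite addr0.
Qed.

Let integrable_ddF i j : Q.-integrable G (EFin \o ddF i j).
Proof.
apply: (@le_integrable _ _ _ Q G mG _ (EFin \o b3)).
- by apply/measurable_EFinP; exact: measurable_ddF.
- move=> x Gx /=; rewrite lee_fin.
  by have := bFF i j Gx norm0; rewrite addr0 => /le_trans -> //; rewrite ler_norm.
- exact: integrableS ib3.
Qed.

(** Recovered from the difference of the two Hessians and from that of [F], which [b3] dominates. *)
Lemma integrable_hessian i j : Q.-integrable G (EFin \o ddD i j).
Proof.
apply: (eq_integrable mG _ _ _ (integrableD mG (integral_ddDF i j).1 (integrable_ddF i j))).
by move=> x Gx /=; rewrite -EFinD subrK.
Qed.

Let integral_ddF i j : Q.-integrable G (EFin \o ddF i j) /\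
  \int[Q]_(x in G) ddF i j x = \int[Q]_(x in G) ddD i j x.
Proof.
split; first exact: integrable_ddF.
apply/esym/subr0_eq.
by rewrite -(RintegralB mG (integrable_hessian i j) (integrable_ddF i j)) (integral_ddDF i j).2.
Qed.

Let rem i h x := dF i h x - dF i 0 x - \sum_j h ord0 j * ddF i j x.

Let radius n : R := del / n.+2%:R.

Let ratrow (q : {ffun 'I_r -> rat}) : 'rV[R]_r := \row_i ratr (q i).

(* Off [bad e n], which decreases to the empty set, the linearization error is at
   most [e * `|h|] for rational, hence for all, small [h]; on it the error is
   dominated by [b3]. *)
Let bad e n := \bigcup_(qi : {ffun 'I_r -> rat} * 'I_r)
  (if `|ratrow qi.1| < radius n
   then G `&` [set x | e * `|ratrow qi.1| < `|rem qi.2 (ratrow qi.1) x|] else set0).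

Let radius0 n : 0 < radius n. Proof. by rewrite divr_gt0. Qed.

Let radius_del n : radius n < del.
Proof. by rewrite ltr_pdivrMr// ltr_pMr// ltr1n. Qed.

Let measurable_bad e n : measurable (bad e n).
Proof.
apply: countable_bigcupT_measurable => [|[q i]]; first exact: countableP.
case: ifPn => // qn /=.
have mrem : measurable_fun G (fun x => `|rem i (ratrow q) x|).
  apply: measurableT_comp => //; apply: measurable_funB.
    apply: measurable_funB; apply: measurable_dF => //.
    exact: lt_trans qn (radius_del n).
  by apply: measurable_sum => l; apply: measurable_funM => //; exact: measurable_ddF.
rewrite (_ : [set x | _] = (fun x => `|rem i (ratrow q) x|) @^-1` `]e * `|ratrow q|, +oo[).
  exact: mrem.
by apply/seteqP; split => x /=; rewrite in_itv /= andbT.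
Qed.

(** If the bound failed at [h], it would fail on a neighbourhood by continuity, hence at a rational
    row. Countability of the rational rows is what makes [bad] measurable. *)
Let not_bad e n x i h : G x -> ~ bad e n x -> `|h| < radius n -> `|rem i h x| <= e * `|h|.
Proof.
move=> Gx bx hn; rewrite leNgt; apply/negP => lt_rem; apply: bx.
have hd : `|h| < del by exact: lt_trans hn (radius_del n).
have cn : (fun h' : 'rV[R]_r => `|h'|) @ h --> `|h| by exact: norm_continuous.
have dr : differentiable (fun h' => rem i h' x) h.
  apply: differentiableB; first apply: differentiableB => //.
    apply: (@differentiable_comp _ _ _ _ (fun h' : 'rV[R]_r => ts + h')) => //.
    exact: diff2F.
  rewrite (_ : (fun _ => _) = \sum_j (fun h' : 'rV[R]_r => h' ord0 j * ddF i j x)).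
    by apply: differentiable_sum => j; apply: differentiableM => //; exact: differentiable_coord.
  by apply/funext => y; rewrite fct_sumE.
have crem : {for h, continuous (fun h' => `|rem i h' x| - e * `|h'|)}.
  apply: (@continuousB _ _ _ (fun h' => `|rem i h' x|) (fun h' : 'rV[R]_r => e * `|h'|)).
    apply: (@continuous_comp _ _ _ (fun h' => rem i h' x) (fun y : R => `|y|)).
      exact: differentiable_continuous.
    exact: norm_continuous.
  apply: (@continuousM _ _ (fun=> e) (fun h' : 'rV[R]_r => `|h'|)).
    exact: cst_continuous.
  exact: norm_continuous.
rewrite -subr_gt0 in lt_rem.
have [q /= [hq1 hq2]] := ratr_row_dense (filterI (cvgr_lt _ cn _ hn) (cvgr_gt _ crem _ lt_rem)).
exists (q, i) => //=.
by rewrite (_ : (_ < _) = true)//; split => //=; rewrite -subr_gt0.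
Qed.

(** At a fixed [x] this is the differentiability of the gradient of [F] at [ts]. *)
Let near_not_bad e x : 0 < e -> G x -> \forall n \near \oo, ~ bad e n x.
Proof.
move=> e0 Gx.
have : \forall n \near \oo, forall i h, `|h| < radius n -> `|rem i h x| <= e * `|h|.
  apply: filter_forall => i.
  have d0 : differentiable (partial i (F ^~ x)) ts.
    by have := diff2F i Gx norm0; rewrite addr0.
  have [dl dl0 hdl] := differentiable_small_o d0 e0.
  near=> n; move=> h hn; rewrite /rem /dF addr0; apply: hdl.
  rewrite ltW// (lt_le_trans hn)// /radius ler_pdivrMr// mulrC -ler_pdivrMr//.
  apply: (@le_trans _ _ n%:R); last by rewrite ler_nat ltnW// ltnW.
  by near: n; exact: nbhs_infty_ger.
apply: filterS => n hn [[q i] _] /=; case: ifPn => // qn [_] /=.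
by apply/negP; rewrite -leNgt; exact: hn.
Unshelve. all: by end_near. Qed.

Let bad_sub e n : bad e n `<=` G.
Proof. by move=> x [[q i] _] /=; case: ifPn => // _ []. Qed.

Let small_bad e eta : 0 < e -> 0 < eta -> exists n,
  (\int[Q]_x (`|b3 x| * \1_(bad e n) x)%:E <= eta%:E)%E.
Proof.
move=> e0 eta0.
have mb3 : measurable_fun setT b3 by apply/measurable_EFinP; exact: measurable_int ib3.
have mf n : measurable_fun setT (fun x => (`|b3 x| * \1_(bad e n) x)%:E).
  apply/measurable_EFinP; apply: measurable_funM; first exact: measurableT_comp.
  exact: measurable_indic.
have h2 : {ae Q, forall x, setT x -> (`|b3 x| * \1_(bad e n) x)%:E @[n --> \oo] --> 0%E}.
  apply: aeW => x _; apply/fine_cvgP; split; first exact: nearW.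
  apply: (@cvg_near_cst _ R^o).
  case: (pselect (G x)) => [Gx|Gx].
    by apply: filterS (near_not_bad e0 Gx) => n nb /=; rewrite indicE memNset// mulr0.
  by apply: nearW => n /=; rewrite indicE memNset ?mulr0// => /bad_sub.
have h3 : {ae Q, forall x n, setT x ->
    (`|(`|b3 x| * \1_(bad e n) x)%:E| <= (`|b3 x|)%:E)%E}.
  apply: aeW => x n _; rewrite /= lee_fin normrM normr_id ler_piMr//.
  by rewrite indicE; case: (x \in _); rewrite ?normr1 ?normr0.
have [_ _ cv] := dominated_convergence measurableT mf (measurable_cst 0%E) h2
  (integrable_norm ib3) h3.
rewrite integral0 in cv; move/fine_cvgP: cv => [fin cv].
have [n _ /(_ n (leqnn n)) [fn hn]] := filterI fin (cvgr_lt _ cv _ eta0).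
by exists n; rewrite -[leLHS]fineK// lee_fin ltW.
Qed.

Let restr (f : T -> R) := f \_ G.

Let restrE f x : G x -> restr f x = f x.
Proof. by move=> Gx; rewrite /restr patchE mem_set. Qed.

Let integral_restr f : Q.-integrable G (EFin \o f) ->
  Q.-integrable setT (EFin \o restr f) /\ \int[Q]_x restr f x = \int[Q]_(x in G) f x.
Proof.
move=> fi; split; last by rewrite [RHS]Rintegral_mkcond.
rewrite /restr -restrict_EFin; exact: (integrable_mkcond _ mG).1.
Qed.

(** Almost surely no observation ever leaves [G], by a countable union of null events; one event
    serves all [k]. *)
Lemma whp_good : whp Pr (fun k => [set w | forall i : 'I_k, G (X i w)]).
Proof.
have null i : Pr (X i @^-1` (~` G)) = 0%E.
  exact: (etrans (iidX.2 i _ (measurableC mG)) QG).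
have : Pr.-negligible (\bigcup_i (X i @^-1` (~` G))).
  apply: negligible_bigcup => i; exists (X i @^-1` (~` G)); split => //; last exact: null.
  rewrite -[X in measurable X]setTI; apply: measurable_funP => //; exact: measurableC.
move=> [A [mA A0 subA]] e e0; apply: nearW => k; exists A; split => //.
  by rewrite A0 lee_fin ltW.
by move=> w Aw i; apply: contrapT => nG; apply: Aw; apply: subA; exists (i : nat).
Qed.

Variable h_ : nat -> Omega -> 'rV[R]_r.
Hypothesis mh : forall k, measurable_fun setT (h_ k).
Hypothesis h_small : forall dlt : R, 0 < dlt -> whp Pr (fun k => [set w | `|h_ k w| <= dlt]).
Hypothesis h_min : whp Pr (fun k => [set w | forall h, `|h| < del ->
  \sum_(i < k) F (ts + h_ k w) (X i w) <= \sum_(i < k) F (ts + h) (X i w)]).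

(** The index order suits row vectors: the [i]-th coordinate of [h *m Gam] is the derivative along
    [h] of the [i]-th partial derivative, averaged over [G]. *)
Let Gam : 'M[R]_r := \matrix_(j, i) \int[Q]_(x in G) ddD i j x.
Let S : 'M[R]_r := \matrix_(i, j) \int[Q]_(x in G) (dF i 0 x * dF j 0 x).

Theorem m_estimator_normal : Gam \in unitmx -> exists nu : probability 'rV[R]_r R,
  is_multivariate_normal nu 0 ((invmx Gam)^T *m S *m invmx Gam) /\
  cvg_in_distribution Pr (fun k w => Num.sqrt k%:R *: h_ k w) nu.
Proof.
move=> uGam.
pose phi x : 'rV[R]_r := \row_i restr (dF i 0) x.
pose H x : 'M[R]_r := \matrix_(j, i) restr (ddF i j) x.
pose Psi h x : 'rV[R]_r := \row_i dF i h x.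
have phiE i x : phi x ord0 i = restr (dF i 0) x by rewrite mxE.
have phi2E i j x : phi x ord0 i * phi x ord0 j = restr (fun x => dF i 0 x * dF j 0 x) x.
  rewrite !phiE /restr !patchE; case: ifPn => //.
  by rewrite /point /= mul0r.
have mphi : measurable_fun setT phi.
  apply: measurable_rV => // i; under eq_fun do rewrite phiE.
  by apply/(measurable_restrictT _ mG)/measurable_dF.
have iphi i : Q.-integrable setT (EFin \o (fun x => phi x ord0 i)).
  rewrite (_ : (fun x => phi x ord0 i) = restr (dF i 0)); last exact/funext.
  exact: (integral_restr (integral_dF i).1).1.
have phi0 i : \int[Q]_x (phi x ord0 i) = 0.
  under eq_Rintegral do rewrite phiE.
  by rewrite (integral_restr (integral_dF i).1).2 (integral_dF i).2.
have iphi2 i j : Q.-integrable setT (EFin \o (fun x => phi x ord0 i * phi x ord0 j)).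
  rewrite (_ : (fun x => _ * _) = restr (fun x => dF i 0 x * dF j 0 x)); last exact/funext.
  exact: (integral_restr (iFF i j)).1.
have mH i j : measurable_fun setT (fun x => H x i j).
  under eq_fun do rewrite mxE.
  by apply/(measurable_restrictT _ mG)/measurable_ddF.
have iH i j : Q.-integrable setT (EFin \o (fun x => H x i j)).
  rewrite (_ : (fun x => _) = restr (ddF j i)); last by apply/funext => x; rewrite mxE.
  exact: (integral_restr (integral_ddF j i).1).1.
have EH i j : \int[Q]_x H x i j = Gam i j.
  under eq_Rintegral do rewrite mxE.
  rewrite [RHS]mxE.
  exact: (etrans (integral_restr (integral_ddF j i).1).2 (integral_ddF j i).2).
have lin (e : R) : 0 < e -> exists2 dlt : R, 0 < dlt &
  exists rho : T -> R, [/\ measurable_fun setT rho, forall x, 0 <= rho x,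
    (\int[Q]_x (rho x)%:E <= e%:E)%E &
    forall x h, G x -> `|h| <= dlt -> `|Psi h x - phi x - h *m H x| <= rho x * `|h|].
  move=> e0; have e2 : 0 < e / 2 by rewrite divr_gt0.
  (* On the bad set, each of the two parts of the error is at most [r * b3 x] times the norm of [h];
     the [+ 1] keeps [K] positive for [r = 0]. *)
  pose K : R := 2 * r%:R + 1; have K0 : 0 < K by rewrite ltr_wpDl// mulr_ge0.
  have eta0 : 0 < e / 2 / K by rewrite divr_gt0.
  have [n hn] := small_bad e2 eta0.
  exists (radius n / 2); first by rewrite divr_gt0.
  pose f x := `|b3 x| * \1_(bad (e / 2) n) x.
  have f0 x : 0 <= f x by rewrite mulr_ge0.
  have mf : measurable_fun setT f.
    apply: measurable_funM; last exact: measurable_indic.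
    apply: measurableT_comp => //; apply/measurable_EFinP; exact: measurable_int ib3.
  exists (fun x => K * f x + e / 2); split.
  - by apply: measurable_funD => //; exact: measurable_funM.
  - by move=> x; rewrite addr_ge0 ?mulr_ge0// ltW.
  - under eq_integral do rewrite EFinD.
    rewrite ge0_integralD//; first last.
    + by move=> x _; rewrite lee_fin ltW.
    + by apply/measurable_EFinP; exact: measurable_funM.
    + by move=> x _; rewrite lee_fin mulr_ge0// ltW.
    rewrite integral_probability_cst [X in (_ <= X%:E)%E](splitr e) EFinD leeD//.
    under eq_integral do rewrite EFinM.
    rewrite ge0_integralZl//; first last.
    + by rewrite lee_fin ltW.
    + by move=> x _; rewrite lee_fin.
    + exact/measurable_EFinP.
    rewrite (@le_trans _ _ (K%:E * (e / 2 / K)%:E)%E)//.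
      by apply: lee_wpmul2l => //; rewrite lee_fin ltW.
    by rewrite -EFinM lee_fin mulrC divfK ?gt_eqF.
  move=> x h Gx hh.
  have hr : `|h| < radius n.
    by rewrite (le_lt_trans hh)// ltr_pdivrMr// ltr_pMr// ltr1n.
  have hd : `|h| < del by exact: lt_trans hr (radius_del n).
  (* For [r = 0] there is no index at which [bFF] would show [b3 x] to be nonnegative. *)
  have b30 : 0 <= r%:R * b3 x.
    have [->|r0] := eqVneq r 0%N; first by rewrite mul0r.
    have i0 : 'I_r by apply: (@Ordinal r 0); rewrite lt0n.
    rewrite mulr_ge0// (le_trans _ (bFF i0 i0 Gx norm0))//.
  apply: norm_rV_le => [|i]; first by rewrite mulr_ge0// addr_ge0 ?mulr_ge0// ltW.
  have -> : (Psi h x - phi x - h *m H x) ord0 i = rem i h x.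
    rewrite !mxE restrE// /rem; congr (_ - _); apply: eq_bigr => j _.
    by rewrite mxE restrE.
  have [bx|bx] := pselect (bad (e / 2) n x); last first.
    rewrite (le_trans (not_bad i Gx bx hr))// ler_wpM2r// lerDr mulr_ge0// ltW//.
  rewrite /rem (le_trans (ler_normB _ _))//.
  have h1 : `|dF i h x - dF i 0 x| <= r%:R * b3 x * `|h|.
    rewrite /dF addr0; apply: (@mean_value_bound _ _ (partial i (F ^~ x)) _ del) => //.
      by move=> h' h'd; exact: diff2F.
    by move=> h' j h'd; exact: bFF.
  have h2 : `|\sum_j h ord0 j * ddF i j x| <= r%:R * b3 x * `|h|.
    rewrite (le_trans (ler_norm_sum _ _ _))//.
    apply: (@le_trans _ _ (\sum_(j < r) b3 x * `|h|)).
      apply: ler_sum => j _; rewrite normrM mulrC ler_pM// ?coord_le_norm//.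
      by have := bFF i j Gx norm0; rewrite addr0.
    by rewrite sumr_const card_ord -[_ *+ r]mulr_natl mulrA.
  rewrite (le_trans (lerD h1 h2))// -mulrDl ler_wpM2r//.
  rewrite /f indicE mem_set// mulr1.
  have := ler_norm (b3 x); have := normr_ge0 (b3 x); have : 0 <= r%:R :> R by [].
  rewrite /K; set b := b3 x; nra.
(* With high probability the estimator is an interior minimum of the empirical loss, hence a zero of
   its gradient. *)
have zero : whp Pr (fun k => [set w |
    (forall i : 'I_k, G (X i w)) /\ \sum_(i < k) Psi (h_ k w) (X i w) = 0]).
  have del2 : 0 < del / 2 by rewrite divr_gt0.
  apply: whpS (whpI whp_good (whpI (h_small del2) h_min)).
  apply: nearW => k w /= [Gw [hw mw]]; split => //.
  have hd : `|h_ k w| < del by rewrite (le_lt_trans hw)// ltr_pdivrMr// ltr_pMr// ltr1n.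
  apply/rowP => i; rewrite summxE [RHS]mxE.
  have hk h' : `|h'| < del - `|h_ k w| -> `|h_ k w + h'| < del.
    by move=> h'l; rewrite (le_lt_trans (ler_normD _ _))// -ltrBrDl.
  pose u := \sum_(j < k) (F ^~ (X j w)).
  have uE a : u a = \sum_(j < k) F a (X j w) by rewrite /u fct_sumE.
  have := @partial_at_min _ _ u (ts + h_ k w) i (del - `|h_ k w|).
  rewrite subr_gt0 => /(_ hd) um.
  rewrite -[RHS]um => [|h' /hk h'd|h' /hk h'd].
  - rewrite /partial derive_sum => [|j].
      by apply: eq_bigr => j _; rewrite mxE.
    by apply: diff_derivable; exact: diffF.
  - by rewrite -addrA; apply: differentiable_sum => j; exact: diffF.
  - by rewrite -addrA !uE; exact: mw.
have [nu [Nnu cv]] := zestimator_normal iidX mphi iphi phi0 iphi2 mH iH EH uGam lin mh h_small zero.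
have SE : S = cov_matrix Q phi.
  apply/matrixP => i j; rewrite !mxE.
  under [RHS]eq_Rintegral do rewrite phi2E.
  by rewrite (integral_restr (iFF i j)).2.
by exists nu; rewrite SE; split; [exact: Nnu|exact: cv].
Qed.

End MEstimator.

(** * The diffusion score matching loss *)

Section ConullIntegral.
Context {d} {T : measurableType d} {R : realType} (mu : {measure set T -> \bar R}).
Variables (D G : set T) (mG : measurable G) (GD : G `<=` D) (nG : mu (~` G) = 0%E).
Import HBNNSimple.

(* The integral of a nonnegative function, measurable or not, is the supremum of
   the integrals of the simple functions below it. *)
Let ge0_integral_conull (f : T -> \bar R) : (forall x, 0 <= f x)%E ->
  (\int[mu]_(x in D) f x = \int[mu]_(x in G) f x)%E.
Proof.
move=> f0; rewrite !ge0_integralE//; apply/eqP; rewrite eq_le; apply/andP; split.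
  apply: ge_ereal_sup => _ [h /= hf <-].
  pose h' := mul_nnsfun h (indic_nnsfun R mG).
  have h'E x : h' x = h x * \1_G x by [].
  have -> : sintegral mu h = sintegral mu h'.
    rewrite -!integralT_nnsfun; apply: ae_eq_integral => //.
    - by apply/measurable_EFinP; exact: measurable_funP.
    - by apply/measurable_EFinP; exact: measurable_funP.
    exists (~` G); split => //; first exact: measurableC.
    move=> x /= hx Gx; apply: hx => _.
    have hE : h' x = h x by rewrite h'E indicE mem_set// mulr1.
    exact: (congr1 EFin (esym hE)).
  apply: ereal_sup_ubound; exists h' => // x; rewrite h'E.
  have := hf x; rewrite !patchE indicE.
  have [Gx|Gx] := boolP (x \in G); last by rewrite mulr0.
  by rewrite mem_set ?mulr1//; apply: GD; exact: set_mem.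
apply: le_ereal_sup => _ [h /= hf <-]; exists h => // x.
rewrite (le_trans (hf x))// !patchE.
case: (boolP (x \in G)) => [/set_mem Gx|_]; first by rewrite mem_set//; exact: GD.
by case: ifP.
Qed.

(** Valid for arbitrary [f], so that the integrals over [X] in the hypotheses can be moved to the
    good set before anything is known about their integrands. *)
Lemma integral_conull (f : T -> \bar R) :
  (\int[mu]_(x in D) f x = \int[mu]_(x in G) f x)%E.
Proof.
by rewrite integralE [RHS]integralE !ge0_integral_conull.
Qed.

End ConullIntegral.

(** * Losses quadratic in the score, and their derivatives in theta *)

Section QuadraticLoss.
Context {R : realType} {r d : nat}.
Implicit Types (u v : 'rV[R]_r -> R) (t : 'rV[R]_r).

Lemma near_eq_differentiable (V W : normedModType R) (f g : V -> W) (x : V) :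
  (\near x, f x = g x) -> differentiable f x -> differentiable g x.
Proof.
move=> fg df; have fx := nbhs_singleton fg; have [cf ef] := (diff_locallyP _ _).1 df.
have eg : g \o shift x = cst (g x) + 'd f x +o_ 0 id.
  apply/eqaddoP => e e0; move/eqaddoP: ef => /(_ e e0).
  have : \forall h \near (0 : V), f (h + x) = g (h + x).
    move/nbhs_ballP : fg => [dl /= dl0 hdl]; apply/nbhs_ballP; exists dl => //= h hh.
    apply: hdl; move: hh; rewrite -!ball_normE /= sub0r normrN.
    by rewrite opprD addrCA subrr addr0 normrN.
  apply: filterS2 => h hE /=.
  by rewrite !fctE /= hE fx.
by apply/diff_locallyP; rewrite (diff_unique cf eg).
Qed.

Lemma partial_subr i u (c : R) t : partial i (fun t => u t - c) t = partial i u t.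
Proof.
rewrite /partial /derive.
have -> // : (fun h : R => h^-1 *: (((fun t => u t - c) \o shift t) (h *: delta_mx ord0 i) -
   (u t - c))) = (fun h : R => h^-1 *: ((u \o shift t) (h *: delta_mx ord0 i) - u t)).
by apply/funext => h /=; rewrite opprB addrA subrK.
Qed.

Lemma is_derive_sum_fin (I : finType) (f : I -> 'rV[R]_r -> R) (df : I -> R) t w :
  (forall i, is_derive t w (f i) (df i)) ->
  is_derive t w (fun t => \sum_i f i t) (\sum_i df i).
Proof.
move=> h; rewrite (_ : (fun t => _) = \sum_i f i); last first.
  by apply/funext => x; rewrite fct_sumE.
elim/big_ind2 : _; [exact: is_derive_cst|by move=> *; exact: is_deriveD|by []].
Qed.

Lemma differentiable_sum_fin (I : finType) (f : I -> 'rV[R]_r -> R) t :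
  (forall i, differentiable (f i) t) -> differentiable (fun t => \sum_i f i t) t.
Proof.
move=> h; rewrite (_ : (fun t => _) = \sum_i f i); last first.
  by apply/funext => x; rewrite fct_sumE.
elim/big_ind : _; [exact: differentiable_cst|by move=> *; exact: differentiableD|by []].
Qed.

Variables (a : 'I_d * 'I_d -> R) (b : 'I_d -> R).
Variables (s : 'I_d -> 'rV[R]_r -> R) (h : 'I_d * 'I_d -> 'rV[R]_r -> R).

(** The common shape of both losses at a fixed [x]: F has [a = m m^T], [b] its divergence, [s] the
    score and [h] the Hessian of [log p] in [x]; D has [b = h = 0] and the centred score as [s]. *)
Definition qloss t : R :=
  \sum_p a p * (s p.1 t * s p.2 t + 2 * h p t) + \sum_k 2 * b k * s k t.

Definition qloss1 i t : R :=
  \sum_p a p * (s p.1 t * partial i (s p.2) t + s p.2 t * partial i (s p.1) t +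
    2 * partial i (h p) t) + \sum_k 2 * b k * partial i (s k) t.

Definition qloss2 i j t : R :=
  \sum_p a p * (s p.1 t * partial j (partial i (s p.2)) t +
      partial i (s p.2) t * partial j (s p.1) t +
      (s p.2 t * partial j (partial i (s p.1)) t +
      partial i (s p.1) t * partial j (s p.2) t) +
    2 * partial j (partial i (h p)) t) + \sum_k 2 * b k * partial j (partial i (s k)) t.

Section At.
Variable t : 'rV[R]_r.
Hypothesis ds : forall k, differentiable (s k) t.
Hypothesis dh : forall p, differentiable (h p) t.

Let Ds k i : is_derive t (delta_mx ord0 i) (s k) (partial i (s k) t).
Proof. by apply: derivableP; exact: diff_derivable. Qed.
Let Dh p i : is_derive t (delta_mx ord0 i) (h p) (partial i (h p) t).
Proof. by apply: derivableP; exact: diff_derivable. Qed.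

Lemma differentiable_qloss : differentiable qloss t.
Proof.
apply: differentiableD; apply: differentiable_sum_fin => p.
  apply: differentiableM => //; apply: differentiableD; first exact: differentiableM.
  exact: differentiableM.
exact: differentiableM.
Qed.

Lemma partial_qloss i : partial i qloss t = qloss1 i t.
Proof.
suff [_ ] : is_derive t (delta_mx ord0 i) qloss (qloss1 i t) by [].
apply: is_deriveD; apply: is_derive_sum_fin => p.
  apply: is_deriveZ; apply: is_deriveD; last exact: is_deriveZ.
  exact: is_deriveM.
exact: is_deriveZ.
Qed.

Variable i : 'I_r.
Hypothesis dds : forall k, differentiable (partial i (s k)) t.
Hypothesis ddh : forall p, differentiable (partial i (h p)) t.

Let DDs k j : is_derive t (delta_mx ord0 j) (partial i (s k)) (partial j (partial i (s k)) t).
Proof. by apply: derivableP; exact: diff_derivable. Qed.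
Let DDh p j : is_derive t (delta_mx ord0 j) (partial i (h p)) (partial j (partial i (h p)) t).
Proof. by apply: derivableP; exact: diff_derivable. Qed.

Lemma differentiable_qloss1 : differentiable (qloss1 i) t.
Proof.
apply: differentiableD; apply: differentiable_sum_fin => p.
  apply: differentiableM => //; apply: differentiableD; last exact: differentiableM.
  by apply: differentiableD; exact: differentiableM.
exact: differentiableM.
Qed.

Lemma partial_qloss1 j : partial j (qloss1 i) t = qloss2 i j t.
Proof.
suff [_ ] : is_derive t (delta_mx ord0 j) (qloss1 i) (qloss2 i j t) by [].
apply: is_deriveD; apply: is_derive_sum_fin => p.
  apply: is_deriveZ; apply: is_deriveD; last exact: is_deriveZ.
  by apply: is_deriveD; exact: is_deriveM.
exact: is_deriveZ.
Qed.

End At.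

Section Ball.
Variables (ts : 'rV[R]_r) (del : R).
Hypothesis ds : forall k h, `|h| < del -> differentiable (s k) (ts + h).
Hypothesis dh : forall p h', `|h'| < del -> differentiable (h p) (ts + h').
Hypothesis dds : forall k i h, `|h| < del -> differentiable (partial i (s k)) (ts + h).
Hypothesis ddh : forall p i h', `|h'| < del -> differentiable (partial i (h p)) (ts + h').

(** The formula for the first derivative is needed on a neighbourhood, since it is differentiated
    again. *)
Lemma near_partial_qloss i h' : `|h'| < del ->
  \forall t \near (ts + h'), qloss1 i t = partial i qloss t.
Proof.
move=> h'd; apply/nbhs_ballP; exists (del - `|h'|); first by rewrite /= subr_gt0.
move=> t; rewrite -ball_normE /= => ht.
have td : `|t - ts| < del.
  rewrite (_ : t - ts = h' - (ts + h' - t)); last first.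
    by rewrite opprB addrCA opprD (addrC (- ts)) addNKr.
  by rewrite (le_lt_trans (ler_normB _ _))// -ltrBrDl.
rewrite partial_qloss// => k; rewrite -[t](subrK ts) addrC; [exact: ds|exact: dh].
Qed.

Lemma differentiable_partial_qloss i h' : `|h'| < del ->
  differentiable (partial i qloss) (ts + h').
Proof.
move=> h'd; apply: (near_eq_differentiable (near_partial_qloss i h'd)).
apply: differentiable_qloss1 => k; [exact: ds|exact: dds|exact: ddh].
Qed.

Lemma partial_partial_qloss i j h' : `|h'| < del ->
  partial j (partial i qloss) (ts + h') = qloss2 i j (ts + h').
Proof.
move=> h'd; rewrite -partial_qloss1 => [|k|k|k]; last first.
- exact: ddh.
- exact: dds.
- exact: ds.
by rewrite {1}/partial -(near_eq_derive _ (near_partial_qloss i h'd)).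
Qed.

End Ball.

End QuadraticLoss.

Section DsmLoss.
Context {R : realType} {d : nat}.
Variable m : 'rV[R]_d -> 'M[R]_d.

Lemma dotcC (u v : 'cV[R]_d) : dotc u v = dotc v u.
Proof. by apply: eq_bigr => k _; exact: mulrC. Qed.

Lemma dotc_diffusion x (u v : 'cV[R]_d) : dotc ((m x)^T *m u) ((m x)^T *m v) =
  \sum_p diffusion m x p.1 p.2 * (u p.1 ord0 * v p.2 ord0).
Proof.
rewrite -(pair_bigA _ (fun j k => diffusion m x j k * (u j ord0 * v k ord0))) /=.
rewrite /dotc (eq_bigr (fun i => \sum_j \sum_k (m x j i * m x k i) * (u j ord0 * v k ord0))).
  rewrite exchange_big; apply: eq_bigr => j _; rewrite exchange_big; apply: eq_bigr => k _ /=.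
  rewrite /diffusion mxE mulr_suml; apply: eq_bigr => i _; by rewrite mxE.
move=> i _; rewrite !mxE mulr_suml; apply: eq_bigr => j _.
by rewrite mulr_sumr; apply: eq_bigr => k _; rewrite !mxE; ring.
Qed.

(** The product rule for the divergence of [A s], with [A = m m^T], separates the derivatives of [A]
    from those of [log p]; only the latter depend on theta. *)
Lemma dsm_lossE (p : 'rV[R]_d -> R) x :
  (forall i j, differentiable (fun y => diffusion m y i j) x) ->
  twice_differentiable (fun y => ln (p y)) x ->
  dsm_loss m p x =
  \sum_q diffusion m x q.1 q.2 *
    (partial q.1 (fun y => ln (p y)) x * partial q.2 (fun y => ln (p y)) x +
     2 * partial q.1 (partial q.2 (fun y => ln (p y))) x) +
  \sum_k 2 * div_mx (diffusion m) x k ord0 * partial k (fun y => ln (p y)) x.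
Proof.
move=> da [_ ds].
rewrite /dsm_loss dotc_diffusion.
have scoreE k y : score p y k ord0 = partial k (fun y => ln (p y)) y by rewrite /score mxE.
under eq_bigr do rewrite !scoreE.
have divE : div_vec (fun y => diffusion m y *m score p y) x =
  \sum_j \sum_k (diffusion m x j k * partial j (partial k (fun y => ln (p y))) x +
    partial j (fun y => diffusion m y j k) x * partial k (fun y => ln (p y)) x).
  apply: eq_bigr => j _; apply: (@derive_val _ _ _ _ _ _ _).
  rewrite (_ : (fun y => _) =
    (fun y => \sum_k diffusion m y j k * partial k (fun y => ln (p y)) y)); last first.
    by apply/funext => y; rewrite mxE; apply: eq_bigr => k _; rewrite scoreE.
  apply: is_derive_sum_fin => k; rewrite [X in is_derive _ _ _ (_ + X)]mulrC.
  by apply: is_deriveM; apply: derivableP; apply: diff_derivable.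
rewrite divE; under [X in _ + 2 * X]eq_bigr do rewrite big_split.
rewrite [X in _ + 2 * X]big_split /= mulrDr addrA; congr (_ + _).
  rewrite pair_big /= mulr_sumr -big_split /=; apply: eq_bigr => q _.
  by rewrite [RHS]mulrDr; congr (_ + _); exact: mulrCA.
rewrite exchange_big mulr_sumr; apply: eq_bigr => k _.
by rewrite /div_mx mxE -mulr_suml mulrA.
Qed.

(** The function is cut off outside [X], so that its difference quotients are measurable on the
    whole space; as [X] is open, the cut changes no derivative at its points. *)
Lemma measurable_partial (X : set 'rV[R]_d) (f : 'rV[R]_d -> R) i : open X ->
  (forall x, X x -> differentiable f x) -> measurable_fun X (partial i f).
Proof.
move=> oX df; have mX : measurable X by exact: sub_sigma_algebra.
have mf : measurable_fun X f.
  by apply: open_continuous_measurable_Rn => // x Xx; apply: differentiable_continuous; exact: df.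
pose g := f \_ X.
have mg : measurable_fun setT g by apply/(measurable_restrictT _ mX).
have fg x : X x -> \near x, f x = g x.
  move=> Xx; have : nbhs x X by exact: open_nbhs_nbhs.
  by apply: filterS => y Xy; rewrite /g patchE mem_set.
apply: (@eq_measurable_fun _ _ _ _ _ (partial i g)).
  by move=> x /set_mem Xx; apply/esym; exact: near_eq_derive (fg x Xx).
apply: (@measurable_fun_cvg _ _ R _ (fun k (x : 'rV[R]_d) => k.+2%:R / 1 *
  (g (x + (1 / k.+2%:R) *: delta_mx ord0 i) - g x))) => [k|x Xx].
  apply: measurable_funM => //; apply: measurable_funB; last exact: measurable_funTS.
  apply: (measurableT_comp mg); apply: measurable_rVD => //; exact: measurable_id.
apply: partial_quotient_cvg => //.
exact: near_eq_differentiable (fg x Xx) (df x Xx).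
Qed.

End DsmLoss.

Section QuadraticLossBounds.
Context {R : realType} {r d : nat}.

Lemma coord_le_l2norm (I : finType) (a : I -> R) i : `|a i| <= l2norm a.
Proof.
rewrite -sqrtr_sqr ler_wsqrtr// (bigD1 i)//= lerDl.
by apply: sumr_ge0 => j _; exact: sqr_ge0.
Qed.

Lemma l2norm_ge0 (I : finType) (a : I -> R) : 0 <= l2norm a.
Proof. exact: sqrtr_ge0. Qed.

Let n2 := #|{: 'I_d * 'I_d}|.
(** There are [n2 = d^2] terms with a factor [a] and [d] with a factor [b]; 6 counts the four
    products and the factor 2 in a term of [qloss2]. *)
Definition loss_const : R := (6 * (n2 + d))%:R.

Let bound (a c : 'I_d * 'I_d -> R) (b e : 'I_d -> R) (f C E : R) :
  (forall p, `|a p| <= f) -> (forall p, `|c p| <= C) -> (forall k, `|b k * e k| <= f * E) ->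
  `|\sum_p a p * c p + \sum_k 2 * b k * e k| <= n2%:R * (f * C) + d%:R * (2 * (f * E)).
Proof.
move=> af cC be; rewrite (le_trans (ler_normD _ _))// lerD// (le_trans (ler_norm_sum _ _ _))//.
  apply: (@le_trans _ _ (\sum_(p : 'I_d * 'I_d) f * C)).
    by apply: ler_sum => p _; rewrite normrM ler_pM.
  by rewrite sumr_const -[_ *+ _]mulr_natl.
apply: (@le_trans _ _ (\sum_(k < d) 2 * (f * E))).
  by apply: ler_sum => k _; rewrite -mulrA normrM ger0_norm// ler_wpM2l.
by rewrite sumr_const card_ord -[_ *+ _]mulr_natl.
Qed.

Variables (a : 'I_d * 'I_d -> R) (b : 'I_d -> R).
Variables (s : 'I_d -> 'rV[R]_r -> R) (h : 'I_d * 'I_d -> 'rV[R]_r -> R).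
Variables (f1 f2 g1 : R) (t : 'rV[R]_r).
Hypothesis ab_f1 : l2norm a + l2norm b <= f1.
Hypothesis s_f2 : l2norm (fun k => s k t) + l2norm (fun k => nabla s k t) +
  l2norm (fun k => nabla h k t) <= f2.
Hypothesis s_g1 : l2norm (fun k => nabla s k t) ^+ 2 +
  l2norm (fun k => s k t) * l2norm (fun k => nabla (nabla s) k t) +
  l2norm (fun k => nabla (nabla s) k t) + l2norm (fun k => nabla (nabla h) k t) <= g1.

Let af p : `|a p| <= f1.
Proof. by rewrite (le_trans (coord_le_l2norm a p))// (le_trans _ ab_f1)// lerDl l2norm_ge0. Qed.

Let bf k : `|b k| <= f1.
Proof. by rewrite (le_trans (coord_le_l2norm b k))// (le_trans _ ab_f1)// lerDr l2norm_ge0. Qed.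

Lemma loss_f1_ge0 : 0 <= f1.
Proof. by rewrite (le_trans _ ab_f1)// addr_ge0// l2norm_ge0. Qed.

Lemma loss_f2_ge0 : 0 <= f2.
Proof. by rewrite (le_trans _ s_f2)// !addr_ge0// l2norm_ge0. Qed.

Lemma loss_g1_ge0 : 0 <= g1.
Proof. by rewrite (le_trans _ s_g1)// !addr_ge0 ?sqr_ge0 ?mulr_ge0 ?l2norm_ge0. Qed.

Let N2 := l2norm_ge0 (fun k => s k t).
Let N3 := l2norm_ge0 (fun k => nabla s k t).
Let N4 := l2norm_ge0 (fun k => nabla h k t).
Let N5 := l2norm_ge0 (fun k => nabla (nabla s) k t).
Let N6 := l2norm_ge0 (fun k => nabla (nabla h) k t).

Lemma loss_s_le k : `|s k t| <= f2.
Proof.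
rewrite (le_trans (coord_le_l2norm (fun k => s k t) k))//.
by move: N3 N4 s_f2; lra.
Qed.

Lemma loss_ds_le i k : `|partial i (s k) t| <= f2.
Proof.
rewrite (le_trans (coord_le_l2norm (fun k => nabla s k t) (i, k)))//.
by move: N2 N4 s_f2; lra.
Qed.

Let dh_le i p : `|partial i (h p) t| <= f2.
Proof.
rewrite (le_trans (coord_le_l2norm (fun k => nabla h k t) (i, p)))//.
by move: N2 N3 s_f2; lra.
Qed.

Let dds_le i j k : `|partial j (partial i (s k)) t| <= g1.
Proof.
rewrite (le_trans (coord_le_l2norm (fun k => nabla (nabla s) k t) (j, (i, k))))//.
by move: (mulr_ge0 N2 N5) (sqr_ge0 (l2norm (fun k => nabla s k t))) N6 s_g1; lra.
Qed.

Let ddh_le i j p : `|partial j (partial i (h p)) t| <= g1.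
Proof.
rewrite (le_trans (coord_le_l2norm (fun k => nabla (nabla h) k t) (j, (i, p))))//.
by move: (mulr_ge0 N2 N5) (sqr_ge0 (l2norm (fun k => nabla s k t))) N5 s_g1; lra.
Qed.

Let dsds_le i j k l : `|partial i (s k) t * partial j (s l) t| <= g1.
Proof.
have h1 := coord_le_l2norm (fun k => nabla s k t) (i, k).
have h2 := coord_le_l2norm (fun k => nabla s k t) (j, l).
rewrite normrM (le_trans (ler_pM _ _ h1 h2))// -expr2.
by move: (mulr_ge0 N2 N5) N5 N6 s_g1; lra.
Qed.

Let sdds_le i j k l : `|s k t * partial j (partial i (s l)) t| <= g1.
Proof.
have h1 := coord_le_l2norm (fun k => s k t) k.
have h2 := coord_le_l2norm (fun k => nabla (nabla s) k t) (j, (i, l)).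
rewrite normrM (le_trans (ler_pM _ _ h1 h2))//.
by move: (sqr_ge0 (l2norm (fun k => nabla s k t))) N5 N6 s_g1; lra.
Qed.

Let n20 : 0 <= n2%:R :> R. Proof. by []. Qed.
Let d0 : 0 <= d%:R :> R. Proof. by []. Qed.

Lemma qloss1_le i : `|qloss1 a b s h i t| <= loss_const * (f1 * f2 + f1 * f2 ^+ 2).
Proof.
have f10 := loss_f1_ge0; have f20 := loss_f2_ge0.
apply: (le_trans (bound (C := 2 * f2 ^+ 2 + 2 * f2) (E := f2) af _ _)) => [p|k|].
- rewrite (le_trans (ler_normD _ _))// lerD//.
    rewrite (le_trans (ler_normD _ _))// mulr_natl mulr2n expr2 !normrM.
    by apply: lerD; apply: ler_pM => //; [exact: loss_s_le|exact: loss_ds_le|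
      exact: loss_s_le|exact: loss_ds_le].
  by rewrite normrM ger0_norm// ler_wpM2l.
- by rewrite normrM ler_pM// loss_ds_le.
rewrite /loss_const natrM natrD.
have h1 : 0 <= n2%:R * (f1 * f2) by rewrite !mulr_ge0.
have h2 : 0 <= d%:R * (f1 * f2) by rewrite !mulr_ge0.
have h3 : 0 <= n2%:R * (f1 * f2 ^+ 2) by rewrite !mulr_ge0.
have h4 : 0 <= d%:R * (f1 * f2 ^+ 2) by rewrite !mulr_ge0.
rewrite (_ : n2%:R * _ + _ = 2 * (n2%:R * (f1 * f2)) + 2 * (n2%:R * (f1 * f2 ^+ 2)) +
  2 * (d%:R * (f1 * f2))); last by ring.
rewrite (_ : 6 * _ * _ = 6 * (n2%:R * (f1 * f2)) + 6 * (d%:R * (f1 * f2)) +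
  6 * (n2%:R * (f1 * f2 ^+ 2)) + 6 * (d%:R * (f1 * f2 ^+ 2))); last by ring.
by lra.
Qed.

Lemma qloss2_le i j : `|qloss2 a b s h i j t| <= loss_const * (f1 * g1).
Proof.
have f10 := loss_f1_ge0; have g10 := loss_g1_ge0.
apply: (le_trans (bound (C := 6 * g1) (E := g1) af _ _)) => [p|k|].
- rewrite (_ : 6 * g1 = (g1 + g1) + (g1 + g1) + 2 * g1); last by ring.
  rewrite (le_trans (ler_normD _ _))// lerD//.
    rewrite (le_trans (ler_normD _ _))// lerD// (le_trans (ler_normD _ _))// lerD//.
  by rewrite normrM ger0_norm// ler_wpM2l.
- by rewrite normrM ler_pM.
rewrite /loss_const natrM natrD.
have h2 : 0 <= d%:R * (f1 * g1) by rewrite !mulr_ge0.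
rewrite (_ : n2%:R * _ + _ = 6 * (n2%:R * (f1 * g1)) + 2 * (d%:R * (f1 * g1))); last by ring.
rewrite (_ : 6 * _ * _ = 6 * (n2%:R * (f1 * g1)) + 6 * (d%:R * (f1 * g1))); last by ring.
by lra.
Qed.

(* For [a] = m m^T and [s0] the score at the true parameter, this is the integrand
   of DSM. *)
Definition qdist (s0 : 'I_d -> R) : 'rV[R]_r -> R :=
  qloss a (fun=> 0) (fun k t => s k t - s0 k) (fun _ _ => 0).

Lemma qdist_le (s0 : 'I_d -> R) U : (forall k, `|s k t - s0 k| <= U) ->
  `|qdist s0 t| <= n2%:R * (f1 * U ^+ 2).
Proof.
move=> sU; apply: (le_trans (bound (C := U ^+ 2) (E := 0) af _ _)) => [p|k|].
- by rewrite mulr0 addr0 normrM expr2 ler_pM.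
- by rewrite mul0r mulr0 normr0.
by rewrite !mulr0 addr0.
Qed.

(** [U] is left free: a constant bound on the centred score gives the domination by [b1], a
    Lipschitz bound the linear growth required in [bD2]. *)
Lemma qdist1_le (s0 : 'I_d -> R) U i : (forall k, `|s k t - s0 k| <= U) ->
  `|qloss1 a (fun=> 0) (fun k t => s k t - s0 k) (fun _ _ => 0) i t| <=
  n2%:R * (f1 * (2 * (U * f2))).
Proof.
move=> sU; apply: (le_trans (bound (C := 2 * (U * f2)) (E := 0) af _ _)) => [p|k|].
- rewrite [X in _ + 2 * X](derive_cst _ _ _) mulr0 addr0 !partial_subr.
  rewrite (le_trans (ler_normD _ _))// mulr_natl mulr2n !normrM.
  by apply: lerD; apply: ler_pM => //; exact: loss_ds_le.
- by rewrite mul0r mulr0 normr0.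
by rewrite !mulr0 addr0.
Qed.

(** Centring at the point of evaluation makes the undifferentiated factors vanish; only products of
    first derivatives survive. *)
Lemma qdist2E i j : qloss2 a (fun=> 0) (fun k z => s k z - s k t) (fun _ _ => 0) i j t =
  \sum_q a q * (partial j (s q.1) t * partial i (s q.2) t) +
  \sum_q a q * (partial i (s q.1) t * partial j (s q.2) t).
Proof.
rewrite /qloss2 [X in _ + X]big1 => [|k _]; last by rewrite mulr0 mul0r.
have p0 : partial j (partial i (fun _ : 'rV[R]_r => 0 : R)) t = 0.
  rewrite (_ : partial i _ = fun=> 0) /partial ?derive_cst//.
  by apply/funext => z; rewrite derive_cst.
have alg (A x y B C D1 D2 D3 D4 E1 E2 E3 E4 Z : R) : x = 0 -> y = 0 -> Z = 0 ->
    D1 = E1 -> D2 = E2 -> D3 = E3 -> D4 = E4 ->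
    A * (x * B + D1 * D2 + (y * C + D3 * D4) + 2 * Z) = A * (E2 * E1) + A * (E3 * E4).
  by move=> -> -> -> -> -> -> ->; ring.
rewrite [LHS]addr0 -big_split; apply: eq_bigr => q _ /=.
by apply: alg; [exact: subrr|exact: subrr|exact: p0|exact: partial_subr|exact: partial_subr|
  exact: partial_subr|exact: partial_subr].
Qed.

End QuadraticLossBounds.

Lemma unitmx_scale2 (R : realType) n (A : 'M[R]_n) : A \in unitmx -> 2 *: A \in unitmx.
Proof. by move=> uA; rewrite unitmxZ// unitfE pnatr_eq0. Qed.

Lemma sandwich_scale2 (R : realType) n (A B : 'M[R]_n) : A^T = A -> A \in unitmx ->
  4^-1 *: (invmx A *m B *m invmx A) = (invmx (2 *: A))^T *m B *m invmx (2 *: A).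
Proof.
move=> sA uA; have u2 := unitmx_scale2 uA.
rewrite trmx_inv linearZ /= sA invmxZ// -!scalemxAl -scalemxAr scalerA.
by rewrite -invfM -natrM.
Qed.

(** * Score matching satisfies the conditions on M-estimators *)

Section ScoreMatchingEstimator.
Variables (R : realType) (d r : nat) (X : set 'rV[R]_d) (Theta : set 'rV[R]_r).
Hypothesis oX : open X.
Variables (P : 'rV[R]_r -> probability 'rV[R]_d R) (p : 'rV[R]_r -> 'rV[R]_d -> R).
Variable m : 'rV[R]_d -> 'M[R]_d.
Hypothesis m_diff : forall x i j, X x -> differentiable (fun y => diffusion m y i j) x.
Hypothesis logp_diff : forall theta x, Theta theta -> X x ->
  twice_differentiable (fun y => ln (p theta y)) x.
Variables (ts : 'rV[R]_r) (eps : R).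
Hypothesis eps_gt0 : 0 < eps.
Hypothesis ball_Theta : l2_closed_ball ts eps `<=` Theta.
Variables (f1 f2 g1 : 'rV[R]_d -> R).
Let Q : probability 'rV[R]_d R := P ts.
Hypothesis f1f2_L2 : (fun x => f1 x * f2 x) \in Lfun Q 2%:E.
Hypothesis f1f2f2_L2 : (fun x => f1 x * f2 x ^+ 2) \in Lfun Q 2%:E.
Hypothesis f1g1_L1 : (fun x => f1 x * g1 x) \in Lfun Q 1%:E.
Variables (G : set 'rV[R]_d) (mG : measurable G) (QG : Q (~` G) = 0%E) (GX : G `<=` X).
Let a x (q : 'I_d * 'I_d) := diffusion m x q.1 q.2.
Let b x k := div_mx (diffusion m) x k ord0.
Let s := log_grad p.
Let h := log_hess p.
Hypothesis G_coef : forall x, G x -> l2norm (a x) + l2norm (b x) <= f1 x.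
Hypothesis G_diff : forall x t, G x -> l2_closed_ball ts eps t ->
  (forall k, twice_differentiable (s x k) t) /\ (forall q, twice_differentiable (h x q) t).
Hypothesis G_f2 : forall x t, G x -> l2_closed_ball ts eps t ->
  l2norm (fun k => s x k t) + l2norm (fun k => nabla (s x) k t) +
  l2norm (fun k => nabla (h x) k t) <= f2 x.
Hypothesis G_g1 : forall x t, G x -> l2_closed_ball ts eps t ->
  l2norm (fun k => nabla (s x) k t) ^+ 2 +
  l2norm (fun k => s x k t) * l2norm (fun k => nabla (nabla (s x)) k t) +
  l2norm (fun k => nabla (nabla (s x)) k t) +
  l2norm (fun k => nabla (nabla (h x)) k t) <= g1 x.

(** The sup-norm ball of this radius lies in the Euclidean ball of radius [eps], as [r * del^2] is
    at most [((r + 1) * del)^2]; the successor covers [r = 0]. *)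
Let del := eps / r.+1%:R.

Let del_gt0 : 0 < del. Proof. by rewrite divr_gt0. Qed.

Let ball_l2 z : `|z| < del -> l2_closed_ball ts eps (ts + z).
Proof.
move=> zd; rewrite /l2_closed_ball /= addrC addKr /l2norm.
rewrite -[leRHS](ger0_norm (ltW eps_gt0)) -sqrtr_sqr ler_wsqrtr//.
apply: (@le_trans _ _ (\sum_(i < r) del ^+ 2)).
  apply: ler_sum => i _; rewrite -[X in X <= _]real_normK ?num_real//.
  by rewrite lerXn2r ?nnegrE ?(ltW del_gt0)// (le_trans (coord_le_norm _ _))// ltW.
rewrite sumr_const card_ord -[_ *+ r]mulr_natl.
rewrite [X in _ <= X ^+ 2](_ : eps = r.+1%:R * del); last by rewrite mulrC divfK// pnatr_eq0.
rewrite [X in _ <= X]exprMn ler_wpM2r ?sqr_ge0// -natrX ler_nat.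
by rewrite expnS expn1 (leq_trans (leqnSn r))// leq_pmulr.
Qed.

Let F t x := qloss (a x) (b x) (s x) (h x) t.
Let s0 x k := s x k ts.
Let D t x := qdist (a x) (s x) (s0 x) t.

Lemma dsm_loss_qloss t x : Theta t -> X x -> dsm_loss m (p t) x = F t x.
Proof.
by move=> Tt Xx; rewrite dsm_lossE// => [i j|]; [exact: m_diff|exact: logp_diff].
Qed.

Lemma dsm_dist_qdist t x :
  (let u := (m x)^T *m (score (p ts) x - score (p t) x) in dotc u u) = D t x.
Proof.
rewrite /= dotc_diffusion /D /qdist /qloss [X in _ = _ + X]big1; last first.
  by move=> k _; rewrite mulr0 mul0r.
rewrite addr0; apply: eq_bigr => q _; rewrite mulr0 addr0; congr (_ * _).
have sE k : (score (p ts) x - score (p t) x) k ord0 = - (s x k t - s0 x k).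
  by rewrite mxE [X in _ + X]mxE /score !mxE opprB.
exact: (etrans (f_equal2 *%R (sE q.1) (sE q.2)) (mulrNN _ _)).
Qed.

Let mX : measurable X. Proof. exact: sub_sigma_algebra. Qed.

Let measurable_a q : measurable_fun X (fun x => a x q).
Proof.
apply: open_continuous_measurable_Rn => // x Xx.
by apply: differentiable_continuous; exact: m_diff.
Qed.

Let measurable_b k : measurable_fun X (fun x => b x k).
Proof.
rewrite /b /div_mx; under eq_fun do rewrite mxE.
apply: measurable_sum => j.
by apply: measurable_partial => // x Xx; exact: m_diff.
Qed.

Let measurable_s t k : Theta t -> measurable_fun X (fun x => s x k t).
Proof.
move=> Tt; apply: measurable_partial => // x Xx.
exact: nbhs_singleton (logp_diff Tt Xx).1.
Qed.

Let measurable_h t q : Theta t -> measurable_fun X (fun x => h x q t).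
Proof. by move=> Tt; apply: measurable_partial => // x Xx; exact: (logp_diff Tt Xx).2. Qed.

Let measurable_F t : Theta t -> measurable_fun X (F t).
Proof.
move=> Tt; apply: measurable_funD; apply: measurable_sum => k.
  apply: measurable_funM; first exact: measurable_a.
  apply: measurable_funD; first by apply: measurable_funM; exact: measurable_s.
  by apply: measurable_funM => //; exact: measurable_h.
by apply: measurable_funM; [apply: measurable_funM => //; exact: measurable_b|exact: measurable_s].
Qed.

Let ball0 : l2_closed_ball ts eps ts.
Proof. by have := @ball_l2 0; rewrite addr0 normr0; apply. Qed.

Let measurable_D t : Theta t -> measurable_fun X (D t).
Proof.
move=> Tt; apply: measurable_funD; apply: measurable_sum => k.
  apply: measurable_funM; first exact: measurable_a.
  apply: measurable_funD => //; apply: measurable_funM; apply: measurable_funB;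
    by apply: measurable_s => //; exact: ball_Theta.
apply: measurable_funM => //.
by apply: measurable_funB; apply: measurable_s => //; exact: ball_Theta.
Qed.

Let ds x k z : G x -> `|z| < del -> differentiable (s x k) (ts + z).
Proof. by move=> Gx /ball_l2 /(G_diff Gx) [H _]; exact: nbhs_singleton (H k).1. Qed.

Let dh x q z : G x -> `|z| < del -> differentiable (h x q) (ts + z).
Proof. by move=> Gx /ball_l2 /(G_diff Gx) [_ H]; exact: nbhs_singleton (H q).1. Qed.

Let dds x k i z : G x -> `|z| < del -> differentiable (partial i (s x k)) (ts + z).
Proof. by move=> Gx /ball_l2 /(G_diff Gx) [H _]; exact: (H k).2. Qed.

Let ddh x q i z : G x -> `|z| < del -> differentiable (partial i (h x q)) (ts + z).
Proof. by move=> Gx /ball_l2 /(G_diff Gx) [_ H]; exact: (H q).2. Qed.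

Let v x k t := s x k t - s0 x k.

Let partial_v x k i : partial i (v x k) = partial i (s x k).
Proof. by apply/funext => t; rewrite /v partial_subr. Qed.

Let dv x k z : G x -> `|z| < del -> differentiable (v x k) (ts + z).
Proof. by move=> Gx zd; apply: differentiableB => //; exact: ds. Qed.

Let ddv x k i z : G x -> `|z| < del -> differentiable (partial i (v x k)) (ts + z).
Proof. by rewrite partial_v; exact: dds. Qed.

Let partial_cst0 i : partial i (fun _ : 'rV[R]_r => 0 : R) = fun=> 0.
Proof. by apply/funext => t; rewrite /partial derive_cst. Qed.

Let dd0 i t : differentiable (partial i (fun _ : 'rV[R]_r => 0 : R)) t.
Proof. by rewrite partial_cst0. Qed.

Let v_le x k z : G x -> `|z| < del -> `|v x k (ts + z)| <= f2 x + f2 x.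
Proof.
move=> Gx zd; rewrite (le_trans (ler_normB _ _))// lerD//.
  exact: (loss_s_le (G_f2 Gx (ball_l2 zd)) k).
exact: (loss_s_le (G_f2 Gx ball0) k).
Qed.

Let v_lip x k z : G x -> `|z| < del -> `|v x k (ts + z)| <= r%:R * f2 x * `|z|.
Proof.
move=> Gx zd; apply: (mean_value_bound (del := del)) => // y.
  exact: ds.
by move=> j yd; exact: (loss_ds_le (G_f2 Gx (ball_l2 yd)) j k).
Qed.

Let f10 x : G x -> 0 <= f1 x.
Proof. by move=> Gx; exact: loss_f1_ge0 (G_coef Gx). Qed.

Let f20 x : G x -> 0 <= f2 x.
Proof. by move=> Gx; exact: loss_f2_ge0 (G_f2 Gx ball0). Qed.

Let n2 : R := #|{: 'I_d * 'I_d}|%:R.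
Let K : R := @loss_const R d.
(** In [b1], the terms in [K] bound the gradient of [F], and [4 * n2] is for [D], whose centred
    score is at most [2 * f2 x]. In [b2] the centred score is instead bounded by [r * f2 x] times
    the displacement. *)
Let b1 x := K * (f1 x * f2 x) + (K + 4 * n2) * (f1 x * f2 x ^+ 2).
Let b2 x := n2 * (2 * r%:R) * (f1 x * f2 x ^+ 2).
Let b3 x := K * (f1 x * g1 x).

Let K0 : 0 <= K. Proof. by []. Qed.
Let n20 : 0 <= n2. Proof. by []. Qed.

Let fin_Q : Q setT \is a fin_num. Proof. by rewrite probability_setT. Qed.

Let i12 : Q.-integrable setT (EFin \o (fun x => f1 x * f2 x)).
Proof. by apply/Lfun1_integrable; exact: (Lfun_subset12 fin_Q f1f2_L2). Qed.

Let i122 : Q.-integrable setT (EFin \o (fun x => f1 x * f2 x ^+ 2)).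
Proof. by apply/Lfun1_integrable; exact: (Lfun_subset12 fin_Q f1f2f2_L2). Qed.

Let i1g : Q.-integrable setT (EFin \o (fun x => f1 x * g1 x)).
Proof. exact/Lfun1_integrable. Qed.

Let ib1 : Q.-integrable setT (EFin \o b1).
Proof.
exact: (integrableD measurableT (integrableZl measurableT K i12)
  (integrableZl measurableT (K + 4 * n2) i122)).
Qed.

Let ib2 : Q.-integrable setT (EFin \o b2).
Proof. exact: (integrableZl measurableT (n2 * (2 * r%:R)) i122). Qed.

Let ib3 : Q.-integrable setT (EFin \o b3).
Proof. exact: (integrableZl measurableT K i1g). Qed.

Let Theta_ball z : `|z| < del -> Theta (ts + z).
Proof. by move=> /ball_l2; exact: ball_Theta. Qed.

Let mGF t : Theta t -> measurable_fun G (F t).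
Proof. by move=> Tt; exact: measurable_funS mX GX (measurable_F Tt). Qed.

Let mGD t : Theta t -> measurable_fun G (D t).
Proof. by move=> Tt; exact: measurable_funS mX GX (measurable_D Tt). Qed.

Let iD z : `|z| < del -> Q.-integrable G (EFin \o D (ts + z)).
Proof.
move=> zd; apply: (@le_integrable _ _ _ Q G mG _ (EFin \o (fun x => 4 * n2 * (f1 x * f2 x ^+ 2)))).
- by apply/measurable_EFinP; apply: mGD; exact: Theta_ball.
- move=> x Gx /=; rewrite lee_fin (le_trans _ (ler_norm _))//.
  rewrite (le_trans (qdist_le (G_coef Gx) (fun k => v_le k Gx zd)))// le_eqVlt.
  by apply/orP; left; apply/eqP; rewrite -/n2; ring.
- by apply: integrableS (integrableZl measurableT (4 * n2) i122).
Qed.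

Lemma integral_dsm_loss t : Theta t ->
  (\int[Q]_(x in X) (dsm_loss m (p t) x)%:E = \int[Q]_(x in G) (F t x)%:E)%E.
Proof.
move=> Tt; rewrite (integral_conull mG GX QG).
by apply: eq_integral => x /set_mem Gx; rewrite dsm_loss_qloss//; exact: GX.
Qed.

Lemma DSM_qdist t : DSM m X Q (p ts) (p t) = (\int[Q]_(x in G) (D t x)%:E)%E.
Proof.
rewrite /DSM (integral_conull mG GX QG).
by apply: eq_integral => x _; exact: (congr1 EFin (dsm_dist_qdist t x)).
Qed.

Variable c : R.
Hypothesis DSM_loss : forall theta, Theta theta -> DSM m X Q (p ts) (p theta) =
  (c%:E + \int[Q]_(x in X) (dsm_loss m (p theta) x)%:E)%E.

Let DFe z : `|z| < del -> (\int[Q]_(x in G) (D (ts + z) x)%:E =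
  c%:E + \int[Q]_(x in G) (F (ts + z) x)%:E)%E.
Proof.
by move=> /Theta_ball Tz; rewrite -DSM_qdist -integral_dsm_loss// DSM_loss.
Qed.

(** [D] is integrable by domination; the identity between the two integrals then makes that of [F]
    finite, and a measurable function with a finite integral is integrable. *)
Let iF z : `|z| < del -> Q.-integrable G (EFin \o F (ts + z)).
Proof.
move=> zd; have mF := mGF (Theta_ball zd).
apply/integrableP; split; first exact/measurable_EFinP.
rewrite (integral_fin_num_abs Q mG mF).
have := integrable_fin_num mG (iD zd); rewrite /comp (DFe zd).
by rewrite fin_numD => /andP[].
Qed.

Let DF z : `|z| < del ->
  \int[Q]_(x in G) D (ts + z) x = c + \int[Q]_(x in G) F (ts + z) x.
Proof.
move=> zd; rewrite /Rintegral (DFe zd) fineD//.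
exact: (integrable_fin_num mG (iF zd)).
Qed.

Let diffF x z : G x -> `|z| < del -> differentiable (F ^~ x) (ts + z).
Proof. by move=> Gx zd; apply: differentiable_qloss => q; [exact: ds|exact: dh]. Qed.

Let diffD x z : G x -> `|z| < del -> differentiable (D ^~ x) (ts + z).
Proof. by move=> Gx zd; apply: differentiable_qloss => q //; exact: dv. Qed.

Let diff2F x i z : G x -> `|z| < del -> differentiable (partial i (F ^~ x)) (ts + z).
Proof.
move=> Gx; move=> zd; apply: (@differentiable_partial_qloss _ _ _ (a x) (b x) (s x) (h x) ts del) => // k.
- by move=> z'; exact: ds.
- by move=> z'; exact: dh.
- by move=> j z'; exact: dds.
- by move=> j z'; exact: ddh.
Qed.

Let diff2Dz x i z : G x -> `|z| < del -> differentiable (partial i (D ^~ x)) (ts + z).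
Proof.
move=> Gx; move=> zd; apply: (@differentiable_partial_qloss _ _ _ (a x) (fun=> 0) (v x) (fun _ _ => 0) ts del) => // k.
- by move=> z'; exact: dv.
- by move=> j z'; exact: ddv.
Qed.

Let partialF x i z : G x -> `|z| < del ->
  partial i (F ^~ x) (ts + z) = qloss1 (a x) (b x) (s x) (h x) i (ts + z).
Proof. by move=> Gx zd; apply: partial_qloss => q; [exact: ds|exact: dh]. Qed.

Let partialD x i z : G x -> `|z| < del ->
  partial i (D ^~ x) (ts + z) = qloss1 (a x) (fun=> 0) (v x) (fun _ _ => 0) i (ts + z).
Proof. by move=> Gx zd; apply: partial_qloss => q //; exact: dv. Qed.

Let bF x i z : G x -> `|z| < del -> `|partial i (F ^~ x) (ts + z)| <= b1 x.
Proof.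
move=> Gx zd; rewrite partialF//.
rewrite (le_trans (qloss1_le (G_coef Gx) (G_f2 Gx (ball_l2 zd)) i))//.
rewrite /b1 mulrDr lerD2l; apply: ler_wpM2r; first by rewrite mulr_ge0 ?sqr_ge0 ?f10.
by rewrite lerDl mulr_ge0.
Qed.

Let bD x i z : G x -> `|z| < del -> `|partial i (D ^~ x) (ts + z)| <= b1 x.
Proof.
move=> Gx zd; rewrite partialD//.
have H := qdist1_le (G_coef Gx) (G_f2 Gx (ball_l2 zd)) i (fun k => v_le k Gx zd).
rewrite (le_trans H)// /b1 -/n2.
have h1 : 0 <= K * (f1 x * f2 x) by rewrite !mulr_ge0 ?f10 ?f20.
have h2 : 0 <= K * (f1 x * f2 x ^+ 2) by rewrite !mulr_ge0 ?f10 ?f20 ?sqr_ge0.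
rewrite (_ : n2 * _ = 4 * n2 * (f1 x * f2 x ^+ 2)); last by ring.
by rewrite [(K + _) * _]mulrDl; move: h1 h2; lra.
Qed.

Let bD2 x i z : G x -> `|z| < del -> `|partial i (D ^~ x) (ts + z)| <= b2 x * `|z|.
Proof.
move=> Gx zd; rewrite partialD//.
have H := qdist1_le (G_coef Gx) (G_f2 Gx (ball_l2 zd)) i (fun k => v_lip k Gx zd).
rewrite (le_trans H)// /b2 -/n2 le_eqVlt; apply/orP; left; apply/eqP; ring.
Qed.

Let bFF x i j z : G x -> `|z| < del ->
  `|partial j (partial i (F ^~ x)) (ts + z)| <= b3 x.
Proof.
move=> Gx zd; rewrite (@partial_partial_qloss _ _ _ (a x) (b x) (s x) (h x) ts del)//.
- exact: (qloss2_le (G_coef Gx) (G_g1 Gx (ball_l2 zd)) i j).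
- by move=> k z'; exact: ds.
- by move=> k z'; exact: dh.
- by move=> k l z'; exact: dds.
- by move=> k l z'; exact: ddh.
Qed.

(** The square of the bound on the gradient at [ts]; its integrability is where products of two
    square-integrable functions occur. *)
Let b4 x := K ^+ 2 * ((f1 x * f2 x) * (f1 x * f2 x) +
  ((f1 x * f2 x) * (f1 x * f2 x ^+ 2) + (f1 x * f2 x) * (f1 x * f2 x ^+ 2)) +
  (f1 x * f2 x ^+ 2) * (f1 x * f2 x ^+ 2)).

Let ib4 : Q.-integrable setT (EFin \o b4).
Proof.
have uu := (Lfun1_integrable _ _).1 (Lfun2_mul_Lfun1 f1f2_L2 f1f2_L2).
have uw := (Lfun1_integrable _ _).1 (Lfun2_mul_Lfun1 f1f2_L2 f1f2f2_L2).
have ww := (Lfun1_integrable _ _).1 (Lfun2_mul_Lfun1 f1f2f2_L2 f1f2f2_L2).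
exact: (integrableZl measurableT (K ^+ 2) (integrableD measurableT
  (integrableD measurableT uu (integrableD measurableT uw uw)) ww)).
Qed.

Let bF2 x i j : G x ->
  `|partial i (F ^~ x) (ts + 0) * partial j (F ^~ x) (ts + 0)| <= b4 x.
Proof.
move=> Gx; have z0 : `|0 : 'rV[R]_r| < del by rewrite normr0.
have bd k : `|partial k (F ^~ x) (ts + 0)| <= K * (f1 x * f2 x + f1 x * f2 x ^+ 2).
  by rewrite partialF//; exact: (qloss1_le (G_coef Gx) (G_f2 Gx (ball_l2 z0)) k).
rewrite normrM (le_trans (ler_pM _ _ (bd i) (bd j)))// le_eqVlt.
by apply/orP; left; apply/eqP; rewrite /b4; ring.
Qed.

Let diff2D x i : G x -> differentiable (partial i (D ^~ x)) ts.
Proof. by move=> Gx; have := @diff2Dz x i 0 Gx; rewrite addr0 normr0; apply. Qed.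

Let near_F x i : G x ->
  partial i (fun t => dsm_loss m (p t) x) ts = partial i (F ^~ x) (ts + 0).
Proof.
move=> Gx; rewrite addr0; apply: near_eq_derive; apply/nbhs_ballP; exists del => //= t.
rewrite -ball_normE /= => tb; rewrite dsm_loss_qloss//; last exact: GX.
by rewrite -[t](subrK ts) addrC; apply: Theta_ball; rewrite distrC.
Qed.

Let dscoreE i x k : dscore p i ts x k ord0 = partial i (s x k) ts.
Proof.
rewrite /dscore mxE; congr (partial i _ ts); apply/funext => t.
by rewrite /score mxE.
Qed.

Let fisher i j x := dotc ((m x)^T *m dscore p i ts x) ((m x)^T *m dscore p j ts x).

Let fisherE i j x : fisher i j x =
  \sum_q a x q * (partial i (s x q.1) ts * partial j (s x q.2) ts).
Proof.
rewrite /fisher dotc_diffusion; apply: eq_bigr => q _.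
exact: (congr1 (fun z => a x q * z) (f_equal2 *%R (dscoreE i x q.1) (dscoreE j x q.2))).
Qed.

Let fisherC i j x : fisher i j x = fisher j i x.
Proof. exact: dotcC. Qed.

Let ddDE x i j : G x -> partial j (partial i (D ^~ x)) ts = 2 * fisher i j x.
Proof.
move=> Gx; have z0 : `|0 : 'rV[R]_r| < del by rewrite normr0.
have := @partial_partial_qloss _ _ _ (a x) (fun=> 0) (v x) (fun _ _ => 0) ts del.
move=> /(_ (fun k z => @dv x k z Gx) (fun _ z _ => @differentiable_cst _ _ _ 0 (ts + z))
  (fun k l z => @ddv x k l z Gx) (fun _ l z _ => dd0 l (ts + z)) i j 0 z0).
rewrite addr0 => ->; rewrite qdist2E.
have -> : 2 * fisher i j x = fisher j i x + fisher i j x.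
  by rewrite [X in _ = X + _]fisherC mulr_natl mulr2n.
by rewrite !fisherE.
Qed.

Hypothesis infoE : forall i j, dsm_info m X P p ts i j = \int[Q]_(x in X) fisher i j x.
Hypothesis info_inv : dsm_info m X P p ts \in unitmx.

Let Rintegral_G (f : 'rV[R]_d -> R) : \int[Q]_(x in X) f x = \int[Q]_(x in G) f x.
Proof. by rewrite /Rintegral (integral_conull mG GX QG). Qed.

Let infoC : (dsm_info m X P p ts)^T = dsm_info m X P p ts.
Proof.
apply/matrixP => i j; rewrite mxE !infoE.
by apply: eq_Rintegral => x _; rewrite fisherC.
Qed.

Section Estimator.
Context {dO : measure_display} {Omega : measurableType dO} (Pr : probability Omega R).
Variables (Xs : nat -> {RV Pr >-> 'rV[R]_d}) (Xs_iid : iid_from Xs Q).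
Variable theta_hat : nat -> {RV Pr >-> 'rV[R]_r}.
Hypothesis theta_hat_argmin : forall n, (0 < n)%N -> {ae Pr, forall w, is_argmin Theta
  (fun theta => n%:R^-1 * \sum_(i < n) dsm_loss m (p theta) (Xs i w)) (theta_hat n w)}.
Hypothesis theta_hat_cvg : cvg_in_probability theta_hat ts.

Let dev k w := theta_hat k w - ts.

Let measurable_dev k : measurable_fun setT (dev k).
Proof. by apply: measurable_rVD => //; exact: measurable_funP. Qed.

Let dev_small dlt : 0 < dlt -> whp Pr (fun k => [set w | `|dev k w| <= dlt]).
Proof.
move=> dlt0 e e0; have /fine_cvgP[fin cv] := theta_hat_cvg dlt0.
apply: filterS2 fin (cvgr_le _ cv _ e0) => k fk le_e.
exists [set w | dlt <= l2norm ((theta_hat k w - ts) ord0)]; split.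
- have ml : measurable_fun setT (fun w => l2norm (dev k w ord0)).
    apply: (measurableT_comp (continuous_measurable_fun (@sqrt_continuous R))).
    apply: measurable_sum => i; apply: measurable_funX; exact: measurable_coord_fun.
  rewrite (_ : [set w | _] = (fun w => l2norm (dev k w ord0)) @^-1` `[dlt, +oo[).
    by rewrite -[X in measurable X]setTI; exact: ml.
  by apply/seteqP; split => w /=; rewrite in_itv /= andbT.
- by rewrite -[leLHS]fineK// lee_fin.
move=> w /negP; rewrite -ltNge => lw /=; apply: norm_rV_le => [|i]; first exact: ltW.
by rewrite (le_trans _ (ltW lw))//; exact: (coord_le_l2norm (dev k w ord0) i).
Qed.

(** Off a null event and a small one, the estimator minimizes the empirical loss and every
    observation lies in [G], where the loss is [F]. *)
Let dev_min : whp Pr (fun k => [set w | forall z, `|z| < del ->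
  \sum_(i < k) F (ts + dev k w) (Xs i w) <= \sum_(i < k) F (ts + z) (Xs i w)]).
Proof.
move=> e e0; apply: filterS2 (nbhs_infty_gt 0) (whp_good Xs_iid mG QG e0).
move=> k k0 [B [mB PB BG]].
have [A [mA A0 subA]] := theta_hat_argmin k0; have {}A0 : Pr A = 0%E := A0.
exists (A `|` B); split; first exact: measurableU.
  rewrite (le_trans (measureU2 _ _ _))// -[leRHS]add0e; apply: leeD => //.
  exact: (eq_ind_r (fun z => (z <= 0)%E) (lexx _) A0).
rewrite setCU => w [Aw Bw] z zd.
have [Th argmin] : is_argmin Theta
    (fun theta => k%:R^-1 * \sum_(i < k) dsm_loss m (p theta) (Xs i w)) (theta_hat k w).
  by apply: contrapT => nw; apply: Aw; exact: subA.
have sumE t : Theta t ->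
    \sum_(i < k) dsm_loss m (p t) (Xs i w) = \sum_(i < k) F t (Xs i w).
  by move=> Tt; apply: eq_bigr => i _; apply: (dsm_loss_qloss Tt); apply: GX; exact: (BG w Bw i).
have le1 := argmin _ (Theta_ball zd); rewrite ler_pM2l ?invr_gt0 ?ltr0n// in le1.
have tE : theta_hat k w = ts + dev k w by rewrite /dev addrC subrK.
have transport (x y x' y' : R) : x = x' -> y = y' -> x <= y -> x' <= y' by move=> -> ->.
exact: (transport _ _ _ _ (etrans (sumE _ Th)
  (congr1 (fun t => \sum_(i < k) F t (Xs i w)) tE)) (sumE _ (Theta_ball zd)) le1).
Qed.

Theorem dsm_estimator_normal : exists nu : probability 'rV[R]_r R,
  is_multivariate_normal nu 0 (dsm_asymptotic_cov m X P p ts) /\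
  cvg_in_distribution Pr (fun n w => Num.sqrt n%:R *: (theta_hat n w - ts)) nu.
Proof.
pose Gam : 'M[R]_r := \matrix_(j, i) \int[Q]_(x in G) partial j (partial i (D ^~ x)) ts.
pose S : 'M[R]_r := \matrix_(i, j) \int[Q]_(x in G)
  (partial i (F ^~ x) (ts + 0) * partial j (F ^~ x) (ts + 0)).
have GamE : Gam = 2 *: dsm_info m X P p ts.
  apply/matrixP => j i; rewrite [LHS]mxE [RHS]mxE infoE Rintegral_G.
  (* Taking the factor 2 out of the integral requires [fisher] to be integrable, which is inherited
     from the Hessian of [D]. *)
  have iH := integrable_hessian mG del_gt0 iF iD DF diffF diffD diff2F diff2D
    ib1 ib2 ib3 bF bD bD2 bFF i j.
  have half (y : R) : 2^-1 * (2 * y) = y by rewrite mulrA mulVf ?pnatr_eq0// mul1r.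
  have hE x : G x -> 2^-1 * partial j (partial i (D ^~ x)) ts = fisher j i x.
    move=> Gx; exact: (etrans (congr1 (fun z => 2^-1 * z) (ddDE i j Gx))
      (etrans (half _) (fisherC i j x))).
  have ifish : Q.-integrable G (EFin \o fisher j i).
    apply: (eq_integrable mG _ _ _ (integrableZl mG 2^-1 iH)) => x /set_mem Gx.
    exact: (congr1 EFin (hE x Gx)).
  rewrite -(RintegralZl _ mG ifish); apply: eq_Rintegral => x /set_mem Gx.
  exact: (etrans (ddDE i j Gx) (congr1 (fun z => 2 * z) (fisherC i j x))).
have SE : dsm_Sigma m X P p ts = S.
  apply/matrixP => i j; rewrite [LHS]mxE [RHS]mxE Rintegral_G.
  by apply: eq_Rintegral => x /set_mem Gx; rewrite !near_F.
have uGam : Gam \in unitmx by rewrite GamE; exact: (unitmx_scale2 info_inv).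
have [nu [Nnu cv]] := m_estimator_normal Xs_iid mG QG del_gt0 iF iD DF diffF diffD diff2F diff2D
  ib1 ib2 ib3 bF bD bD2 bFF ib4 bF2 measurable_dev dev_small dev_min uGam.
exists nu; split; last exact: cv.
suff -> : dsm_asymptotic_cov m X P p ts = (invmx Gam)^T *m S *m invmx Gam by exact: Nnu.
have covE := @sandwich_scale2 R r (dsm_info m X P p ts) S infoC info_inv.
rewrite /dsm_asymptotic_cov SE covE GamE; reflexivity.
Qed.

End Estimator.

End ScoreMatchingEstimator.

Theorem theorem6 (R : realType) (d r : nat)
  (X : set 'rV[R]_d) (Theta : set 'rV[R]_r)
  (oX : open X) (oTheta : open Theta)
  (P : 'rV[R]_r -> probability 'rV[R]_d R) (p : 'rV[R]_r -> 'rV[R]_d -> R)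
  (Pp : forall theta, Theta theta -> is_positive_density X (P theta) (p theta))
  (m : 'rV[R]_d -> 'M[R]_d)
  (* F_theta is defined on X *)
  (m_diff : forall x i j, X x -> differentiable (fun y => diffusion m y i j) x)
  (logp_diff : forall theta x, Theta theta -> X x ->
     twice_differentiable (fun y => ln (p theta y)) x)
  (theta_star : 'rV[R]_r)
  (* int F_theta dQ is the theta-dependent part of DSM, where Q = P theta_star *)
  (DSM_loss : exists c : R, forall theta, Theta theta ->
     DSM m X (P theta_star) (p theta_star) (p theta) =
     (c%:E + \int[P theta_star]_(x in X) (dsm_loss m (p theta) x)%:E)%E)
  (star_argmin_DSM : is_argmin Theta
     (fun theta => DSM m X (P theta_star) (p theta_star) (p theta)) theta_star)
  (star_argmin : is_argmin Theta
     (fun theta => \int[P theta_star]_(x in X) (dsm_loss m (p theta) x)%:E)%E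
     theta_star)
  (* the components of the information tensor at theta_star *)
  (infoE : forall i j, dsm_info m X P p theta_star i j =
     \int[P theta_star]_(x in X)
       dotc ((m x)^T *m dscore p i theta_star x)
            ((m x)^T *m dscore p j theta_star x))
  (dO : measure_display) (Omega : measurableType dO) (Pr : probability Omega R)
  (Xs : nat -> {RV Pr >-> 'rV[R]_d}) (Xs_iid : iid_from Xs (P theta_star))
  (theta_hat : nat -> {RV Pr >-> 'rV[R]_r})
  (theta_hat_argmin : forall n, (0 < n)%N -> {ae Pr, forall w, is_argmin Theta
     (fun theta => n%:R^-1 * \sum_(i < n) dsm_loss m (p theta) (Xs i w))
     (theta_hat n w)})
  (theta_hat_cvg : cvg_in_probability theta_hat theta_star)
  (eps : R) (eps_gt0 : 0 < eps)
  (ball_Theta : l2_closed_ball theta_star eps `<=` Theta)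
  (logp_C2 : forall x, X x -> twice_continuously_differentiable_on
     (l2_closed_ball theta_star eps) (fun theta => ln (p theta x)))
  (dlogp_diff : {ae P theta_star, forall x, X x ->
     forall theta, l2_closed_ball theta_star eps theta ->
     (forall a, twice_differentiable (log_grad p x a) theta) /\
     (forall ab, twice_differentiable (log_hess p x ab) theta)})
  (f1 f2 g1 : 'rV[R]_d -> R)
  (f1_bound : {ae P theta_star, forall x, X x ->
     l2norm (fun ab : 'I_d * 'I_d => diffusion m x ab.1 ab.2) +
     l2norm (fun a => div_mx (diffusion m) x a ord0) <= f1 x})
  (f2_bound : {ae P theta_star, forall x, X x ->
     forall theta, l2_closed_ball theta_star eps theta ->
     l2norm (fun k => log_grad p x k theta) +
     l2norm (fun k => nabla (log_grad p x) k theta) +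
     l2norm (fun k => nabla (log_hess p x) k theta) <= f2 x})
  (f1f2_L2 : (fun x => f1 x * f2 x) \in Lfun (P theta_star) 2%:E)
  (f1f2f2_L2 : (fun x => f1 x * f2 x ^+ 2) \in Lfun (P theta_star) 2%:E)
  (g1_bound : {ae P theta_star, forall x, X x ->
     forall theta, l2_closed_ball theta_star eps theta ->
     l2norm (fun k => nabla (log_grad p x) k theta) ^+ 2 +
     l2norm (fun k => log_grad p x k theta) *
       l2norm (fun k => nabla (nabla (log_grad p x)) k theta) +
     l2norm (fun k => nabla (nabla (log_grad p x)) k theta) +
     l2norm (fun k => nabla (nabla (log_hess p x)) k theta) <= g1 x})
  (f1g1_L1 : (fun x => f1 x * g1 x) \in Lfun (P theta_star) 1%:E)
  (info_inv : dsm_info m X P p theta_star \in unitmx) :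
  exists nu : probability 'rV[R]_r R,
    is_multivariate_normal nu 0 (dsm_asymptotic_cov m X P p theta_star) /\
    cvg_in_distribution Pr
      (fun n w => Num.sqrt n%:R *: (theta_hat n w - theta_star)) nu.
Proof.
have Tts : Theta theta_star by case: star_argmin.
have mX : measurable X by exact: sub_sigma_algebra.
have X0 : P theta_star (~` X) = 0%E.
  have [_ _ ->] := Pp _ Tts; last exact: measurableC.
  by rewrite setICl integral_set0.
(* One measurable null set contains all the exceptional points of the four almost-everywhere
   hypotheses, so that on [G] they hold at every point. *)
have [A [mA A0 subA]] := filterI dlogp_diff (filterI f1_bound (filterI f2_bound g1_bound)).
pose G := X `\` A.
have mG : measurable G by exact: measurableD.
have QG : P theta_star (~` G) = 0%E.
  apply/eqP; rewrite eq_le measure_ge0 andbT /G setCD setUC.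
  rewrite (le_trans (measureU2 _ _ _))//; first exact: measurableC.
  apply: (le_trans (leeD (eq_ind_r (fun z => (z <= 0)%E) (lexx _) A0) (eq_ind_r (fun z => (z <= 0)%E) (lexx _) X0))).
  by rewrite adde0.
have GX : G `<=` X by move=> x [].
have cond x : G x -> [/\ (forall theta, l2_closed_ball theta_star eps theta ->
     (forall a, twice_differentiable (log_grad p x a) theta) /\
     (forall ab, twice_differentiable (log_hess p x ab) theta)),
   l2norm (fun ab : 'I_d * 'I_d => diffusion m x ab.1 ab.2) +
     l2norm (fun a => div_mx (diffusion m) x a ord0) <= f1 x,
   forall theta, l2_closed_ball theta_star eps theta ->
     l2norm (fun k => log_grad p x k theta) +
     l2norm (fun k => nabla (log_grad p x) k theta) +
     l2norm (fun k => nabla (log_hess p x) k theta) <= f2 x &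
   forall theta, l2_closed_ball theta_star eps theta ->
     l2norm (fun k => nabla (log_grad p x) k theta) ^+ 2 +
     l2norm (fun k => log_grad p x k theta) *
       l2norm (fun k => nabla (nabla (log_grad p x)) k theta) +
     l2norm (fun k => nabla (nabla (log_grad p x)) k theta) +
     l2norm (fun k => nabla (nabla (log_hess p x)) k theta) <= g1 x].
  move=> [Xx nA]; have [h1 [h2 [h3 h4]]] : _ x := contrapT (fun n => nA (subA x n)).
  by split; [exact: h1|exact: h2|exact: h3|exact: h4].
have [c DSMc] := DSM_loss.
apply: (@dsm_estimator_normal R d r X Theta oX P p m m_diff logp_diff theta_star eps eps_gt0
  ball_Theta f1 f2 g1 f1f2_L2 f1f2f2_L2 f1g1_L1 G mG QG GX _ _ _ _ c DSMc infoE info_inv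
  dO Omega Pr Xs Xs_iid theta_hat theta_hat_argmin theta_hat_cvg).
- by move=> x /cond[].
- by move=> x t /cond[+ _ _ _]; apply.
- by move=> x t /cond[_ _ + _]; apply.
- by move=> x t /cond[_ _ _ +]; apply.
Qed.
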